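(* Let $\eta:\mathbb{R}^d\to\mathbb{R}^d$ and $\vartheta:\mathbb{R}^d\times\mathbb{R}^d\to\mathbb{R}^d$ be Lipschitz continuous, and suppose that there is a Lipschitz function $\kappa:[0,\infty)\to\mathbb{R}$, constant and strictly negative outside of a bounded interval, such that $$\langle x-y,\,\eta(x)-\eta(y)\rangle\le\kappa(|x-y|)\,|x-y|^2\qquad\text{for all }x,y\in\mathbb{R}^d .$$ For $\tau\in\mathbb{R}$ and $x\in\mathbb{R}^d$, let $\mu_t^x$ denote the law at time $t$ of the solution $(X_t)$ of the nonlinear (McKean–Vlasov) SDE $$dX_t=\eta(X_t)\,dt+\tau\int\vartheta(X_t,y)\,\mu_t^x(dy)\,dt+dB_t,\quad X_0=x,\qquad \mu_t^x=\operatorname{Law}(X_t).$$ Then there is $\tau_0\in(0,\infty)$ such that for any $\tau\in\mathbb{R}$ with $|\tau|\le\tau_0$ and any $x,y\in\mathbb{R}^d$ there are constants $B,c\in(0,\infty)$ such that $$\|\mu_t^x-\mu_t^y\|_{TV}\le B\,e^{-ct}\qquad\text{for any }t\ge0 .$$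
   Context: $(B_t)$ is a $d$-dimensional Brownian motion; $|\cdot|$ and $\langle\cdot,\cdot\rangle$ are the Euclidean norm and inner product; $\|\cdot\|_{TV}$ is the total variation distance. Since $\eta$ and $\vartheta$ are Lipschitz, the McKean–Vlasov SDE has a unique strong solution for every deterministic initial value. The constants $B,c$ may depend on the initial values $x,y$. *)

(* Defs.v *)
From HB Require Import structures.
From mathcomp Require Import all_boot all_order all_algebra.
From mathcomp Require Import all_classical all_reals all_analysis.

Set Implicit Arguments.
Unset Strict Implicit.
Unset Printing Implicit Defensive.

Import Order.TTheory GRing.Theory Num.Theory.
Import numFieldNormedType.Exports.

Local Open Scope classical_set_scope.
Local Open Scope ring_scope.

(* The library puts no sigma-algebra on matrices; we use the Borel one. *)
HB.instance Definition _ (R : realType) (m n : nat) :=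
  @isMeasurable.Build (sigma_display (@open 'M[R]_(m, n))) 'M[R]_(m, n)
    <<s (@open 'M[R]_(m, n)) >>
    (@sigma_algebra0 _ setT _) (@sigma_algebraC _ _)
    (@sigma_algebra_bigcup _ setT _).

(* The library norm on 'rV[R]_n is the sup norm, hence these two. *)
Definition dotp (R : realType) (n : nat) (u v : 'rV[R]_n) : R :=
  \sum_(i < n) u 0 i * v 0 i.

Definition enorm (R : realType) (n : nat) (u : 'rV[R]_n) : R :=
  Num.sqrt (dotp u u).

Definition elipschitz (R : realType) (m n : nat)
    (f : 'rV[R]_m -> 'rV[R]_n) : Prop :=
  exists L : R, forall x y, enorm (f x - f y) <= L * enorm (x - y).

Definition tv_dist d (T : measurableType d) (R : realType)
    (mu nu : set T -> \bar R) : \bar R :=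
  ereal_sup [set `|mu A - nu A|%E | A in @measurable d T].

(* Continuous-time processes are indexed by R, and only their values at
   times t >= 0 are constrained. *)
Section processes.
Context (R : realType) (d : nat) (disp : measure_display)
  (Omega : measurableType disp) (P : probability Omega R).

Definition is_filtration (F : R -> set (set Omega)) : Prop :=
  [/\ forall t : R, 0 <= t -> sigma_algebra setT (F t),
      forall t : R, 0 <= t -> F t `<=` measurable
    & forall s t : R, 0 <= s -> s <= t -> F s `<=` F t].

Definition adapted (F : R -> set (set Omega))
    (X : R -> {RV P >-> 'rV[R]_d}) : Prop :=
  forall t : R, 0 <= t -> forall A, measurable A -> F t (X t @^-1` A).

Definition continuous_paths (X : R -> {RV P >-> 'rV[R]_d}) : Prop :=
  {ae P, forall w, {within [set t : R | 0 <= t],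
                    continuous (fun t => X t w)}}.

(* The last two clauses say that, for s < t, B_t - B_s has law N(0, (t - s) I)
   and is independent of F_s; the second parameter of normal_prob is the
   standard deviation. *)
Definition brownian_motion (F : R -> set (set Omega))
    (B : R -> {RV P >-> 'rV[R]_d}) : Prop :=
  [/\ adapted F B,
      {ae P, forall w, B 0 w = 0},
      continuous_paths B,
      forall s t : R, 0 <= s -> s < t ->
        forall A : 'I_d -> set R, (forall i, measurable (A i)) ->
        (P [set w | forall i, A i ((B t w - B s w) 0 i)%R] =
         \prod_(i < d) normal_prob 0%R (Num.sqrt (t - s)%R) (A i))%E
    & forall s t : R, 0 <= s -> s < t ->
        forall E, F s E -> forall A : set 'rV[R]_d, measurable A ->
        (P (E `&` [set w | A (B t w - B s w)%R]) =
         P E * P [set w | A (B t w - B s w)%R])%E].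

Definition mckean_vlasov_drift (eta : 'rV[R]_d -> 'rV[R]_d)
    (theta : 'rV[R]_d -> 'rV[R]_d -> 'rV[R]_d) (tau : R)
    (X : R -> {RV P >-> 'rV[R]_d}) (s : R) (w : Omega) : 'rV[R]_d :=
  \row_i (eta (X s w) 0 i +
          tau * \int[distribution P (X s)]_y (theta (X s w) y 0 i)).

(* As the noise is additive, the SDE is an integral equation holding path by
   path; at t = 0 it gives X_0 = x a.s. Library integrals have a default value
   for non-integrable functions, so the existence of both integrals is part of
   the definition. *)
Definition mckean_vlasov_solution (eta : 'rV[R]_d -> 'rV[R]_d)
    (theta : 'rV[R]_d -> 'rV[R]_d -> 'rV[R]_d) (tau : R) (x : 'rV[R]_d)
    (F : R -> set (set Omega)) (B X : R -> {RV P >-> 'rV[R]_d}) : Prop :=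
  let b := mckean_vlasov_drift eta theta tau X in
  [/\ adapted F X,
      continuous_paths X,
      forall s : R, 0 <= s -> forall z i,
        (distribution P (X s)).-integrable setT
          (fun y => (theta z y 0 i)%:E)
    & {ae P, forall w, forall t : R, 0 <= t -> forall i : 'I_d,
        lebesgue_measure.-integrable `[0, t] (fun s => (b s w 0 i)%:E) /\
        X t w 0 i = x 0 i + \int[lebesgue_measure]_(s in `[0, t]) b s w 0 i
                    + B t w 0 i}].

End processes.

(* mu is the flow of one-dimensional time marginals (Law(X_t))_t of a solution
   started at x, on some filtered probability space. *)
Definition mckean_vlasov_law (R : realType) (d : nat)
    (eta : 'rV[R]_d -> 'rV[R]_d) (theta : 'rV[R]_d -> 'rV[R]_d -> 'rV[R]_d)
    (tau : R) (x : 'rV[R]_d) (mu : R -> probability 'rV[R]_d R) : Prop :=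
  exists (disp : measure_display) (Omega : measurableType disp)
    (P : probability Omega R) (F : R -> set (set Omega))
    (B X : R -> {RV P >-> 'rV[R]_d}),
    [/\ is_filtration F,
        brownian_motion F B,
        mckean_vlasov_solution eta theta tau x F B X
      & forall t : R, 0 <= t -> forall A, measurable A ->
          mu t A = distribution P (X t) A].

(* Main.v *)
(* Over a short time [h] the flow of marginals is, up to [o(h)], an Euler step
   with Gaussian noise, so [\int g dmu_t] is approximated by iterating
   backwards [u |-> (z |-> E u (z + h b z + N(0, h I)))] from [g]. Two such
   recursions [U], [V], run with the drifts of the two flows, are compared by
   bounds [U_j z - V_j w <= F_j (|z - w|)]: under the reflection coupling of the
   two noises a bound [a r + c G_q r + beta], where [G_q r] is the expected sign
   of [r + N(0, q)], becomes the same bound at the drifted distance with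
   [q + 4 h] in place of [q]. For small [eps] and suitable [q], the concave
   function [eps r + G_q r] is contracted at an exponential rate: near 0 the
   noise flattens [G_q] faster than the drift expands, and far away the drift is
   contracting. Lipschitz functions thus see an exponentially small gap between
   the laws, up to the gap between the two mean-field terms; these are themselves
   integrals of Lipschitz functions, and for small [tau] the resulting inequality
   closes. Over the last unit of time, starting from [G_0 = sg] instead of a
   Lipschitz bound turns this into total variation: [G_(2t)] is Lipschitz for
   every [t > 0]. *)

Require Import Defs.
From HB Require Import structures.
From mathcomp Require Import all_boot all_order all_algebra.
From mathcomp Require Import all_classical all_reals all_analysis.
From mathcomp Require Import measurable_realfun.
From mathcomp Require Import ring lra.
Import Order.TTheory GRing.Theory Num.Theory.
Import numFieldNormedType.Exports.
Local Open Scope classical_set_scope.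
Local Open Scope ring_scope.
Set Implicit Arguments.
Unset Strict Implicit.
Unset Printing Implicit Defensive.

(** * Euclidean norm and bounded measurable functions *)

(** No coupled process is constructed: the two solutions may live on unrelated probability spaces,
    and the coupling survives only as an inequality between integrals of [U] and [V] over one
    Gaussian step. The 4 is the variance factor of reflection, under which the difference of the two
    noises is twice a normal of variance [h]. The estimates on the recursions are uniform in small
    [h]; a fixed time and a fixed Lipschitz test function only decide how small [h] has to be. The
    circularity to break is that the two drifts differ by the very mean-field gap to be bounded.
    Contraction is run at twice the rate [c] at which this gap is assumed to decay, so that the
    accumulated source still decays at rate [c]. For small [tau] a gap constant [K] then improves to
    [A0 + K / 2], and a crude moment bound on a bounded time interval supplies a first finite
    [K]. *)

Section euclidean.
Context {R : realType} {d : nat}.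
Implicit Types (u v w : 'rV[R]_d) (a : R).

Lemma dotpC u v : dotp u v = dotp v u.
Proof. by apply: eq_bigr => i _; rewrite mulrC. Qed.

Lemma dotpDl u v w : dotp (u + v) w = dotp u w + dotp v w.
Proof. by rewrite -big_split; apply: eq_bigr => i _; rewrite mxE mulrDl. Qed.

Lemma dotpDr u v w : dotp u (v + w) = dotp u v + dotp u w.
Proof. by rewrite dotpC dotpDl (dotpC v) (dotpC w). Qed.

Lemma dotpZl a u v : dotp (a *: u) v = a * dotp u v.
Proof. by rewrite /dotp mulr_sumr; apply: eq_bigr => i _; rewrite mxE mulrA. Qed.

Lemma dotpZr a u v : dotp u (a *: v) = a * dotp u v.
Proof. by rewrite dotpC dotpZl dotpC. Qed.

Lemma dotpNl u v : dotp (- u) v = - dotp u v.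
Proof. by rewrite -scaleN1r dotpZl mulN1r. Qed.

Lemma dotpNr u v : dotp u (- v) = - dotp u v.
Proof. by rewrite dotpC dotpNl dotpC. Qed.

Lemma dotp_ge0 u : 0 <= dotp u u.
Proof. by apply: sumr_ge0 => i _; rewrite -expr2 sqr_ge0. Qed.

Lemma enorm_ge0 u : 0 <= enorm u.
Proof. exact: sqrtr_ge0. Qed.

Lemma sqr_enorm u : enorm u ^+ 2 = dotp u u.
Proof. by rewrite sqr_sqrtr ?dotp_ge0. Qed.

Lemma enormZ a u : enorm (a *: u) = `|a| * enorm u.
Proof.
by rewrite /enorm dotpZl dotpZr mulrA -expr2 sqrtrM ?sqr_ge0// sqrtr_sqr.
Qed.

Lemma enormN u : enorm (- u) = enorm u.
Proof. by rewrite -scaleN1r enormZ normrN1 mul1r. Qed.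

Lemma enorm0 : enorm (0 : 'rV[R]_d) = 0.
Proof. by rewrite -(scale0r 0) enormZ normr0 mul0r. Qed.

Lemma enorm_distC u v : enorm (u - v) = enorm (v - u).
Proof. by rewrite -enormN opprB. Qed.

Lemma coord_le_enorm u i : `|u 0 i| <= enorm u.
Proof.
rewrite -(ler_pXn2r (n := 2)) ?nnegrE ?normr_ge0 ?enorm_ge0//.
rewrite sqr_enorm real_normK ?num_real// /dotp (bigD1 i)//= -expr2 lerDl.
by apply: sumr_ge0 => j _; rewrite -expr2 sqr_ge0.
Qed.

Lemma enorm_eq0 u : enorm u = 0 -> u = 0.
Proof.
move=> u0; apply/rowP => i; rewrite mxE; apply/eqP; rewrite -normr_le0 -u0.
exact: coord_le_enorm.
Qed.

Lemma dotp_le_enorm u v : dotp u v <= enorm u * enorm v.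
Proof.
have [u0|u0] := eqVneq (enorm u) 0.
  by rewrite (enorm_eq0 u0) -(scale0r (0 : 'rV[R]_d)) dotpZl mul0r enormZ normr0 !mul0r.
have up : 0 < enorm u by rewrite lt_neqAle eq_sym u0 enorm_ge0.
have [v0|v0] := eqVneq (enorm v) 0.
  by rewrite (enorm_eq0 v0) -(scale0r (0 : 'rV[R]_d)) dotpZr mul0r enormZ normr0 !mul0r mulr0.
have vp : 0 < enorm v by rewrite lt_neqAle eq_sym v0 enorm_ge0.
have := dotp_ge0 (enorm v *: u - enorm u *: v).
rewrite !(dotpDl, dotpDr, dotpNl, dotpNr, dotpZl, dotpZr) -!sqr_enorm (dotpC v u).
move=> H; have : 0 <= (2 * (enorm u * enorm v)) * (enorm u * enorm v - dotp u v) by nra.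
by rewrite pmulr_rge0 ?subr_ge0// mulr_gt0// mulr_gt0.
Qed.

Lemma enormD u v : enorm (u + v) <= enorm u + enorm v.
Proof.
rewrite -(ler_pXn2r (n := 2)) ?nnegrE ?addr_ge0 ?enorm_ge0//.
rewrite sqr_enorm !(dotpDl, dotpDr) (dotpC v u) -!sqr_enorm.
by have := dotp_le_enorm u v; nra.
Qed.

Lemma ler_enorm_dist u v w : enorm (u - w) <= enorm (u - v) + enorm (v - w).
Proof. by apply: le_trans (enormD _ _); rewrite addrA subrK. Qed.

Lemma enorm_le_sum u : enorm u <= \sum_i `|u 0 i|.
Proof.
rewrite -(ler_pXn2r (n := 2)) ?nnegrE ?sumr_ge0 ?enorm_ge0//.
rewrite sqr_enorm expr2 mulr_suml; apply: ler_sum => i _.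
rewrite -expr2 -[leLHS]real_normK ?num_real// expr2 ler_wpM2l//.
by rewrite (bigD1 i)//= lerDl sumr_ge0.
Qed.

Lemma enorm_le_bound u c : (forall i, `|u 0 i| <= c) -> enorm u <= d%:R * c.
Proof.
move=> uc; apply: le_trans (enorm_le_sum u) _.
apply: (@le_trans _ _ (\sum_(i < d) c)); first exact: ler_sum.
by rewrite sumr_const card_ord mulr_natl.
Qed.

End euclidean.

(** * Borel sets of row vectors *)

Section rV_measurability.
Context {R : realType} {d : nat}.
Implicit Types (u v : 'rV[R]_d).

Lemma measurable_open_rV (A : set 'rV[R]_d) : open A -> measurable A.
Proof. by move=> oA; apply: sub_sigma_algebra. Qed.

Lemma continuous_measurable_rV (f : 'rV[R]_d -> R) :
  continuous f -> measurable_fun setT f.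
Proof.
move=> cf; apply: (measurability _ (RGenOInfty.measurableE R)) => //.
move=> _ [_ [x ->] <-]; rewrite setTI; apply: measurable_open_rV.
by move/continuousP: cf; apply; exact: interval_open.
Qed.

Lemma measurable_coord (i : 'I_d) : measurable_fun setT (fun v : 'rV[R]_d => v 0 i).
Proof. by apply: continuous_measurable_rV => x; exact: coord_continuous. Qed.

Definition rectangle (A : 'I_d -> set R) : set 'rV[R]_d :=
  [set z | forall i, A i (z 0 i)].

Definition rectangles : set (set 'rV[R]_d) :=
  [set rectangle A | A in [set A | forall i, measurable (A i)]].

Lemma measurable_rectangle (A : 'I_d -> set R) :
  (forall i, measurable (A i)) -> measurable (rectangle A).
Proof.
move=> mA; rewrite (_ : rectangle A = \bigcap_i ((fun v : 'rV[R]_d => v 0 i) @^-1` A i)).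
  apply: fin_bigcap_measurable => // i _.
  by rewrite -[X in measurable X]setTI; exact: measurable_coord.
by apply/seteqP; split => z /= H i => [_|]; [exact: H|exact: (H i Logic.I)].
Qed.

Lemma rectanglesI : setI_closed rectangles.
Proof.
move=> _ _ [A mA <-] [B mB <-]; exists (fun i => A i `&` B i).
  by move=> i; exact: measurableI.
by apply/seteqP; split => z /= => [H|[H1 H2] i]; [split => i; case: (H i)|split].
Qed.

(** An open set is the union of the boxes it contains with rational centre and radius [n.+1%:R^-1];
    [pickle] enumerates these boxes. *)
Lemma open_rV_rectangles (U : set 'rV[R]_d) : open U -> <<s rectangles >> U.
Proof.
move=> oU.
pose b (k : 'rV[rat]_d * nat) i : set R := ball (ratr (k.1 0 i) : R) (k.2.+1%:R^-1).
pose F k := if `[< rectangle (b k) `<=` U >] then rectangle (b k) else set0.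
have sF k : <<s rectangles >> (F k).
  rewrite /F; case: ifP => _; last exact: sigma_algebra0.
  apply: sub_sigma_algebra; exists (b k) => // i; exact: measurable_ball.
rewrite (_ : U = \bigcup_k (if unpickle k is Some j then F j else set0)).
  apply: sigma_algebra_bigcup => k; case: unpickle => [j|]; first exact: sF.
  exact: sigma_algebra0.
apply/seteqP; split => z; last first.
  move=> [k _]; case: unpickle => // j; rewrite /F; case: ifPn => [/asboolP H|_//]; exact: H.
move=> Uz; have /nbhs_ballP[e /= e0 He] : nbhs z U by apply: open_nbhs_nbhs.
(* Half of [e]: a point of the box is within one radius of the centre, and the centre within one
   radius of [z]. *)
have [n _ /(_ n (leqnn n)) ne] := near_infty_natSinv_lt (PosNum (divr_gt0 e0 (ltr0n R 2))).
have n0 : 0 < n.+1%:R^-1 :> R by rewrite invr_gt0.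
have H i : exists q : rat, ratr q \in `](z 0 i - n.+1%:R^-1), (z 0 i + n.+1%:R^-1)[.
  by have [|q] := @rat_in_itvoo R (z 0 i - n.+1%:R^-1) (z 0 i + n.+1%:R^-1); last (by exists q); rewrite ltrBlDr -addrA ltrDl addr_gt0.
pose k : 'rV[rat]_d * nat := (\row_i xchoose (H i), n).
have bk i : `|ratr (k.1 0 i) - z 0 i| < n.+1%:R^-1.
  rewrite mxE; have := xchooseP (H i); rewrite in_itv /= => /andP[h1 h2].
  by rewrite ltr_distl h1 h2.
exists (pickle k) => //; rewrite pickleK /F; case: ifPn => [_ i|].
  by rewrite /b /ball/=; exact: bk.
move/asboolP => nH; exfalso; apply: nH => y /= yk; apply: He; split => // i j.
rewrite ord1 /ball/=; have := yk j; rewrite /b /ball/= => yj.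
rewrite -(subrK (ratr (k.1 0 j)) (z 0 j)) -addrA; apply: le_lt_trans (ler_normD _ _) _.
rewrite distrC (splitr e); apply: ltrD.
  exact: lt_trans (bk j) ne.
exact: lt_trans yj ne.
Qed.

Lemma measurable_rVE : @measurable _ 'rV[R]_d = <<s rectangles >>.
Proof.
apply/seteqP; split => A.
  apply: smallest_sub; first exact: smallest_sigma_algebra.
  exact: open_rV_rectangles.
apply: smallest_sub; first exact: sigma_algebra_measurable.
by move=> _ [B mB <-]; exact: measurable_rectangle.
Qed.

Lemma measurable_fun_rV disp (T : measurableType disp) (f : T -> 'rV[R]_d) :
  (forall i, measurable_fun setT (fun x => f x 0 i)) -> measurable_fun setT f.
Proof.
move=> mf; apply: (measurability _ measurable_rVE).
move=> _ [_ [A mA <-] <-]; rewrite setTI.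
rewrite (_ : _ @^-1` _ = \bigcap_i ((fun x => f x 0 i) @^-1` A i)).
  by apply: fin_bigcap_measurable => // i _; rewrite -[X in measurable X]setTI; exact: mf.
by apply/seteqP; split => z /= H i => [_|]; [exact: H|exact: (H i Logic.I)].
Qed.

(** Rectangles form a pi-system generating the Borel sets. Gaussian vectors and Brownian increments
    are prescribed on rectangles only; this determines their laws. *)
Lemma eq_prob_rV (mu nu : {measure set 'rV[R]_d -> \bar R}) :
  (mu setT < +oo)%E ->
  (forall A, (forall i, measurable (A i)) -> mu (rectangle A) = nu (rectangle A)) ->
  forall A, measurable A -> mu A = nu A.
Proof.
move=> mu1 H A mA.
apply: (measure_unique rectangles (fun=> setT)) => //.
- exact: measurable_rVE.
- exact: rectanglesI.
- move=> _; exists (fun=> setT) => //; by apply/seteqP; split.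
- by rewrite bigcup_const.
- by move=> _ [B mB <-]; exact: H.
Qed.

End rV_measurability.
(** The class in which test functions are kept: its members are integrable for every probability
    measure, so their integrals can be added and compared freely, and averaging over one variable
    does not leave it. *)
Definition bounded_measurable {R : realType} disp (T : measurableType disp) (f : T -> R) :=
  measurable_fun setT f /\ exists M : R, forall x, `|f x| <= M.

Section bounded_integrals.
Context {R : realType} {disp : measure_display} {T : measurableType disp}
  (P : probability T R).
Implicit Types f g : T -> R.

Lemma bmf_integrable f : bounded_measurable f -> P.-integrable setT (EFin \o f).
Proof.
move=> [mf [M fM]]; apply: measurable_bounded_integrable => //.
  exact: le_lt_trans (probability_le1 P measurableT) (ltry _).
exists M; split; first exact: num_real.
by move=> N MN x _; apply: le_trans (fM x) (ltW MN).
Qed.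

Lemma bmf_cst (c : R) : bounded_measurable (fun _ : T => c).
Proof. by split; [exact: measurable_cst|exists `|c|]. Qed.

Lemma bmfD f g : bounded_measurable f -> bounded_measurable g ->
  bounded_measurable (fun x => f x + g x).
Proof.
move=> [mf [M fM]] [mg [N gN]]; split; first exact: measurable_funD.
by exists (M + N) => x; apply: le_trans (ler_normD _ _) _; apply: lerD.
Qed.

Lemma bmfM f g : bounded_measurable f -> bounded_measurable g ->
  bounded_measurable (fun x => f x * g x).
Proof.
move=> [mf [M fM]] [mg [N gN]]; split; first exact: measurable_funM.
by exists (M * N) => x; rewrite normrM ler_pM.
Qed.

Lemma bmfN f : bounded_measurable f -> bounded_measurable (fun x => - f x).
Proof.
move=> [mf [M fM]]; split; last by exists M => x; rewrite normrN.
exact: measurableT_comp mf.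
Qed.

Lemma bmfB f g : bounded_measurable f -> bounded_measurable g ->
  bounded_measurable (fun x => f x - g x).
Proof. by move=> bf bg; apply: bmfD => //; exact: bmfN. Qed.

Lemma bmf_norm f : bounded_measurable f -> bounded_measurable (fun x => `|f x|).
Proof.
move=> [mf [M fM]]; split; last by exists M => x; rewrite normr_id.
exact: measurableT_comp.
Qed.

Lemma bmf_indic (A : set T) : measurable A -> bounded_measurable (\1_A : T -> R).
Proof.
move=> mA; split; first exact: measurable_indic.
by exists 1 => x; rewrite indicE; case: (_ \in _); rewrite ?normr1 ?normr0.
Qed.

Lemma prob_Rintegral_cst c : \int[P]_x c = c.
Proof.
rewrite Rintegral_cst// [X in _ * X](_ : _ = 1) ?mulr1//.
exact: (congr1 fine (probability_setT P)).
Qed.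

Lemma prob_Rintegral_indic (A : set T) : measurable A ->
  \int[P]_x (\1_A x : R) = fine (P A).
Proof. by move=> mA; rewrite /Rintegral integral_indic// setIT. Qed.

Lemma prob_le_Rintegral_cst f c : P.-integrable setT (EFin \o f) ->
  (forall x, f x <= c) -> \int[P]_x f x <= c.
Proof.
move=> fi fc; rewrite -[leRHS]prob_Rintegral_cst; apply: le_Rintegral => //.
exact/bmf_integrable/bmf_cst.
Qed.

Lemma prob_Rintegral_bound f M : measurable_fun setT f ->
  (forall x, `|f x| <= M) -> `|\int[P]_x f x| <= M.
Proof.
move=> mf fM.
have bf : bounded_measurable f by split => //; exists M.
apply: le_trans (le_normr_Rintegral _ (bmf_integrable bf)) _ => //.
by apply: prob_le_Rintegral_cst => //; exact/bmf_integrable/bmf_norm.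
Qed.

Lemma bounded_convergence (f_ : nat -> T -> R) f (M : R) :
  (forall n, measurable_fun setT (f_ n)) -> measurable_fun setT f ->
  (forall n x, `|f_ n x| <= M) ->
  (forall x, (f_ n x) @[n --> \oo] --> f x) ->
  (\int[P]_x f_ n x) @[n --> \oo] --> \int[P]_x f x.
Proof.
move=> mf_ mf fM cf.
have bfM x : `|f x| <= M.
  apply: (ler_cvg_to (cvg_norm (cf x)) (cvg_cst M)).
  by apply: nearW => n; exact: fM.
have bf : bounded_measurable f by split => //; exists M.
apply: fine_cvg; rewrite fineK; last exact/integrable_fin_num/bmf_integrable.
apply: (@dominated_cvg _ _ _ P setT measurableT (fun n => EFin \o f_ n) (EFin \o f) (fun=> M%:E)) => //.
- by move=> n; exact/measurable_EFinP.
- by move=> x _; apply: cvg_EFin; [exact: nearW|exact: cf].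
- exact/bmf_integrable/bmf_cst.
- by move=> n x _; rewrite lee_fin.
Qed.
End bounded_integrals.

(** * Lipschitz test functions and total variation *)

Definition elip {R : realType} {d : nat} (L : R) (g : 'rV[R]_d -> R) :=
  forall x y, `|g x - g y| <= L * enorm (x - y).

Section lipschitz_tests.
Context {R : realType} {d : nat}.
Implicit Types (g : 'rV[R]_d -> R) (L M : R).

Lemma enorm_le_normr (u : 'rV[R]_d) : enorm u <= d%:R * `|u|.
Proof.
apply: enorm_le_bound => i.
rewrite {2}/Num.Def.normr/= mx_normrE.
by apply: le_trans (le_bigmax _ _ (0, i)).
Qed.

Lemma elip_continuous L g : elip L g -> continuous g.
Proof.
move=> Lg x; apply/(@cvgrPdist_le _ _ _ (nbhs x) (nbhs_filter x)) => e e0.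
pose c : R := `|L| * d%:R + 1.
have c0 : 0 < c by rewrite ltr_wpDl// mulr_ge0.
near=> y; apply: le_trans (Lg x y) _.
apply: (@le_trans _ _ (c * `|x - y|)).
  apply: (@le_trans _ _ (`|L| * enorm (x - y))).
    by rewrite ler_wpM2r ?enorm_ge0// ler_norm.
  apply: (@le_trans _ _ (`|L| * (d%:R * `|x - y|))).
    by rewrite ler_wpM2l ?enorm_le_normr.
  by rewrite mulrA /c mulrDl mul1r lerDl.
rewrite mulrC -ler_pdivlMr//; near: y.
by apply: cvgr_dist_le; [exact: cvg_id|rewrite divr_gt0].
Unshelve. all: by end_near. Qed.

Lemma elip_measurable L g : elip L g -> measurable_fun setT g.
Proof. by move=> /elip_continuous; exact: continuous_measurable_rV. Qed.

Lemma ler_dist_max (a b u v : R) : `|Num.max a b - Num.max u v| <= `|a - u| + `|b - v|.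
Proof.
have := ler_norm (a - u); have := ler_norm (b - v).
have := ler_norm (u - a); have := ler_norm (v - b); rewrite (distrC v) (distrC u) ler_norml.
move: `|a - u| `|b - v| (normr_ge0 (a - u)) (normr_ge0 (b - v)) => n m n0 m0 h1 h2 h3 h4.
by rewrite /Num.max; case: ifPn; case: ifPn; rewrite -?leNgt => h5 h6; apply/andP; split; lra.
Qed.

Lemma elip_max L M f g : elip L f -> elip M g -> elip (Num.max L M) (fun x => Num.max (f x) (g x)).
Proof.
move=> Lf Mg x y.
have h1 : `|f x - f y| <= Num.max L M * enorm (x - y).
  by apply: le_trans (Lf x y) _; rewrite ler_wpM2r ?enorm_ge0// le_max lexx.
have h2 : `|g x - g y| <= Num.max L M * enorm (x - y).
  by apply: le_trans (Mg x y) _; rewrite ler_wpM2r ?enorm_ge0// le_max lexx orbT.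
move: h1 h2; move: (Num.max L M * _) => c; rewrite !ler_norml => /andP[? ?] /andP[? ?].
by rewrite /Num.max; case: ifPn; case: ifPn; rewrite -?leNgt => ? ?; apply/andP; split; lra.
Qed.

(* The Lipschitz approximation of the indicator of an open set [U] is the
   infimum over [y] outside [U] of the functions below. *)
Let cap (n : nat) (x y : 'rV[R]_d) : R := Num.min 1 (n%:R * enorm (x - y)).

Let cap_dist n x y z : cap n x z - cap n y z <= n%:R * enorm (x - y).
Proof.
have h : n%:R * enorm (x - z) <= n%:R * enorm (x - y) + n%:R * enorm (y - z).
  by rewrite -mulrDr ler_wpM2l// ler_enorm_dist.
have h0 : 0 <= n%:R * enorm (x - y) by rewrite mulr_ge0 ?enorm_ge0.
by rewrite /cap /Num.min; case: ifPn; case: ifPn; rewrite -?leNgt => ? ?; lra.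
Qed.

Lemma open_elip_approx (U : set 'rV[R]_d) : open U ->
  exists g : nat -> 'rV[R]_d -> R, [/\ forall n, elip n%:R (g n),
    forall n x, 0 <= g n x <= 1 & forall x, g n x @[n --> \oo] --> (\1_U x : R)].
Proof.
move=> oU.
(* With [U] the whole space the infimum would range over the empty set and take a default value; the
   constant 1 serves instead. *)
have [UT|/eqP/set0P[y0 Uy0]] := pselect (~` U = set0).
  exists (fun _ _ => 1); split.
  - by move=> n x y; rewrite subrr normr0 mulr_ge0// enorm_ge0.
  - by move=> n x; rewrite ler01 lexx.
  - move=> x; rewrite indicE mem_set; first exact: cvg_cst.
    by apply: contrapT => nU; have : (~` U) x by []; rewrite UT.
pose S n x := [set cap n x y | y in ~` U].
have cap0 n x y : 0 <= cap n x y.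
  by rewrite le_min ler01 mulr_ge0 ?enorm_ge0.
have lbS n x : lbound (S n x) 0 by move=> _ [y _ <-].
have infS n x : has_inf (S n x) by split; [exists (cap n x y0), y0|exists 0].
have Sle n x y : (~` U) y -> inf (S n x) <= cap n x y.
  by move=> Uy; apply: ge_inf; [exists 0|exists y].
have S01 n x : 0 <= inf (S n x) <= 1.
  rewrite lb_le_inf//=; last by exists (cap n x y0), y0.
  by apply: le_trans (Sle n x y0 Uy0) _; rewrite ge_min lexx.
have half n x y : inf (S n x) - inf (S n y) <= n%:R * enorm (x - y).
  rewrite lerBlDr -lerBlDl; apply: lb_le_inf; first by exists (cap n y y0), y0.
  move=> _ [z Uz <-]; rewrite lerBlDl; apply: le_trans (Sle n x z Uz) _.
  by rewrite -lerBlDr cap_dist.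
exists (fun n x => inf (S n x)); split => [n x y|//|x].
  by rewrite ler_norml lerNl opprB half enorm_distC half.
have [Ux|Ux] := pselect (U x); rewrite indicE; last first.
  rewrite memNset//; apply: cvg_near_cst.
  near=> n; apply/eqP; rewrite eq_le.
  case/andP: (S01 n x) => -> _; rewrite andbT; apply: le_trans (Sle n x x Ux) _.
  by rewrite /cap subrr enorm0 mulr0 ge_min lexx orbT.
rewrite mem_set//.
have /nbhs_ballP[e /= e0 He] : nbhs x U by apply: open_nbhs_nbhs.
apply: cvg_near_cst.
near=> n; apply/eqP; rewrite eq_le.
case/andP: (S01 n x) => _ ->; rewrite andTb.
apply: lb_le_inf; first by exists (cap n x y0), y0.
move=> _ [y Uy <-]; rewrite le_min lexx/=.
have xye : e <= enorm (x - y).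
  rewrite leNgt; apply/negP => xye; apply: Uy; apply: He; split => // i j.
  rewrite ord1 /ball/=; apply: le_lt_trans xye.
  by have := coord_le_enorm (x - y) j; rewrite !mxE.
apply: (@le_trans _ _ (n%:R * e)); last by rewrite ler_wpM2l.
rewrite -ler_pdivrMr//; near: n; exact: nbhs_infty_ger.
Unshelve. all: by end_near. Qed.

End lipschitz_tests.

Section total_variation.
Context {R : realType} {d : nat} (mu nu : probability 'rV[R]_d R).

(** One and the same [g] has to be close to the indicator under both laws, because only the
    difference of its two integrals is under control. *)
Let approximable (A : set 'rV[R]_d) := forall e : R, 0 < e ->
  exists (L : R) g, [/\ elip L g, forall x, 0 <= g x <= 1,
    \int[mu]_x `|\1_A x - g x| <= e & \int[nu]_x `|\1_A x - g x| <= e].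

Let bmf_unit (g : 'rV[R]_d -> R) L : elip L g -> (forall x, 0 <= g x <= 1) ->
  bounded_measurable g.
Proof.
move=> Lg g01; split; first exact: elip_measurable Lg.
by exists 1 => x; case/andP: (g01 x) => ? ?; rewrite ger0_norm.
Qed.

Let bmf_diff A (g : 'rV[R]_d -> R) L : measurable A -> elip L g -> (forall x, 0 <= g x <= 1) ->
  bounded_measurable (fun x => `|\1_A x - g x|).
Proof.
by move=> mA Lg g01; apply: bmf_norm; apply: bmfB; [exact: bmf_indic|exact: bmf_unit Lg g01].
Qed.

Let cvg0_le (u : nat -> R) e : 0 < e -> u n @[n --> \oo] --> (0 : R) -> \forall n \near \oo, u n <= e.
Proof. by move=> e0 u0; exact: (cvgr_le _ u0). Qed.

Let approximable_lim (F : nat -> set 'rV[R]_d) A : measurable A ->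
  (forall n, measurable (F n)) -> (forall n, approximable (F n)) ->
  (forall x, (\1_(F n) x : R) @[n --> \oo] --> (\1_A x : R)) -> approximable A.
Proof.
move=> mA mF aF cF e e0.
have H (P : probability 'rV[R]_d R) : (\int[P]_x `|\1_A x - \1_(F n) x : R|) @[n --> \oo] --> (0 : R).
  rewrite -(prob_Rintegral_cst P 0).
  apply: (@bounded_convergence _ _ _ _ _ _ 1).
  - by move=> n; case: (bmf_norm (bmfB (bmf_indic (R := R) mA) (bmf_indic (R := R) (mF n)))).
  - exact: measurable_cst.
  - move=> n x; rewrite normr_id !indicE.
    by case: (_ \in _); case: (_ \in _); rewrite ?subrr ?subr0 ?sub0r ?normrN ?normr0 ?normr1.
  - move=> x; rewrite -(normr0 R) -(subrr (\1_A x)); apply: cvg_norm.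
    by apply: cvgB; [exact: cvg_cst|exact: cF].
have e20 : 0 < e / 2 by rewrite divr_gt0.
near \oo => n.
have [L [g [Lg g01 h1 h2]]] := aF n _ e20.
have bF : bounded_measurable (fun x => `|\1_A x - \1_(F n) x : R|).
  by apply: bmf_norm; apply: bmfB; exact: bmf_indic.
have tri (P : probability 'rV[R]_d R) : \int[P]_x `|\1_A x - g x| <=
    \int[P]_x `|\1_A x - \1_(F n) x| + \int[P]_x `|\1_(F n) x - g x|.
  rewrite -RintegralD//; [|exact: bmf_integrable|by apply: bmf_integrable; exact: bmf_diff Lg g01].
  apply: le_Rintegral => //.
  - by apply: bmf_integrable; exact: bmf_diff Lg g01.
  - by apply: bmf_integrable; apply: bmfD => //; exact: bmf_diff Lg g01.
  - by move=> x _; apply: le_trans (ler_normD _ _); rewrite addrA subrK.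
exists L, g; split => //; rewrite (splitr e); apply: le_trans (tri _) _; apply: lerD => //.
  near: n; exact: cvg0_le (H mu).
near: n; exact: cvg0_le (H nu).
Unshelve. all: by end_near. Qed.

Let approximableU A B : measurable A -> measurable B ->
  approximable A -> approximable B -> approximable (A `|` B).
Proof.
move=> mA mB aA aB e e0.
have e20 : 0 < e / 2 by rewrite divr_gt0.
have [L [f [Lf f01 f1 f2]]] := aA _ e20.
have [M [g [Mg g01 g1 g2]]] := aB _ e20.
have Lfg := elip_max Lf Mg.
have fg01 x : 0 <= Num.max (f x) (g x) <= 1.
  by case/andP: (f01 x) => ? ?; case/andP: (g01 x) => ? ?; rewrite le_max ge_max; apply/andP; split; [apply/orP; left|apply/andP].
have tri (P : probability 'rV[R]_d R) : \int[P]_x `|\1_(A `|` B) x - Num.max (f x) (g x)| <=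
    \int[P]_x `|\1_A x - f x| + \int[P]_x `|\1_B x - g x|.
  rewrite -RintegralD//; [|by apply: bmf_integrable; exact: bmf_diff Lf f01|by apply: bmf_integrable; exact: bmf_diff Mg g01].
  apply: le_Rintegral => //.
  - by apply: bmf_integrable; apply: bmf_diff Lfg fg01; exact: measurableU.
  - by apply: bmf_integrable; apply: bmfD; [exact: bmf_diff Lf f01|exact: bmf_diff Mg g01].
  - move=> x _; have -> : \1_(A `|` B) x = Num.max (\1_A x) (\1_B x) :> R.
      by rewrite !indicE in_setU; case: (x \in A); case: (x \in B); rewrite /= ?maxxx ?(max_l ler01) ?(max_r ler01).
    exact: ler_dist_max.
exists (Num.max L M), (fun x => Num.max (f x) (g x)); split => //;
  rewrite (splitr e); apply: le_trans (tri _) _; exact: lerD.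
Qed.

(** Dynkin induction starting from open sets, where [open_elip_approx] applies. Complements pass to
    [1 - g]; a countable union is the limit of its finite subunions, which are approximated by
    maxima. *)
Lemma measurable_approximable A : measurable A -> approximable A.
Proof.
move=> mA; refine (@dynkin_induction _ 'rV[R]_d open approximable erefl _ _ _ _ _ A mA) => //.
- by move=> B C; exact: openI.
- move=> e e0; exists 0, (fun=> 1); split.
  + by move=> x y; rewrite subrr normr0 mul0r.
  + by move=> x; rewrite ler01 lexx.
  + by under eq_Rintegral do rewrite indicT subrr normr0; rewrite prob_Rintegral_cst ltW.
  + by under eq_Rintegral do rewrite indicT subrr normr0; rewrite prob_Rintegral_cst ltW.
- move=> U /[dup] oU /open_elip_approx[g [Lg g01 gU]] e e0.
  have H (P : probability 'rV[R]_d R) : (\int[P]_x `|\1_U x - g n x|) @[n --> \oo] --> (0 : R).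
    rewrite -(prob_Rintegral_cst P 0).
    apply: (@bounded_convergence _ _ _ _ _ _ 1).
    + by move=> n; case: (bmf_diff (measurable_open_rV oU) (Lg n) (g01 n)).
    + exact: measurable_cst.
    + move=> n x; rewrite normr_id; case/andP: (g01 n x) => ? ?.
      by rewrite indicE; case: (_ \in _) => /=; rewrite ler_norml; apply/andP; split; lra.
    + move=> x; rewrite -(normr0 R) -(subrr (\1_U x)); apply: cvg_norm.
      by apply: cvgB; [exact: cvg_cst|exact: gU].
  near \oo => n; exists n%:R, (g n); split => //.
    near: n; exact: cvg0_le (H mu).
  near: n; exact: cvg0_le (H nu).
- move=> B mB aB e e0; have [L [g [Lg g01 g1 g2]]] := aB _ e0.
  have E x : `|\1_(~` B) x - (1 - g x)| = `|\1_B x - g x|.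
    rewrite !indicE in_setC; case: (x \in B) => /=; last by rewrite -normrN; congr `|_|; lra.
    by rewrite -normrN; congr `|_|; lra.
  exists L, (fun x => 1 - g x); split.
  + by move=> x y; rewrite opprB addrC addrA subrK distrC; exact: Lg.
  + by move=> x; case/andP: (g01 x) => ? ?; apply/andP; split; lra.
  + by under eq_Rintegral do rewrite E.
  + by under eq_Rintegral do rewrite E.
- move=> F mF _ aF.
  pose G n := \big[setU/set0]_(k < n) F k.
  have mG n : measurable (G n) by apply: bigsetU_measurable.
  have aG n : approximable (G n).
    elim: n => [|n IH]; last first.
      by rewrite /G big_ord_recr/=; apply: approximableU => //; exact: mG.
    move=> e e0; exists 0, (fun=> 0); rewrite /G big_ord0; split.
    + by move=> x y; rewrite subrr normr0 mul0r.
    + by move=> x; rewrite ler01 lexx.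
    + by under eq_Rintegral do rewrite indic0 subrr normr0; rewrite prob_Rintegral_cst ltW.
    + by under eq_Rintegral do rewrite indic0 subrr normr0; rewrite prob_Rintegral_cst ltW.
  apply: (approximable_lim _ mG aG); first exact: bigcupT_measurable.
  move=> x; rewrite !indicE; have [[k _ Fk]|nF] := pselect ((\bigcup_k F k) x).
    rewrite mem_set; last by exists k.
    apply: cvg_near_cst; exists k.+1 => // n /= kn.
    by rewrite indicE mem_set// /G -bigcup_mkord; exists k.
  rewrite memNset//; apply: cvg_near_cst.
  apply: nearW => n; rewrite indicE memNset// /G -bigcup_mkord => -[k _ Fk].
  by apply: nF; exists k.
Unshelve. all: by end_near. Qed.

(** The indicator is replaced by a Lipschitz function at cost [e / 2] under each law. The bound [b]
    is uniform in the Lipschitz constant, since the approximations may get steeper as [e]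
    decreases. *)
Lemma tv_le_elip (b : R) :
  (forall L g, elip L g -> (forall x, 0 <= g x <= 1) ->
     \int[mu]_x g x - \int[nu]_x g x <= b) ->
  forall A, measurable A -> fine (mu A) - fine (nu A) <= b.
Proof.
move=> H A mA; apply/ler_addgt0Pr => e e0.
have e20 : 0 < e / 2 by rewrite divr_gt0.
have [L [g [Lg g01 h1 h2]]] := measurable_approximable mA e20.
have bg := bmf_unit Lg g01; have bA := bmf_indic (R := R) mA.
have K (P : probability 'rV[R]_d R) : \int[P]_x `|\1_A x - g x| <= e / 2 ->
    `|fine (P A) - \int[P]_x g x| <= e / 2.
  apply: le_trans; rewrite -prob_Rintegral_indic//.
  rewrite -RintegralB//; [|exact: bmf_integrable|exact: bmf_integrable].
  by apply: le_normr_Rintegral => //; apply: bmf_integrable; exact: bmfB.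
have := K _ h1; have := K _ h2; have := H _ _ Lg g01.
rewrite !ler_norml => ? /andP[? ?] /andP[? ?]; lra.
Qed.

End total_variation.

(** * Gaussian reflection in dimension one *)
Section density.
Local Open Scope ereal_scope.
Context {disp : measure_display} {T : measurableType disp} {R : realType}
  (mu nu : {measure set T -> \bar R}) (p : T -> R).
Hypotheses (mp : measurable_fun setT p) (p0 : forall x, (0 <= p x)%R)
  (nuE : forall A, measurable A -> nu A = \int[mu]_(x in A) (p x)%:E).

Import HBNNSimple.

Let density_nnsfun (f : {nnsfun T >-> R}) :
  \int[nu]_x (f x)%:E = \int[mu]_x ((f x)%:E * (p x)%:E).
Proof.
under [LHS]eq_integral do rewrite fimfunE -fsumEFin//.
rewrite [LHS]ge0_integral_fsum//; last 2 first.
  - by move=> r; exact/measurable_EFinP/measurableT_comp.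
  - by move=> n x _; rewrite EFinM nnfun_muleindic_ge0.
under [RHS]eq_integral.
  move=> x xD; rewrite fimfunE -fsumEFin// muleC ge0_mule_fsumr; last first.
    by move=> r; rewrite EFinM nnfun_muleindic_ge0.
  over.
rewrite [RHS]ge0_integral_fsum//; last 2 first.
  - move=> r; apply: emeasurable_funM; first exact/measurable_EFinP.
    by apply/measurable_EFinP; do 2 apply/measurableT_comp => //.
  - move=> n x _; rewrite EFinM mule_ge0//; last by rewrite nnfun_muleindic_ge0.
    by rewrite lee_fin.
apply: eq_fsbigr => r _.
have mE : measurable (f @^-1` [set r]) by [].
have [r0|r0] := ltP r 0%R.
  rewrite (_ : f @^-1` [set r] = set0); last first.
    by apply/seteqP; split => x //= fxr; move: r0; rewrite -fxr ltNge fun_ge0.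
  by rewrite indic0 !integral0_eq// => x _; rewrite ?mulr0 ?mule0.
rewrite integralZl_indic_nnsfun// integral_indic// setIT nuE//.
under [RHS]eq_integral do rewrite EFinM muleCA.
rewrite ge0_integralZl//.
- congr (_ * _)%E; rewrite integral_mkcond; apply: eq_integral => x _.
  by rewrite patchE indicE; case: ifPn; rewrite ?mule1 ?mule0.
- by apply: emeasurable_funM; apply/measurable_EFinP => //; exact: measurable_indic.
- by move=> x _; rewrite mule_ge0// lee_fin.
Qed.

Lemma ge0_integral_density (f : T -> \bar R) :
  measurable_fun setT f -> (forall x, 0 <= f x) ->
  \int[nu]_x f x = \int[mu]_x (f x * (p x)%:E).
Proof.
move=> mf f0.
pose f_ := nnsfun_approx measurableT mf.
transitivity (lim (\int[nu]_x (f_ n x)%:E @[n --> \oo])).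
  rewrite -monotone_convergence//=.
  - apply: eq_integral => ? /[!inE] xD; apply/esym/cvg_lim => //=.
    exact: cvg_nnsfun_approx.
  - by move=> n; exact/measurable_EFinP/measurable_funTS.
  - by move=> n ? _; rewrite lee_fin.
  - by move=> ? _ ? ? mn; rewrite lee_fin; exact/lefP/nd_nnsfun_approx.
rewrite [RHS](_ : _ = lim (\int[mu]_x ((f_ n x)%:E * (p x)%:E) @[n --> \oo])).
  by apply: congr_lim; apply/funext => n /=; exact: density_nnsfun.
rewrite -monotone_convergence//=.
- apply: eq_integral => x _; apply/esym/cvg_lim => //.
  by apply: cvgeZr => //; exact: cvg_nnsfun_approx.
- by move=> n; apply: emeasurable_funM; exact/measurable_EFinP/measurable_funTS.
- by move=> n ? _; rewrite mule_ge0// lee_fin.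
- move=> x _ m n mn; rewrite lee_wpmul2r ?lee_fin//; exact/lefP/nd_nnsfun_approx.
Qed.
End density.

(** * Affine changes of variables and plane rotations *)

Section lebesgue_affine.
Local Open Scope ereal_scope.
Context {R : realType}.
Notation mu := (@lebesgue_measure R).

Lemma measurable_affine (a b : R) : measurable_fun setT (fun x : R => (a * x + b)%R).
Proof. by apply: measurable_funD => //; apply: measurable_funM. Qed.


(** Uniqueness of Lebesgue measure: its image under [phi], multiplied by [a], gives every half-open
    interval its length. *)
Let lebesgue_affine_pos (a b : R) (A : set R) : (0 < a)%R -> measurable A ->
  mu A = a%:E * mu ((fun x : R => (a * x + b)%R) @^-1` A).
Proof.
move=> a0 mA.
pose phi : R -> measurableTypeR R := (fun x : R => (a * x + b)%R).
have mphi : measurable_fun setT phi := measurable_affine a b.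
pose m' : {measure set (measurableTypeR R) -> \bar R} :=
  mscale (NngNum (ltW a0)) (pushforward mu phi).
rewrite (@lebesgue_measure_unique R (m' mphi) _ A mA)// => _ [[x y]] _ <-.
rewrite /m' /mscale/= /mscale/= /pushforward.
have -> : phi @^-1` `]x, y] = `]((x - b) / a)%R, ((y - b) / a)%R]%classic.
  apply/seteqP; split => z /=; rewrite !in_itv/= ltr_pdivrMr// ler_pdivlMr// ltrBlDr lerBrDr;
    by rewrite (mulrC z).
rewrite !lebesgue_measure_itv/= !lte_fin ltr_pM2r ?invr_gt0// ltrD2r.
case: ifP => _; last by rewrite mule0.
by rewrite -!EFinB -EFinM; congr EFin; field; rewrite gt_eqF.
Qed.

Lemma ge0_integral_affine (a b : R) (f : R -> \bar R) : (0 < a)%R ->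
  measurable_fun setT f -> (forall x, 0 <= f x) ->
  \int[mu]_x f x = a%:E * \int[mu]_x f (a * x + b)%R.
Proof.
move=> a0 mf f0.
pose phi : R -> measurableTypeR R := (fun x : R => (a * x + b)%R).
have mphi : measurable_fun setT phi := measurable_affine a b.
pose m' : {measure set (measurableTypeR R) -> \bar R} :=
  mscale (NngNum (ltW a0)) (pushforward mu phi).
rewrite (@eq_measure_integral _ _ _ _ (m' mphi))//; last first.
  by move=> A mA _; exact: lebesgue_affine_pos.
rewrite ge0_integral_mscale//= ge0_integral_pushforward//.
Qed.

Lemma ge0_integral_oppr (f : R -> \bar R) :
  measurable_fun setT f -> (forall x, 0 <= f x) ->
  \int[mu]_x f x = \int[mu]_x f (- x)%R.
Proof.
move=> mf f0.
pose phi : R -> measurableTypeR R := (fun x : R => (- x)%R).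
have mphi : measurable_fun setT phi by exact: measurableT_comp.
pose m' : {measure set (measurableTypeR R) -> \bar R} := pushforward mu phi.
rewrite (@eq_measure_integral _ _ _ _ (m' mphi))//; last first.
  by move=> A mA _; rewrite /m' /= lebesgue_measureN.
by rewrite ge0_integral_pushforward.
Qed.

Lemma ge0_integral_translate (b : R) (f : R -> \bar R) :
  measurable_fun setT f -> (forall x, 0 <= f x) ->
  \int[mu]_x f (x + b)%R = \int[mu]_x f x.
Proof.
move=> mf f0; rewrite (ge0_integral_affine b ltr01 mf f0) mul1e.
by apply: eq_integral => x _; rewrite mul1r.
Qed.

End lebesgue_affine.
Section lebesgue_rotation.
Local Open Scope ereal_scope.
Context {R : realType}.
Notation mu := (@lebesgue_measure R).
Implicit Types (f : R * R -> \bar R) (a b c s : R).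

Let shear1 a f : measurable_fun setT f -> (forall z, 0 <= f z) ->
  \int[mu]_x \int[mu]_y f (x + a * y, y)%R = \int[mu]_x \int[mu]_y f (x, y).
Proof.
move=> mf f0.
have mg : measurable_fun setT (fun z : R * R => f (z.1 + a * z.2, z.2)%R).
  apply: (measurableT_comp mf); apply: measurable_fun_pair => //.
  by apply: measurable_funD => //; apply: measurable_funM.
transitivity (\int[mu]_y \int[mu]_x f (x + a * y, y)%R).
  by apply: (fubini_tonelli (m1 := mu) (m2 := mu) _ mg).
transitivity (\int[mu]_y \int[mu]_x f (x, y)); last first.
  by apply/esym; apply: (fubini_tonelli (m1 := mu) (m2 := mu) _ mf).
apply: eq_integral => y _.
apply: (ge0_integral_translate (a * y)%R (f := fun x => f (x, y))) => //.
by apply: (measurableT_comp mf); apply: measurable_fun_pair.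
Qed.

Let shear2 a f : measurable_fun setT f -> (forall z, 0 <= f z) ->
  \int[mu]_x \int[mu]_y f (x, y + a * x)%R = \int[mu]_x \int[mu]_y f (x, y).
Proof.
move=> mf f0; apply: eq_integral => x _.
apply: (ge0_integral_translate (a * x)%R (f := fun y => f (x, y))) => //.
by apply: (measurableT_comp mf); apply: measurable_fun_pair.
Qed.

(* A rotation is a product of three shears. *)
Lemma lebesgue_rotation c s f : (c ^+ 2 + s ^+ 2 = 1)%R -> c != (-1)%R ->
  measurable_fun setT f -> (forall z, 0 <= f z) ->
  \int[mu]_x \int[mu]_y f (c * x - s * y, s * x + c * y)%R =
  \int[mu]_x \int[mu]_y f (x, y).
Proof.
move=> cs c1 mf f0.
have c10 : (1 + c)%R != 0%R by rewrite addrC addr_eq0.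
(* For the rotation by an angle [t] this is [- tan (t / 2)], the slope of the two outer shears; it
   is undefined only for the half turn [c = -1]. *)
pose a := (- s / (1 + c))%R.
pose f1 (z : R * R) := f (z.1 + a * z.2, z.2)%R.
pose f2 (z : R * R) := f1 (z.1, z.2 + s * z.1)%R.
have mf1 : measurable_fun setT f1.
  apply: (measurableT_comp mf); apply: measurable_fun_pair => //.
  by apply: measurable_funD => //; apply: measurable_funM.
have mf2 : measurable_fun setT f2.
  apply: (measurableT_comp mf1); apply: measurable_fun_pair => //.
  by apply: measurable_funD => //; apply: measurable_funM.
transitivity (\int[mu]_x \int[mu]_y f2 (x + a * y, y)%R); last first.
  rewrite (shear1 a mf2); last by move=> z; exact: f0.
  transitivity (\int[mu]_x \int[mu]_y f1 (x, y)%R).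
    by apply: (shear2 s mf1) => z; exact: f0.
  exact: (shear1 a mf f0).
apply: eq_integral => x _; apply: eq_integral => y _.
rewrite /f2 /f1; cbn [fst snd].
have E : (1 + a * s)%R = c.
  have s2 : (s ^+ 2 = 1 - c ^+ 2)%R by rewrite -cs addrAC subrr add0r.
  transitivity ((1 + c - s ^+ 2) / (1 + c))%R; first by rewrite /a; field.
  rewrite s2; by field.
have E2 : (a * (1 + c))%R = (- s)%R by rewrite /a divfK.
congr (f (_, _)).
  transitivity ((1 + a * s) * x + (a * (1 + (1 + a * s))) * y)%R; last by ring.
  by rewrite E E2 mulNr.
by transitivity ((1 + a * s) * y + s * x)%R; [rewrite E addrC|ring].
Qed.

End lebesgue_rotation.

Section normal.
Local Open Scope ereal_scope.
Context {R : realType}.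
Notation mu := (@lebesgue_measure R).
Notation N s := (normal_prob (0 : R) s).

Lemma ge0_integral_normal (s : R) (f : R -> \bar R) :
  measurable_fun setT f -> (forall x, 0 <= f x) ->
  \int[N s]_x f x = \int[mu]_x (f x * (normal_pdf 0 s x)%:E).
Proof.
move=> mf f0; apply: ge0_integral_density => //.
- exact: measurable_normal_pdf.
- exact: normal_pdf_ge0.
Qed.

Lemma normal_pdf0E (s x : R) : (0 < s)%R ->
  normal_pdf 0 s x = (normal_peak s * expR (- (x ^+ 2 / (s ^+ 2 *+ 2))))%R.
Proof. by move=> s0; rewrite normal_pdfE ?gt_eqF// /normal_fun subr0 mulNr. Qed.

Lemma normal_peakE (s : R) : (0 < s)%R -> normal_peak s = (s^-1 * normal_peak 1)%R.
Proof.
move=> s0; rewrite /normal_peak -invfM; congr (_^-1)%R.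
by rewrite -mulrnAr sqrtrM ?sqr_ge0// sqrtr_sqr gtr0_norm// expr1n mul1r.
Qed.

Lemma normal_pdf_scale (s x : R) : (0 < s)%R ->
  (s * normal_pdf 0 s (s * x) = normal_pdf 0 1 x)%R.
Proof.
move=> s0; rewrite !normal_pdf0E// (normal_peakE s0) mulrA mulrA divff ?gt_eqF// mul1r.
congr (_ * expR (- _))%R; rewrite expr1n exprMn; field.
by rewrite gt_eqF.
Qed.

Lemma ge0_integral_normal_scale (s : R) (f : R -> \bar R) : (0 < s)%R ->
  measurable_fun setT f -> (forall x, 0 <= f x) ->
  \int[N s]_x f x = \int[N 1]_x f (s * x)%R.
Proof.
move=> s0 mf f0.
pose g (x : R) := f x * (normal_pdf 0 s x)%:E.
have mg : measurable_fun setT g.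
  by apply: emeasurable_funM => //; apply/measurable_EFinP; exact: measurable_normal_pdf.
have g0 x : 0 <= g x by rewrite mule_ge0// lee_fin normal_pdf_ge0.
have ms : measurable_fun setT (fun x : R => f (s * x)%R).
  by apply: (measurableT_comp mf); apply: measurable_funM.
rewrite (ge0_integral_normal 1 ms (fun x => f0 _)).
transitivity (\int[mu]_x g x); first exact: ge0_integral_normal.
rewrite (ge0_integral_affine 0 s0 mg g0).
rewrite -(@ge0_integralZl _ _ _ mu setT measurableT (fun x => g (s * x + 0)%R)).
- apply: eq_integral => x _; rewrite addr0 /g muleCA -EFinM.
  by rewrite normal_pdf_scale.
- exact: (measurableT_comp mg (measurable_affine s 0)).
- by move=> x _; exact: g0.
- by rewrite lee_fin ltW.
Qed.

Let p (x : R) := normal_pdf 0 1 x.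
Let mp : measurable_fun setT p. Proof. exact: measurable_normal_pdf. Qed.

Let integral2_normal (g : R * R -> \bar R) :
  measurable_fun setT g -> (forall z, 0 <= g z) ->
  \int[N 1]_x \int[N 1]_y g (x, y) = \int[mu]_x \int[mu]_y (g (x, y) * (p x * p y)%:E).
Proof.
move=> mg g0.
have m1 (x : R) : measurable_fun setT (fun y : R => g (x, y)).
  by apply: (measurableT_comp mg); apply: measurable_fun_pair.
rewrite (@ge0_integral_normal 1 (fun x : R => \int[N 1]_y g (x, y))); last 2 first.
- exact: (@measurable_fun_fubini_tonelli_F _ _ _ _ _ (N 1) g mg).
- by move=> x; exact: integral_ge0.
apply: eq_integral => x _.
rewrite (@ge0_integral_normal 1 (fun y : R => g (x, y)))//.
rewrite -(@ge0_integralZr _ _ _ mu setT measurableT (fun y : R => g (x, y) * (p y)%:E))//.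
- by apply: eq_integral => y _; rewrite EFinM [in RHS]muleA muleAC.
- by apply: emeasurable_funM; [exact: m1|apply/measurable_EFinP; exact: mp].
- by move=> y _; rewrite mule_ge0// lee_fin normal_pdf_ge0.
- by rewrite lee_fin normal_pdf_ge0.
Qed.

(** Rotations preserve Lebesgue measure, and the product density depends on [x ^+ 2 + y ^+ 2]
    only. *)
Lemma ge0_normal_rotation (c s : R) (f : R * R -> \bar R) :
  (c ^+ 2 + s ^+ 2 = 1)%R -> c != (-1)%R ->
  measurable_fun setT f -> (forall z, 0 <= f z) ->
  \int[N 1]_x \int[N 1]_y f (c * x - s * y, s * x + c * y)%R =
  \int[N 1]_x \int[N 1]_y f (x, y).
Proof.
move=> cs c1 mf f0.
pose g (z : R * R) := f z * (p z.1 * p z.2)%:E.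
have mg : measurable_fun setT g.
  apply: emeasurable_funM => //; apply/measurable_EFinP; apply: measurable_funM;
  exact: (measurableT_comp mp).
have g0 z : 0 <= g z by rewrite mule_ge0// lee_fin mulr_ge0// normal_pdf_ge0.
have mrot : measurable_fun setT (fun z : R * R => f (c * z.1 - s * z.2, s * z.1 + c * z.2)%R).
  apply: (measurableT_comp mf).
  by apply: measurable_fun_pair; [apply: measurable_funB|apply: measurable_funD];
    apply: measurable_funM.
rewrite (integral2_normal mf f0).
transitivity (\int[mu]_x \int[mu]_y g (x, y)) => //.
rewrite -(lebesgue_rotation cs c1 mg g0).
rewrite (integral2_normal mrot) => [|z]; last exact: f0.
apply: eq_integral => x _; apply: eq_integral => y _; rewrite /g; cbn [fst snd]; congr (_ * _%:E).
rewrite /p !normal_pdf0E//.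
rewrite mulrACA -expRD [RHS]mulrACA -expRD; congr (_ * expR _)%R.
rewrite expr1n -!opprD -!mulrDl; congr (- (_ / _))%R.
transitivity ((c ^+ 2 + s ^+ 2) * (x ^+ 2 + y ^+ 2))%R; last by ring.
by rewrite cs mul1r.
Qed.

End normal.
Section signed_density.
Context {disp : measure_display} {T : measurableType disp} {R : realType}
  (mu nu : {measure set T -> \bar R}) (p : T -> R).
Hypotheses (mp : measurable_fun setT p) (p0 : forall x, (0 <= p x)%R)
  (nuE : forall A, measurable A -> nu A = (\int[mu]_(x in A) (p x)%:E)%E).

Lemma integrable_density (f : T -> R) : nu.-integrable setT (EFin \o f) ->
  mu.-integrable setT (EFin \o (fun x => f x * p x)).
Proof.
move=> /integrableP[mf fi]; have mf' : measurable_fun setT f by exact/measurable_EFinP.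
apply/integrableP; split; first by apply/measurable_EFinP; exact: measurable_funM.
apply: le_lt_trans fi; rewrite (ge0_integral_density mp p0 nuE); last 2 first.
- exact: measurableT_comp.
- by move=> x; exact: abse_ge0.
rewrite le_eqVlt; apply/orP; left; apply/eqP; apply: eq_integral => x _.
by rewrite /= normrM (ger0_norm (p0 x)).
Qed.

Lemma Rintegral_density (f : T -> R) : nu.-integrable setT (EFin \o f) ->
  \int[nu]_x f x = \int[mu]_x (f x * p x).
Proof.
move=> fi; have /integrableP[mf _] := fi.
have mf' : measurable_fun setT f by exact/measurable_EFinP.
have ai : nu.-integrable setT (EFin \o (fun x => `|f x|)) by exact: integrable_abse fi.
have H (g : T -> R) : measurable_fun setT g -> (forall x, 0 <= g x) ->
    \int[nu]_x g x = \int[mu]_x (g x * p x).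
  move=> mg g0; rewrite /Rintegral; congr fine.
  rewrite (ge0_integral_density mp p0 nuE); first by apply: eq_integral => x _; rewrite EFinM.
    exact/measurable_EFinP.
  by move=> x; rewrite lee_fin.
(* A difference of two nonnegative integrable functions, to each of which the nonnegative case
   applies. *)
have E x : f x = `|f x| - (`|f x| - f x) by rewrite subKr.
have di : nu.-integrable setT (EFin \o (fun x => `|f x| - f x)).
  by apply: (integrableB measurableT ai fi).
transitivity (\int[nu]_x `|f x| - \int[nu]_x (`|f x| - f x)).
  by rewrite -RintegralB//; apply: eq_Rintegral => x _.
rewrite !H//; last 3 first.
- by apply: measurable_funB => //; exact: measurableT_comp.
- by move=> x; rewrite subr_ge0 ler_norm.
- exact: measurableT_comp.
rewrite -RintegralB//; [|exact: integrable_density|exact: integrable_density].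
by apply: eq_Rintegral => x _; rewrite -mulrBl -E.
Qed.

End signed_density.

Section signed_lebesgue.
Context {R : realType}.
Notation mu := (@lebesgue_measure R).
Implicit Types (f : R -> R) (b : R).

Let ge0_Rintegral_transfer (phi : R -> R) f : measurable_fun setT phi ->
  (forall g : R -> \bar R, measurable_fun setT g -> (forall x, (0 <= g x)%E) ->
    (\int[mu]_x g (phi x) = \int[mu]_x g x)%E) ->
  mu.-integrable setT (EFin \o f) ->
  mu.-integrable setT (EFin \o (f \o phi)) /\ \int[mu]_x f (phi x) = \int[mu]_x f x.
Proof.
move=> mphi H fi; have /integrableP[mf foo] := fi.
have mf' : measurable_fun setT f by exact/measurable_EFinP.
have fpi : mu.-integrable setT (EFin \o (f \o phi)).
  apply/integrableP; split; first by apply/measurable_EFinP; exact: measurableT_comp.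
  rewrite (H (fun x => `|(f x)%:E|%E)); first exact: foo.
    exact: measurableT_comp.
  by move=> x; exact: abse_ge0.
split=> //.
have HR (g : R -> R) : measurable_fun setT g -> (forall x, 0 <= g x) ->
    \int[mu]_x g (phi x) = \int[mu]_x g x.
  move=> mg g0; rewrite /Rintegral (H (fun x => (g x)%:E)); first by [].
    exact/measurable_EFinP.
  by move=> x; rewrite lee_fin.
have D (g : R -> R) : mu.-integrable setT (EFin \o g) ->
    \int[mu]_x g x = \int[mu]_x `|g x| - \int[mu]_x (`|g x| - g x).
  move=> gi; have ai : mu.-integrable setT (EFin \o (fun x => `|g x|)) by exact: integrable_abse gi.
  rewrite -RintegralB//; first by apply: eq_Rintegral => x _; rewrite subKr.
  by apply: (integrableB measurableT ai gi).
rewrite (D _ fpi) (D _ fi) (HR (fun x => `|f x|))//; last exact: measurableT_comp.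
rewrite (HR (fun x => `|f x| - f x))//.
  by apply: measurable_funB => //; exact: measurableT_comp.
by move=> x; rewrite subr_ge0 ler_norm.
Qed.

Lemma integral_translate b f : mu.-integrable setT (EFin \o f) ->
  mu.-integrable setT (EFin \o (fun x => f (x + b))) /\
  \int[mu]_x f (x + b) = \int[mu]_x f x.
Proof.
apply: (ge0_Rintegral_transfer (phi := fun x => x + b)); first exact: measurable_funD.
by move=> g mg g0; exact: ge0_integral_translate.
Qed.

Lemma integral_oppr f : mu.-integrable setT (EFin \o f) ->
  mu.-integrable setT (EFin \o (fun x => f (- x))) /\
  \int[mu]_x f (- x) = \int[mu]_x f x.
Proof.
apply: (ge0_Rintegral_transfer (phi := fun x => - x)); first exact: measurableT_comp.
by move=> g mg g0; rewrite [RHS]ge0_integral_oppr.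
Qed.

End signed_lebesgue.

Section normal_moments.
Context {R : realType}.
Notation mu := (@lebesgue_measure R).
Notation N s := (normal_prob (0 : R) s).
Implicit Types (f : R -> R) (s : R).

Lemma Rintegral_normal s f : (N s).-integrable setT (EFin \o f) ->
  \int[N s]_x f x = \int[mu]_x (f x * normal_pdf 0 s x).
Proof.
apply: Rintegral_density => //; first exact: measurable_normal_pdf.
exact: normal_pdf_ge0.
Qed.

Lemma integrable_normal s f : (N s).-integrable setT (EFin \o f) ->
  mu.-integrable setT (EFin \o (fun x => f x * normal_pdf 0 s x)).
Proof.
apply: integrable_density => //; first exact: measurable_normal_pdf.
exact: normal_pdf_ge0.
Qed.

Lemma normal_pdfN s x : normal_pdf 0 s (- x) = normal_pdf (0 : R) s x \/ s = 0.
Proof.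
have [->|s0] := eqVneq s 0; first by right.
by left; rewrite !normal_pdfE// /normal_fun !subr0 sqrrN.
Qed.

Lemma ge0_integral_normalN s (f : R -> \bar R) : 0 < s ->
  measurable_fun setT f -> (forall x, (0 <= f x)%E) ->
  (\int[N s]_x f (- x)%R = \int[N s]_x f x)%E.
Proof.
move=> s0 mf f0.
have mp : measurable_fun setT (normal_pdf 0 s) by exact: measurable_normal_pdf.
have mfN : measurable_fun setT (fun x : R => f (- x)%R) by exact: (measurableT_comp mf).
rewrite (ge0_integral_normal s mfN (fun x => f0 _)) (ge0_integral_normal s mf f0).
rewrite [RHS](ge0_integral_oppr (f := fun x => (f x * (normal_pdf 0 s x)%:E)%E)); first last.
- by move=> x; rewrite mule_ge0// lee_fin normal_pdf_ge0.
- by apply: emeasurable_funM => //; exact/measurable_EFinP.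
apply: eq_integral => x _; case: (normal_pdfN s x) => [-> //|s0'].
by move: s0; rewrite s0' ltxx.
Qed.

Lemma integrable_normal_id s : 0 < s -> (N s).-integrable setT (EFin \o (fun x : R => x)).
Proof.
move=> s0; apply/integrableP; split; first exact/measurable_EFinP.
rewrite (ge0_integral_normal s (f := fun x => `|x%:E|%E)); last 2 first.
- exact: measurableT_comp.
- by move=> x; exact: abse_ge0.
(* The density with doubled variance dominates: with [y = x ^+ 2 / (4 * s ^+ 2)] the exponent is
   [- 2 y] for [s] and [- y] for [s2], and the spare factor [expR (- y)] absorbs
   [|x| <= s * expR y]. *)
pose s2 := Num.sqrt 2 * s.
have s20 : 0 < s2 by rewrite mulr_gt0// sqrtr_gt0.
pose c := s * (normal_peak s / normal_peak s2).
have pk (t : R) : 0 < t -> 0 < normal_peak t by move=> t0; rewrite normal_peak_gt0// gt_eqF.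
have c0 : 0 <= c by rewrite mulr_ge0 ?(ltW s0)// divr_ge0// normal_peak_ge0.
apply: (@le_lt_trans _ _ (c%:E * \int[mu]_x (normal_pdf 0 s2 x)%:E)%E); last first.
  by rewrite integral_normal_pdf mule1 ltry.
rewrite -(@ge0_integralZl _ _ _ mu setT measurableT (fun x => (normal_pdf 0 s2 x)%:E)); last 3 first.
- by apply/measurable_EFinP; exact: measurable_normal_pdf.
- by move=> x _; rewrite lee_fin normal_pdf_ge0.
- by rewrite lee_fin.
apply: ge0_le_integral => //.
- by move=> x _; rewrite mule_ge0// lee_fin normal_pdf_ge0.
- apply: emeasurable_funM; first exact: measurableT_comp.
  by apply/measurable_EFinP; exact: measurable_normal_pdf.
- apply: emeasurable_funM => //.
  by apply/measurable_EFinP; exact: measurable_normal_pdf.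
- move=> x _; rewrite /= -!EFinM lee_fin !normal_pdf0E//.
  pose y := x ^+ 2 / (4 * s ^+ 2).
  have -> : x ^+ 2 / (s ^+ 2 *+ 2) = y + y by rewrite /y; field; rewrite gt_eqF.
  have -> : x ^+ 2 / (s2 ^+ 2 *+ 2) = y.
    by rewrite /y /s2 exprMn sqr_sqrtr//; field; rewrite gt_eqF.
  have hy : `|x| <= s * expR y.
    apply: (@le_trans _ _ (s * (1 + y))); last by rewrite ler_wpM2l ?(ltW s0)// expR_ge1Dx.
    have -> : s * (1 + y) = `|x| + s * (`|x| / (2 * s) - 1) ^+ 2.
      have -> : y = `|x| ^+ 2 / (4 * s ^+ 2) by rewrite real_normK ?num_real.
      by field; rewrite gt_eqF.
    by rewrite lerDl mulr_ge0 ?sqr_ge0 ?ltW.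
  rewrite opprD expRD /c.
  have -> : s * (normal_peak s / normal_peak s2) * (normal_peak s2 * expR (- y)) =
    s * expR y * (normal_peak s * (expR (- y) * expR (- y))).
    rewrite [X in _ = X](_ : _ = s * normal_peak s * expR (- y) * (expR y * expR (- y))); last by ring.
    by rewrite expRxMexpNx_1; field; rewrite gt_eqF ?pk.
  by rewrite ler_wpM2r// mulr_ge0 ?normal_peak_ge0// mulr_ge0 ?expR_ge0.
Qed.

Lemma integral_normal_id s : 0 < s -> \int[N s]_x x = 0.
Proof.
move=> s0; rewrite (Rintegral_normal (integrable_normal_id s0)).
have [_ H] := integral_oppr (integrable_normal (integrable_normal_id s0)).
have E : \int[mu]_x (- x * normal_pdf 0 s (- x)) = -1 * \int[mu]_x (x * normal_pdf 0 s x).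
  rewrite -(RintegralZl (-1) measurableT (integrable_normal (integrable_normal_id s0))).
  apply: eq_Rintegral => x _; case: (normal_pdfN s x) => [->|s0']; first by rewrite mulN1r mulNr.
  by move: s0; rewrite s0' ltxx.
rewrite H mulN1r in E; apply/eqP; rewrite -eqNr; apply/eqP; exact: esym E.
Qed.

End normal_moments.

(** * The expected sign of a shifted normal variable *)

Section gsign.
Context {R : realType}.
Notation mu := (@lebesgue_measure R).
Notation N s := (normal_prob (0 : R) s).
Implicit Types (q r x y s : R).

(** Carries identities proved for nonnegative functions (Tonelli, change of variables, rotation)
    over to bounded signed ones: add a bound [M], apply the identity, cancel [M]. *)
Lemma integral_shift disp (T : measurableType disp) (P : probability T R) (f : T -> R) (M : R) :
  bounded_measurable f -> (\int[P]_x (f x + M)%:E)%E = (\int[P]_x f x + M)%:E.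
Proof.
move=> bf.
have bM : bounded_measurable (fun _ : T => M) by exact: bmf_cst.
rewrite -{2}(prob_Rintegral_cst P M) -RintegralD//; [|exact: bmf_integrable|exact: bmf_integrable].
by rewrite /Rintegral fineK//; apply/integrable_fin_num => //; apply: bmf_integrable; exact: bmfD.
Qed.

Lemma bmf_integrable_normal s (f : R -> R) : bounded_measurable f ->
  (N s).-integrable setT (EFin \o f).
Proof. exact: (bmf_integrable (N s)). Qed.

Lemma normal_rotation_bounded (c s : R) (h : R * R -> R) :
  c ^+ 2 + s ^+ 2 = 1 -> c != -1 -> bounded_measurable h ->
  \int[N 1]_x \int[N 1]_y h (c * x - s * y, s * x + c * y) =
  \int[N 1]_x \int[N 1]_y h (x, y).
Proof.
move=> cs c1 [mh [M hM]].
have mrot : measurable_fun setT (fun z : R * R => (c * z.1 - s * z.2, s * z.1 + c * z.2)).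
  by apply: measurable_fun_pair; [apply: measurable_funB|apply: measurable_funD];
    apply: measurable_funM.
have H (g : R * R -> R) : measurable_fun setT g -> (forall z, `|g z| <= M) ->
   (\int[N 1]_x \int[N 1]_y (g (x, y) + M)%:E)%E = (\int[N 1]_x \int[N 1]_y g (x, y) + M)%:E.
  move=> mg gM.
  have m1 (x : R) : measurable_fun setT (fun y : R => g (x, y)).
    by apply: (measurableT_comp mg); apply: measurable_fun_pair.
  have b1 (x : R) : bounded_measurable (fun y : R => g (x, y)) by split => //; exists M.
  have E x : (\int[N 1]_y (g (x, y) + M)%:E)%E = (\int[N 1]_y g (x, y) + M)%:E.
    exact: (integral_shift (N 1) M (b1 x)).
  rewrite -(integral_shift (N 1)); first by apply: eq_integral => x _; exact: E.
  split; last by exists M => x; exact: (prob_Rintegral_bound (N 1) (m1 x) (fun y => gM (x, y))).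
  have -> : (fun x => \int[N 1]_y g (x, y)) = (fun x => fine (\int[N 1]_y (g (x, y) + M)%:E)%E - M).
    by apply/funext => x; rewrite E/= addrK.
  apply: measurable_funB => //; apply: measurableT_comp => //.
  apply: (@measurable_fun_fubini_tonelli_F _ _ _ _ _ (N 1) (fun z => (g z + M)%:E)).
    by apply/measurable_EFinP; apply: measurable_funD.
  by move=> z; rewrite lee_fin; have := gM z; rewrite ler_norml => /andP[]; lra.
apply: (addIr M); apply: EFin_inj.
transitivity (\int[N 1]_x \int[N 1]_y (h (x, y) + M)%:E)%E; last exact: (H h mh hM).
transitivity (\int[N 1]_x \int[N 1]_y (h (c * x - s * y, s * x + c * y) + M)%:E)%E.
  exact/esym/(H (fun z => h (c * z.1 - s * z.2, s * z.1 + c * z.2)) (measurableT_comp mh mrot)).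
apply: (ge0_normal_rotation (f := fun z => (h z + M)%:E) cs c1).
  by apply/measurable_EFinP; apply: measurable_funD.
by move=> z; rewrite lee_fin; have := hM z; rewrite ler_norml => /andP[]; lra.
Qed.

Lemma measurable_sgr : measurable_fun setT (Num.sg : R -> R).
Proof.
have -> : (Num.sg : R -> R) = (fun x => if 0 < x then 1 else if x < 0 then -1 else 0).
  by apply/funext => x; case: sgrP.
apply: measurable_fun_ifT => //; first exact: measurable_fun_ltr.
by apply: measurable_fun_ifT => //; exact: measurable_fun_ltr.
Qed.

Lemma normr_sgr_le1 x : `|Num.sg x| <= 1.
Proof. by case: sgrP; rewrite ?normrN ?normr1 ?normr0. Qed.

Lemma sgr_homo x y : x <= y -> Num.sg x <= Num.sg y.
Proof.
by move=> xy; case: (sgrP x) => hx; case: (sgrP y) => hy; lra.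
Qed.

(* For [q > 0] and [r >= 0] this is the probability that a Brownian motion started from [r]
   does not hit 0 before time [q]. *)
Definition gsign q r : R := \int[N 1]_x Num.sg (r + Num.sqrt q * x).

Lemma bmf_gsign q r : bounded_measurable (fun x => Num.sg (r + Num.sqrt q * x)).
Proof.
split; last by exists 1 => x; exact: normr_sgr_le1.
by apply: (measurableT_comp measurable_sgr); apply: measurable_funD => //.
Qed.

Lemma gsign_bound q r : `|gsign q r| <= 1.
Proof.
have [m _] := bmf_gsign q r.
exact: (prob_Rintegral_bound (N 1) m (fun x => normr_sgr_le1 _)).
Qed.

Lemma gsign0 r : gsign 0 r = Num.sg r.
Proof.
rewrite /gsign -[RHS](prob_Rintegral_cst (N 1)); apply: eq_Rintegral => x _.
by rewrite sqrtr0 mul0r addr0.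
Qed.

Lemma gsign_homo q : {homo gsign q : x y / x <= y}.
Proof.
move=> x y xy; apply: le_Rintegral => //; [exact: bmf_integrable_normal (bmf_gsign _ _)..|].
by move=> t _; apply: sgr_homo; rewrite lerD2r.
Qed.

Lemma Rintegral_normalN s (f : R -> R) : 0 < s -> bounded_measurable f ->
  \int[N s]_x f (- x) = \int[N s]_x f x.
Proof.
move=> s0 bf; have [mf [M fM]] := bf.
have bfN : bounded_measurable (fun x => f (- x)).
  by split; [exact: (measurableT_comp mf)|exists M => x].
apply: (addIr M); apply: EFin_inj; rewrite -(integral_shift (N s) M bf) -(integral_shift (N s) M bfN).
apply: (ge0_integral_normalN (f := fun x => (f x + M)%:E) s0).
  by apply/measurable_EFinP; apply: measurable_funD.
by move=> z; rewrite lee_fin; have := fM z; rewrite ler_norml => /andP[]; lra.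
Qed.

Lemma gsignN q r : gsign q (- r) = - gsign q r.
Proof.
rewrite /gsign -(Rintegral_normalN ltr01 (bmf_gsign q (- r))) -[RHS]mulN1r.
rewrite -(RintegralZl (-1) measurableT (bmf_integrable_normal 1 (bmf_gsign q r))).
by apply: eq_Rintegral => x _; rewrite mulrN -opprD sgrN mulN1r.
Qed.

Lemma gsign_ge0 q r : 0 <= r -> 0 <= gsign q r.
Proof.
move=> r0; have := gsign_homo q (x := - r) (y := r); rewrite gsignN => /(_ _); lra.
Qed.

Lemma gsign_scale q r : 0 < q -> gsign q r = gsign 1 (r / Num.sqrt q).
Proof.
move=> q0; apply: eq_Rintegral => x _; rewrite sqrtr1 mul1r.
have s0 : 0 < Num.sqrt q by rewrite sqrtr_gt0.
have -> : r + Num.sqrt q * x = Num.sqrt q * (r / Num.sqrt q + x).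
  by rewrite mulrDr mulrCA divff ?mulr1// gt_eqF.
by rewrite sgrM (gtr0_sg s0) mul1r.
Qed.

(** Two independent standard normals enter through [Num.sqrt q * y + s * x]; a rotation turns this
    sum into [Num.sqrt (q + s ^+ 2)] times a single one of them. *)
Lemma gsign_conv q s r : 0 <= q -> \int[N 1]_x gsign q (r + s * x) = gsign (q + s ^+ 2) r.
Proof.
move=> q0; set a := Num.sqrt (q + s ^+ 2).
have a2 : a ^+ 2 = q + s ^+ 2 by rewrite sqr_sqrtr// addr_ge0// sqr_ge0.
have [a0|a0] := eqVneq a 0.
  move: a2; rewrite a0 expr0n/= => /esym/eqP; rewrite paddr_eq0// ?sqr_ge0//.
  rewrite sqrf_eq0 => /andP[/eqP qE /eqP sE].
  rewrite -(prob_Rintegral_cst (N 1) (gsign (q + s ^+ 2) r)); apply: eq_Rintegral => x _.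
  by rewrite qE sE expr0n/= addr0 mul0r addr0.
have ap : 0 < a by rewrite lt_neqAle eq_sym a0 sqrtr_ge0.
pose c := Num.sqrt q / a; pose k := s / a.
have ck : c ^+ 2 + k ^+ 2 = 1.
  by rewrite /c /k !expr_div_n sqr_sqrtr// -mulrDl -a2 divff// sqrf_eq0.
have c1 : c != -1.
  by rewrite gt_eqF// (@lt_le_trans _ _ 0)// divr_ge0// sqrtr_ge0.
pose h (z : R * R) := Num.sg (r + a * z.2).
have bh : bounded_measurable h.
  split; last by exists 1 => x; exact: normr_sgr_le1.
  by apply: (measurableT_comp measurable_sgr); apply: measurable_funD => //; apply: measurable_funM.
have := normal_rotation_bounded ck c1 bh.
have -> : \int[N 1]_x \int[N 1]_y h (x, y) = gsign (q + s ^+ 2) r.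
  by rewrite -[RHS](prob_Rintegral_cst (N 1)).
move=> <-; apply: eq_Rintegral => x _; apply: eq_Rintegral => y _.
rewrite /h /=; congr Num.sg; rewrite /k /c mulrDr !mulrA !(mulrC a) -!mulrA !mulrA.
by rewrite !mulfK// addrA.
Qed.

Definition phi1 x : R := normal_pdf 0 1 x.

Lemma phi1_gt0 x : 0 < phi1 x.
Proof. by rewrite /phi1 normal_pdf0E// mulr_gt0 ?expR_gt0 ?normal_peak_gt0. Qed.

Lemma phi1_le x y : `|x| <= `|y| -> phi1 y <= phi1 x.
Proof.
move=> xy; rewrite /phi1 !normal_pdf0E// ler_wpM2l ?normal_peak_ge0// ler_expR lerN2.
rewrite ler_wpM2r// ?invr_ge0 ?expr1n//.
by rewrite -(real_normK (num_real x)) -(real_normK (num_real y)) ler_pXn2r ?nnegrE.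
Qed.

Let normal_itv_le (a b c : R) : a <= b -> (forall t, a <= t <= b -> phi1 t <= c) ->
  fine (N 1 `[a, b]%classic) <= c * (b - a).
Proof.
move=> ab H; rewrite -lee_fin fineK; last exact: fin_num_measure.
rewrite /normal_prob.
apply: (@le_trans _ _ (\int[mu]_(x in `[a, b]) c%:E)%E).
  apply: ge0_le_integral => //.
  - by move=> x _; rewrite lee_fin normal_pdf_ge0.
  - by apply/measurable_EFinP; apply: measurable_funTS; exact: measurable_normal_pdf.
rewrite integral_cst//= lebesgue_measure_itv/= lte_fin.
case: ltP => [|ba]; first by rewrite -EFinD -EFinM.
by rewrite mule0 (_ : b - a = 0) ?mulr0//; apply/eqP; rewrite subr_eq0 eq_le ab ba.
Qed.

Let normal_itv_ge (a b c : R) : a <= b -> 0 <= c -> (forall t, a < t < b -> c <= phi1 t) ->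
  c * (b - a) <= fine (N 1 `]a, b[%classic).
Proof.
move=> ab c0 H; rewrite -lee_fin fineK; last exact: fin_num_measure.
rewrite /normal_prob.
apply: (@le_trans _ _ (\int[mu]_(x in `]a, b[) c%:E)%E); last first.
  apply: ge0_le_integral => //.
  - by apply/measurable_EFinP; apply: measurable_funTS; exact: measurable_normal_pdf.
rewrite integral_cst//= lebesgue_measure_itv/= lte_fin.
case: ltP => [|ba]; first by rewrite -EFinD -EFinM.
by rewrite mule0 (_ : b - a = 0) ?mulr0//; apply/eqP; rewrite subr_eq0 eq_le ab ba.
Qed.

(** Concavity on the half-line, with [2 * phi1] as derivative of [gsign 1]: the increment is twice
    the normal mass between [- y] and [- x], and the density decreases with the distance to 0. *)
Lemma gsign_tangent x y : 0 <= x -> 0 <= y ->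
  gsign 1 y <= gsign 1 x + 2 * phi1 x * (y - x).
Proof.
move=> x0 y0.
have bi (A : set R) : measurable A -> bounded_measurable (fun t : R => 2 * \1_A t : R).
  by move=> mA; apply: bmfM; [exact: bmf_cst|exact: bmf_indic].
have iE (A : set R) : measurable A -> \int[N 1]_t (2 * \1_A t) = 2 * fine (N 1 A).
  move=> mA; rewrite RintegralZl//; last exact/bmf_integrable_normal/bmf_indic.
  by rewrite prob_Rintegral_indic.
have gi z := bmf_integrable_normal 1 (bmf_gsign 1 z).
have dE a b : gsign 1 a - gsign 1 b = \int[N 1]_t (Num.sg (a + t) - Num.sg (b + t)).
  by rewrite /gsign -RintegralB//; apply: eq_Rintegral => t _; rewrite sqrtr1 !mul1r.
have bd (a b : R) : bounded_measurable (fun t : R => Num.sg (a + t) - Num.sg (b + t)).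
  have := bmfB (bmf_gsign 1 a) (bmf_gsign 1 b).
  by congr bounded_measurable; apply/funext => t; rewrite sqrtr1 !mul1r.
rewrite addrC -lerBlDr dE.
have [xy|yx] := leP x y.
  (* Closed for this upper bound, open for the lower bound in the other case: where [x + t] or
     [y + t] vanishes the sign is 0, and the pointwise comparison must hold there as well. *)
  have mI : measurable (`[- y, - x]%classic : set R) by [].
  apply: (@le_trans _ _ (2 * fine (N 1 `[- y, - x]%classic))).
    rewrite -iE//; apply: le_Rintegral => //; [exact/bmf_integrable_normal/bd|exact/bmf_integrable_normal/bi|].
    move=> t _; rewrite indicE; case: (boolP (t \in _)) => [_|].
      rewrite mulr1; have := normr_sgr_le1 (y + t); have := normr_sgr_le1 (x + t).
      by rewrite !ler_norml => /andP[? ?] /andP[? ?]; lra.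
    rewrite notin_setE/= in_itv/= mulr0 => /negP; rewrite negb_and -!ltNge => /orP[h|h].
      by rewrite !ltr0_sg ?subrr//; lra.
    by rewrite !gtr0_sg ?subrr//; lra.
  rewrite -mulrA ler_wpM2l//.
  have -> : y - x = - x - - y by lra.
  apply: normal_itv_le; first by lra.
  move=> t /andP[h1 h2]; apply: phi1_le; rewrite (ger0_norm x0) ler0_norm; lra.
have mI : measurable (`]- x, - y[%classic : set R) by [].
rewrite -lerN2 -mulrN opprB.
apply: (@le_trans _ _ (2 * fine (N 1 `]- x, - y[%classic))).
  rewrite -mulrA ler_wpM2l//.
  have -> : x - y = - y - - x by lra.
  apply: normal_itv_ge; [by lra|exact/ltW/phi1_gt0|].
  move=> t /andP[h1 h2]; apply: phi1_le; rewrite (ger0_norm x0) ler0_norm; lra.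
rewrite -dE opprB dE -iE//; apply: le_Rintegral => //; [exact/bmf_integrable_normal/bi|exact/bmf_integrable_normal/bd|].
move=> t _; rewrite indicE; case: (boolP (t \in _)) => [|_].
  rewrite inE/= in_itv/= mulr1 => /andP[h1 h2].
  by rewrite gtr0_sg ?ltr0_sg; lra.
by rewrite mulr0 subr_ge0 sgr_homo// lerD2r ltW.
Qed.

End gsign.

(** * Reflection coupling of two one-dimensional normals *)

Section reflection.
Context {R : realType}.
Notation mu := (@lebesgue_measure R).
Notation N s := (normal_prob (0 : R) s).
Implicit Types (q r x y s : R).

Lemma gsignr0 q : gsign q 0 = 0 :> R.
Proof. have := gsignN q 0; rewrite oppr0; lra. Qed.

Lemma measurable_gsign q : measurable_fun setT (gsign q).
Proof. by apply: nondecreasing_measurable => // x y; exact: gsign_homo. Qed.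

Lemma bmf_gsign_comp q (f : R -> R) : measurable_fun setT f ->
  bounded_measurable (fun x => gsign q (f x)).
Proof.
move=> mf; split; last by exists 1 => x; exact: gsign_bound.
exact: (measurableT_comp (measurable_gsign q) mf).
Qed.

Lemma Rintegral_normal_scale s (f : R -> R) : 0 < s -> bounded_measurable f ->
  \int[N s]_x f x = \int[N 1]_x f (s * x).
Proof.
move=> s0 bf; have [mf [M fM]] := bf.
have bfs : bounded_measurable (fun x : R => f (s * x)).
  by split; [apply: (measurableT_comp mf); exact: measurable_funM|exists M => x].
apply: (addIr M); apply: EFin_inj.
transitivity (\int[N s]_x (f x + M)%:E)%E; first exact: (esym (integral_shift (N s) M bf)).
transitivity (\int[N 1]_x (f (s * x) + M)%:E)%E; last exact: (integral_shift (N 1) M bfs).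
apply: (ge0_integral_normal_scale (f := fun x => (f x + M)%:E) s0).
  by apply/measurable_EFinP; apply: measurable_funD.
by move=> z; rewrite lee_fin; have := fM z; rewrite ler_norml => /andP[]; lra.
Qed.

Let shifted s k (f : R -> R) : (N s).-integrable setT (EFin \o f) ->
  mu.-integrable setT (EFin \o (fun u => f (u + k) * normal_pdf 0 s (u + k))) /\
  \int[mu]_u (f (u + k) * normal_pdf 0 s (u + k)) = \int[N s]_t f t.
Proof.
move=> fi; have [h1 h2] := integral_translate k (integrable_normal fi).
by split; [exact: h1|exact: (etrans h2 (esym (Rintegral_normal fi)))].
Qed.

Let RD (f g : R -> R) : mu.-integrable setT (EFin \o f) -> mu.-integrable setT (EFin \o g) ->
  mu.-integrable setT (EFin \o (fun u => f u + g u)) /\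
  \int[mu]_u (f u + g u) = \int[mu]_u f u + \int[mu]_u g u.
Proof.
move=> fi gi; split; last exact: RintegralD.
exact: (integrableD measurableT fi gi).
Qed.

Let RZ k (f : R -> R) : mu.-integrable setT (EFin \o f) ->
  mu.-integrable setT (EFin \o (fun u => k * f u)) /\
  \int[mu]_u (k * f u) = k * \int[mu]_u f u.
Proof.
move=> fi; split; last exact: RintegralZl.
exact: (integrableZl measurableT k fi).
Qed.

(* Maximal coupling of the normal laws centred at [x] and [y], in density
   form: with [P], [P'] the two densities seen from the midpoint, the common
   mass [min P P'] is left in place and the excess mass is reflected. *)
Lemma normal_reflection s q a b beta (U V : R -> R) x y :
  0 < s -> 0 <= q -> bounded_measurable U -> bounded_measurable V ->
  (forall u v, U u - V v <= a * `|u - v| + b * gsign q `|u - v| + beta) -> y < x ->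
  \int[N s]_t U (x + t) - \int[N s]_t V (y + t) <=
    a * (x - y) + b * gsign (q + 4 * s ^+ 2) (x - y) + beta.
Proof.
move=> s0 q0 bU bV UV yx.
pose m := (x + y) / 2; pose c := (x - y) / 2.
have c0 : 0 < c by rewrite /c; lra.
pose p := normal_pdf (0 : R) s.
(* Odd in [r], so that one formula in [H (2 * u)] covers the transport of excess mass in both
   directions. *)
pose H (r : R) := a * r + b * gsign q r.
have HN r : H (- r) = - H r by rewrite /H gsignN; ring.
have pN t : p (- t) = p t.
  by case: (normal_pdfN s t) => // s0'; move: s0; rewrite s0' ltxx.
have ple t1 t2 : `|t1| <= `|t2| -> p t2 <= p t1.
  move=> t12; rewrite /p !normal_pdf0E// ler_wpM2l ?normal_peak_ge0// ler_expR lerN2.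
  rewrite ler_wpM2r//; first by rewrite invr_ge0 mulrn_wge0// sqr_ge0.
  by rewrite -(real_normK (num_real t1)) -(real_normK (num_real t2)) ler_pXn2r ?nnegrE.
have p0 t : 0 <= p t by exact: normal_pdf_ge0.
(* Symmetrised in [u] and [- u], so that its integral is twice the claim; a point and its mirror
   image are at distance [2 * |u|]. *)
have pt u : U (m + u) * p (u + - c) + U (m - u) * p (u + c) +
    -1 * (V (m + u) * p (u + c) + V (m - u) * p (u + - c)) <=
    H (2 * u) * p (u + - c) + -1 * (H (2 * u) * p (u + c)) +
    beta * (1 * p (u + c) + 1 * p (u + - c)).
  have UVd z : U z - V z <= beta.
    by apply: le_trans (UV z z) _; rewrite subrr normr0 mulr0 gsignr0 mulr0 !add0r.
  have d1 := UVd (m + u); have d2 := UVd (m - u).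
  have [u0|u0] := leP 0 u.
    have h : p (u + c) <= p (u + - c) by apply: ple; rewrite (ger0_norm (x := u + c)) ?ler_norml; lra.
    have := UV (m + u) (m - u).
    have -> : m + u - (m - u) = 2 * u by ring.
    rewrite ger0_norm; last by lra.
    rewrite -/(H (2 * u)) => d3.
    have e1 := ler_wpM2r (p0 (u + c)) d1; have e2 := ler_wpM2r (p0 (u + c)) d2.
    have e3 : (U (m + u) - V (m - u)) * (p (u + - c) - p (u + c)) <=
       (H (2 * u) + beta) * (p (u + - c) - p (u + c)) by rewrite ler_wpM2r// subr_ge0.
    clear -e1 e2 e3; move: (H (2 * u)) (p (u + c)) (p (u + - c)) (U (m + u)) (U (m - u)) (V (m + u)) (V (m - u)) e1 e2 e3.
  by clear; move=> ? ? ? ? ? ? ?; lra.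
  have h : p (u + - c) <= p (u + c).
    by apply: ple; rewrite (ler0_norm (x := u + - c)) ?ler_norml; lra.
  have := UV (m - u) (m + u).
  have -> : m - u - (m + u) = - (2 * u) by ring.
  rewrite ger0_norm; last by lra.
  rewrite -/(H (- (2 * u))) HN => d3.
  have e1 := ler_wpM2r (p0 (u + - c)) d1; have e2 := ler_wpM2r (p0 (u + - c)) d2.
  have e3 : (U (m - u) - V (m + u)) * (p (u + c) - p (u + - c)) <=
     (- H (2 * u) + beta) * (p (u + c) - p (u + - c)) by rewrite ler_wpM2r// subr_ge0.
  clear -e1 e2 e3; move: (H (2 * u)) (p (u + c)) (p (u + - c)) (U (m + u)) (U (m - u)) (V (m + u)) (V (m - u)) e1 e2 e3.
  by clear; move=> ? ? ? ? ? ? ?; lra.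
have comp (W : R -> R) (f : R -> R) : bounded_measurable W -> measurable_fun setT f ->
    bounded_measurable (fun t => W (f t)).
  by move=> [mW [M WM]] mf; split; [exact: (measurableT_comp mW mf)|exists M => t].
have m1 (z : R) : measurable_fun setT (fun t : R => z + t) by exact: measurable_funD.
have m2 (z : R) : measurable_fun setT (fun t : R => z - t) by exact: measurable_funB.
have [A1i A1] := shifted (- c) (bmf_integrable_normal s (comp U _ bU (m1 x))).
have [A2i A2] := shifted c (bmf_integrable_normal s (comp U _ bU (m2 x))).
have [B1i B1] := shifted c (bmf_integrable_normal s (comp V _ bV (m1 y))).
have [B2i B2] := shifted (- c) (bmf_integrable_normal s (comp V _ bV (m2 y))).
have [D1i D1] := shifted c (bmf_integrable_normal s (bmf_cst 1)).
have [D2i D2] := shifted (- c) (bmf_integrable_normal s (bmf_cst 1)).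
(* Doubling a centred normal of variance [s ^+ 2] gives variance [4 * s ^+ 2]: the random part of
   the linear term averages out, and [gsign_conv] raises [q] by that variance. *)
have HI k : (N s).-integrable setT (EFin \o (fun t => H (2 * t + k))) /\
    \int[N s]_t H (2 * t + k) = a * k + b * gsign (q + 4 * s ^+ 2) k.
  have i1 : (N s).-integrable setT (EFin \o (fun t => (2 * a) * t)).
    exact: (integrableZl measurableT (2 * a) (integrable_normal_id s0)).
  have bg : bounded_measurable (fun t : R => a * k + b * gsign q (2 * t + k)).
    apply: bmfD; first exact: bmf_cst.
    apply: bmfM; first exact: bmf_cst.
    by apply: bmf_gsign_comp; apply: measurable_funD => //; exact: measurable_funM.
  have E t : H (2 * t + k) = (2 * a) * t + (a * k + b * gsign q (2 * t + k)).
    by rewrite /H mulrDr addrA; congr (_ + _ + _); ring.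
  have -> : (fun t => H (2 * t + k)) = (fun t => (2 * a) * t + (a * k + b * gsign q (2 * t + k))).
    by apply/funext => t; exact: E.
  split; first exact: (integrableD measurableT i1 (bmf_integrable_normal s bg)).
  rewrite RintegralD//; last exact: bmf_integrable_normal.
  rewrite RintegralZl//; last exact: integrable_normal_id.
  rewrite integral_normal_id// mulr0 add0r (Rintegral_normal_scale s0 bg).
  have bg1 : bounded_measurable (fun t : R => gsign q (k + 2 * s * t)).
    by apply: bmf_gsign_comp; apply: measurable_funD => //; exact: measurable_funM.
  transitivity (\int[N 1]_t (a * k + b * gsign q (k + 2 * s * t))).
    by apply: eq_Rintegral => t _; rewrite mulrA (addrC _ k).
  rewrite RintegralD//; last 2 first.
  - exact: (bmf_integrable_normal 1 (bmf_cst _)).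
  - by apply: (bmf_integrable_normal 1); apply: bmfM => //; exact: bmf_cst.
  rewrite (prob_Rintegral_cst (N 1)) RintegralZl//; last exact: (bmf_integrable_normal 1 bg1).
  have four : (2 : R) ^+ 2 = 4 by ring.
  by rewrite gsign_conv// exprMn four.
have [C1i C1] := shifted (- c) (HI (2 * c)).1.
have [C2i C2] := shifted c (HI (- (2 * c))).1.
rewrite (HI _).2 in C1; rewrite (HI _).2 gsignN in C2.
rewrite (Rintegral_normalN s0 (comp U _ bU (m1 x))) in A2.
rewrite (Rintegral_normalN s0 (comp V _ bV (m1 y))) in B2.
rewrite (prob_Rintegral_cst (N s)) in D1; rewrite (prob_Rintegral_cst (N s)) in D2.
set I1 := \int[N s]_t U (x + t) in A1 A2 *; set I2 := \int[N s]_t V (y + t) in B1 B2 *.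
clearbody I1 I2.
have [L1i L1] := RD A1i A2i; have [L2i L2] := RD B1i B2i.
have [L3i L3] := RZ (-1) L2i; have [Li L] := RD L1i L3i.
have [K1i K1] := RZ (-1) C2i; have [K2i K2] := RD C1i K1i.
have [K3i K3] := RD D1i D2i; have [K4i K4] := RZ beta K3i; have [Ki K] := RD K2i K4i.
have key := @le_Rintegral _ _ _ mu setT _ _ measurableT Li Ki.
move: key; rewrite L L1 L3 L2 A1 A2 B1 B2 K K2 K4 K3 C1 K1 C2 D1 D2 => key.
have xyc : x - y = 2 * c by rewrite /c; field.
rewrite xyc; set g := gsign (q + 4 * s ^+ 2) (2 * c) in key *; clearbody g.
suff : I1 + I1 + -1 * (I2 + I2) <= a * (2 * c) + b * g +
    -1 * (a * - (2 * c) + b * - g) + beta * (1 + 1).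
  by clear; lra.
apply: key => u _; rewrite -/p.
have -> : 2 * (u + - c) + 2 * c = 2 * u by ring.
have -> : 2 * (u + c) + - (2 * c) = 2 * u by ring.
have -> : x + (u + - c) = m + u by rewrite /m /c; field.
have -> : x - (u + c) = m - u by rewrite /m /c; field.
have -> : y + (u + c) = m + u by rewrite /m /c; field.
have -> : y - (u + - c) = m - u by rewrite /m /c; field.
exact: pt.
Qed.

End reflection.

(** * Gaussian reflection in dimension d *)
Section double_integral.
Context {R : realType} {d1 d2 : measure_display} {T1 : measurableType d1}
  {T2 : measurableType d2} (P : probability T1 R) (Q : probability T2 R).

Lemma bmf_pair1 (h : T1 * T2 -> R) x : bounded_measurable h ->
  bounded_measurable (fun y => h (x, y)).
Proof.
move=> [mh [M hM]]; split; last by exists M => y.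
by apply: (measurableT_comp mh); apply: measurable_fun_pair.
Qed.

Lemma bmf_Rintegral (h : T1 * T2 -> R) : bounded_measurable h ->
  bounded_measurable (fun x => \int[Q]_y h (x, y)).
Proof.
move=> bh; have [mh [M hM]] := bh.
split; last first.
  by exists M => x; have [m _] := bmf_pair1 x bh; exact: prob_Rintegral_bound.
have -> : (fun x => \int[Q]_y h (x, y)) = (fun x => fine (\int[Q]_y (h (x, y) + M)%:E)%E - M).
  by apply/funext => x; rewrite (integral_shift Q M (bmf_pair1 x bh))/= addrK.
apply: measurable_funB => //; apply: measurableT_comp => //.
apply: (@measurable_fun_fubini_tonelli_F _ _ _ _ _ Q (fun z => (h z + M)%:E)).
  by apply/measurable_EFinP; apply: measurable_funD.
by move=> z; rewrite lee_fin; have := hM z; rewrite ler_norml => /andP[]; lra.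
Qed.

Lemma integral2_shift (h : T1 * T2 -> R) M : bounded_measurable h ->
  (\int[P]_x \int[Q]_y (h (x, y) + M)%:E)%E = (\int[P]_x \int[Q]_y h (x, y) + M)%:E.
Proof.
move=> bh; transitivity (\int[P]_x (\int[Q]_y h (x, y) + M)%:E)%E.
  by apply: eq_integral => x _; exact: (integral_shift Q M (bmf_pair1 x bh)).
exact: (integral_shift P M (bmf_Rintegral bh)).
Qed.

End double_integral.

Section normal_rotation_scale.
Context {R : realType}.
Notation N s := (normal_prob (0 : R) s).

Lemma ge0_normal_rotation_scale (sd c s : R) (f : R * R -> \bar R) : 0 < sd ->
  c ^+ 2 + s ^+ 2 = 1 -> c != -1 ->
  measurable_fun setT f -> (forall z, (0 <= f z)%E) ->
  (\int[N sd]_x \int[N sd]_y f (c * x - s * y, s * x + c * y)%R =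
   \int[N sd]_x \int[N sd]_y f (x, y))%E.
Proof.
move=> sd0 cs c1 mf f0.
have E (g : R * R -> \bar R) : measurable_fun setT g -> (forall z, (0 <= g z)%E) ->
    (\int[N sd]_x \int[N sd]_y g (x, y) = \int[N 1]_x \int[N 1]_y g (sd * x, sd * y)%R)%E.
  move=> mg g0.
  rewrite (ge0_integral_normal_scale (f := fun x => \int[N sd]_y g (x, y))%E sd0).
  - apply: eq_integral => x _.
    apply: (ge0_integral_normal_scale (f := fun y => g (sd * x, y)%R) sd0) => //.
    by apply: (measurableT_comp mg); apply: measurable_fun_pair.
  - exact: (@measurable_fun_fubini_tonelli_F _ _ _ _ _ (N sd) g mg g0).
  - by move=> x; exact: integral_ge0.
have mrot : measurable_fun setT (fun z : R * R => (c * z.1 - s * z.2, s * z.1 + c * z.2)).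
  by apply: measurable_fun_pair; [apply: measurable_funB|apply: measurable_funD];
    apply: measurable_funM.
rewrite (E _ mf f0).
transitivity (\int[N 1]_x \int[N 1]_y f (c * (sd * x) - s * (sd * y), s * (sd * x) + c * (sd * y))%R)%E.
  exact: (E _ (measurableT_comp mf mrot) (fun z => f0 _)).
pose g (z : R * R) := f (sd * z.1, sd * z.2).
have mg : measurable_fun setT g.
  apply: (measurableT_comp mf); apply: measurable_fun_pair; exact: measurable_funM.
rewrite -[RHS](ge0_normal_rotation cs c1 mg (fun z => f0 _)).
apply: eq_integral => x _; apply: eq_integral => y _; rewrite /g; cbn [fst snd].
by congr (f (_, _)); ring.
Qed.

End normal_rotation_scale.

(** * Gaussian vectors: resampling and rotations *)

Section gaussian.
Context {R : realType} {d : nat}.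
Notation N s := (normal_prob (0 : R) s).
Implicit Types (s : R) (z e : 'rV[R]_d).

(** A specification on rectangles rather than a construction: existence is settled later by taking
    the law of a Brownian increment. The parameter [s] is the standard deviation of each
    coordinate. *)
Definition gaussian_law s (gamma : {measure set 'rV[R]_d -> \bar R}) :=
  forall A : 'I_d -> set R, (forall i, measurable (A i)) ->
    gamma (rectangle A) = (\prod_(i < d) N s (A i))%E.

Definition set_coord z (i : 'I_d) (t : R) : 'rV[R]_d :=
  \row_j (if j == i then t else z 0 j).

Lemma measurable_set_coord i :
  measurable_fun setT (fun p : 'rV[R]_d * R => set_coord p.1 i p.2).
Proof.
apply: measurable_fun_rV => j.
have -> : (fun p : 'rV[R]_d * R => set_coord p.1 i p.2 0 j) =
   if j == i then (fun p : 'rV[R]_d * R => p.2) else (fun p : 'rV[R]_d * R => p.1 0 j).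
  by apply/funext => p; rewrite mxE; case: ifP.
case: ifP => _; first exact: measurable_snd.
exact: (measurableT_comp (measurable_coord j) measurable_fst).
Qed.

(** Independence of the coordinates in integrated form: drawing coordinate [i] afresh leaves the law
    unchanged, as is seen on rectangles. *)
Lemma gaussian_resample s (gamma : probability 'rV[R]_d R) i (f : 'rV[R]_d -> \bar R) :
  gaussian_law s gamma -> measurable_fun setT f -> (forall z, (0 <= f z)%E) ->
  (\int[gamma]_z f z = \int[gamma]_z \int[N s]_t f (set_coord z i t))%E.
Proof.
move=> gl mf f0.
have msc := measurable_set_coord i.
pose m' : {measure set 'rV[R]_d -> \bar R} :=
  pushforward (gamma \x (N s))%E (fun p : 'rV[R]_d * R => set_coord p.1 i p.2).
rewrite (@eq_measure_integral _ _ _ _ (m' msc)); last first.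
  move=> A mA _; apply: eq_prob_rV => //.
    exact: le_lt_trans (probability_le1 gamma measurableT) (ltry _).
  move=> B mB; rewrite /m' /= /pushforward.
  pose C : 'I_d -> set R := fun j => if j == i then setT else B j.
  have mC j : measurable (C j) by rewrite /C; case: ifP.
  rewrite (_ : _ @^-1` _ = rectangle C `*` B i); last first.
    apply/seteqP; split => [[z t] /= H|[z t] /= [H1 H2] j].
      split => [j|]; last by have := H i; rewrite mxE eqxx.
      by rewrite /C; case: ifPn => // ji; have := H j; rewrite mxE (negbTE ji).
    rewrite mxE; case: ifPn => [/eqP-> //|ji].
    by have := H1 j; rewrite /C (negbTE ji).
  have mRC := measurable_rectangle mC.
  rewrite (product_measure1E gamma (N s) mRC (mB i)).
  rewrite (gl _ mB); transitivity (gamma (rectangle C) * N s (B i))%E; last by [].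
  rewrite (gl _ mC).
  rewrite (bigD1 i)//= [in RHS](bigD1 i)//= /C eqxx probability_setT mul1e muleC.
  by congr (_ * _)%E; apply: eq_bigr => j /negbTE ->.
rewrite ge0_integral_pushforward//.
rewrite preimage_setT.
exact: (fubini_tonelli1 (m1 := gamma) (m2 := N s)
  (fun p : 'rV[R]_d * R => f (set_coord p.1 i p.2)) (measurableT_comp mf msc) (fun p => f0 _)).
Qed.


End gaussian.

Section gaussian_directions.
Context {R : realType} {d : nat}.
Notation N s := (normal_prob (0 : R) s).
Implicit Types (s : R) (z e : 'rV[R]_d).
Definition givens (c k : R) (i j : 'I_d) z : 'rV[R]_d :=
  \row_l (if l == i then c * z 0 i - k * z 0 j
          else if l == j then k * z 0 i + c * z 0 j else z 0 l).

Lemma measurable_givens c k i j : measurable_fun setT (givens c k i j).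
Proof.
apply: measurable_fun_rV => l.
have m (l' : 'I_d) a : measurable_fun setT (fun z : 'rV[R]_d => a * z 0 l').
  by apply: measurable_funM => //; exact: measurable_coord.
have -> : (fun z : 'rV[R]_d => givens c k i j z 0 l) =
   if l == i then (fun z : 'rV[R]_d => c * z 0 i - k * z 0 j) else
   if l == j then (fun z : 'rV[R]_d => k * z 0 i + c * z 0 j) else (fun z : 'rV[R]_d => z 0 l).
  by apply/funext => z; rewrite mxE; do 2 case: ifP => // _.
case: ifP => _; first exact: measurable_funB.
by case: ifP => _; [exact: measurable_funD|exact: measurable_coord].
Qed.

Lemma givens_lin c k i j (a : R) u v :
  givens c k i j (u + a *: v) = givens c k i j u + a *: givens c k i j v.
Proof.
by apply/rowP => l; rewrite !mxE; case: ifP => _; last case: ifP => _ //; ring.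
Qed.

(** Resampling both coordinates reduces the claim to the rotation invariance of a pair of
    independent normals. *)
Lemma gaussian_givens s (gamma : probability 'rV[R]_d R) c k i j (f : 'rV[R]_d -> \bar R) :
  0 < s -> i != j -> c ^+ 2 + k ^+ 2 = 1 -> c != -1 ->
  gaussian_law s gamma -> measurable_fun setT f -> (forall z, (0 <= f z)%E) ->
  (\int[gamma]_z f (givens c k i j z) = \int[gamma]_z f z)%E.
Proof.
move=> s0 ij ck c1 gl mf f0.
have msc2 z : measurable_fun setT (fun p : R * R => set_coord (set_coord z i p.1) j p.2).
  have h1 : measurable_fun setT (fun p : R * R => set_coord z i p.1).
    apply: (measurableT_comp (measurable_set_coord i)
      (g := fun p : R * R => (z, p.1))).
    by apply: measurable_fun_pair.
  apply: (measurableT_comp (measurable_set_coord j)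
      (g := fun p : R * R => (set_coord z i p.1, p.2))).
  by apply: measurable_fun_pair.
have E (g : 'rV[R]_d -> \bar R) : measurable_fun setT g -> (forall z, (0 <= g z)%E) ->
   (\int[gamma]_z g z = \int[gamma]_z \int[N s]_x \int[N s]_y
     g (set_coord (set_coord z i x) j y))%E.
  move=> mg g0; rewrite (gaussian_resample j gl mg g0).
  apply: (gaussian_resample i (f := fun z => \int[N s]_t g (set_coord z j t))%E gl) => [|z].
    apply: (@measurable_fun_fubini_tonelli_F _ _ _ _ _ (N s) (fun p : 'rV[R]_d * R => g (set_coord p.1 j p.2))).
      exact: (measurableT_comp mg (measurable_set_coord j)).
    by move=> p; exact: g0.
  exact: integral_ge0.
rewrite (E _ (measurableT_comp mf (measurable_givens c k i j)) (fun z => f0 _)) (E _ mf f0).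
apply: eq_integral => z _.
have mfz : measurable_fun setT (fun p : R * R => f (set_coord (set_coord z i p.1) j p.2)).
  exact: (measurableT_comp mf (msc2 z)).
rewrite -[RHS](ge0_normal_rotation_scale s0 ck c1 mfz (fun p => f0 _)).
apply: eq_integral => x _; apply: eq_integral => y _; cbn [fst snd]; congr f.
apply/rowP => l; rewrite !mxE eqxx (negbTE ij) eqxx.
have [->|li] := eqVneq l i; first by rewrite (negbTE ij).
by case: (eqVneq l j).
Qed.

(** Splits the noise into a multiple [t] of [e] and a part [A z] independent of [t]. Induction on
    the number of nonzero coordinates of [e]: a plane rotation carries a unit vector with one
    nonzero coordinate fewer to [e]. In the end [e] is plus or minus a basis vector, and [A] erases
    that coordinate. *)
Lemma gaussian_direction s (gamma : probability 'rV[R]_d R) e :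
  0 < s -> gaussian_law s gamma -> dotp e e = 1 ->
  exists A : 'rV[R]_d -> 'rV[R]_d, measurable_fun setT A /\
    forall f : 'rV[R]_d -> \bar R, measurable_fun setT f -> (forall z, (0 <= f z)%E) ->
    (\int[gamma]_z f z = \int[gamma]_z \int[N s]_t f (A z + t *: e)%R)%E.
Proof.
move=> s0 gl; move: {2}(#|_|) (leqnn #|[pred i | e 0 i != 0]|) => n.
elim: n e => [|n IH] e en e1.
  have e0 : e = 0.
    apply/rowP => i; rewrite mxE; apply/eqP; apply: contraT => ei.
    by move: en; rewrite leqn0 => /eqP/card0_eq/(_ i); rewrite inE ei.
  move: e1; rewrite e0 -(scale0r (0 : 'rV[R]_d)) dotpZl mul0r => /eqP.
  by rewrite eq_sym oner_eq0.
have /existsP[i ei] : [exists i, e 0 i != 0].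
  rewrite -negb_forall; apply/negP => /forallP H; move: e1; rewrite /dotp big1.
    by move=> /eqP; rewrite eq_sym oner_eq0.
  by move=> i _; rewrite (eqP (H i)) mul0r.
have [/existsP[j /andP[ij ej]]|/existsPn H] := boolP [exists j, (i != j) && (e 0 j != 0)].
  (* The sign makes [c] nonnegative, hence different from -1. *)
  pose rho := Num.sg (e 0 i) * Num.sqrt (e 0 i ^+ 2 + e 0 j ^+ 2).
  have S0 : 0 < e 0 i ^+ 2 + e 0 j ^+ 2.
    by rewrite ltr_wpDr ?sqr_ge0// exprn_even_gt0.
  have rho2 : rho ^+ 2 = e 0 i ^+ 2 + e 0 j ^+ 2.
    by rewrite exprMn sqr_sg ei mul1r sqr_sqrtr ?ltW.
  have rho0 : rho != 0 by rewrite -sqrf_eq0 rho2 gt_eqF.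
  pose c := e 0 i / rho; pose k := e 0 j / rho.
  have ck : c ^+ 2 + k ^+ 2 = 1.
    by rewrite /c /k !expr_div_n -mulrDl -rho2 divff// sqrf_eq0.
  have c1 : c != -1.
    rewrite gt_eqF// (@lt_le_trans _ _ 0)// /c /rho invfM mulrA.
    rewrite mulr_ge0 ?invr_ge0 ?sqrtr_ge0//.
    by rewrite {1}(numEsg (e 0 i)) mulrAC divff ?sgr_eq0// mul1r.
  pose e' : 'rV[R]_d := \row_l (if l == i then rho else if l == j then 0 else e 0 l).
  have ge : givens c k i j e' = e.
    apply/rowP => l; rewrite !mxE eqxx (eq_sym j) (negbTE ij) eqxx.
    have [->|li] := eqVneq l i; first by rewrite mulr0 subr0 /c divfK.
    by have [->|lj] := eqVneq l j; rewrite ?mulr0 ?addr0 /k ?divfK.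
  have e'1 : dotp e' e' = 1.
    rewrite -e1 /dotp (bigD1 i)//= [RHS](bigD1 i)//= (bigD1 j) ?(eq_sym j)//=.
    rewrite [in RHS](bigD1 j) ?(eq_sym j)//= !addrA !mxE !eqxx (eq_sym j) (negbTE ij).
    rewrite mulr0 addr0 -!expr2 rho2; congr (_ + _); apply: eq_bigr => l /andP[li lj].
    by rewrite mxE (negbTE li) (negbTE lj).
  have [|A [mA HA]] := IH e' _ e'1.
    rewrite -ltnS; apply: leq_trans en; apply: proper_card; apply/properP; split.
      apply/fintype.subsetP => l; rewrite !inE mxE; have [->|li] := eqVneq l i; first by rewrite ei.
      by have [->|lj] := eqVneq l j; rewrite ?eqxx.
    by exists j; rewrite !inE ?mxE ?eqxx ?(eq_sym j) ?(negbTE ij)// eqxx.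
  exists (givens c k i j \o A); split.
    exact: (measurableT_comp (measurable_givens c k i j) mA).
  move=> f mf f0; rewrite -(gaussian_givens s0 ij ck c1 gl mf f0).
  rewrite (HA _ (measurableT_comp mf (measurable_givens c k i j)) (fun z => f0 _)).
  apply: eq_integral => z _; apply: eq_integral => t _ /=.
  by rewrite givens_lin ge.
have ej j : j != i -> e 0 j = 0.
  by move=> ji; have := H j; rewrite eq_sym ji/= negbK => /eqP.
have ei1 : e 0 i = 1 \/ e 0 i = -1.
  have : e 0 i ^+ 2 = 1.
    by rewrite -e1 /dotp (bigD1 i)//= big1 ?addr0 ?expr2// => j ji; rewrite ej ?mul0r.
  by move=> /eqP; rewrite sqrf_eq1 => /orP[] /eqP ->; [left|right].
exists (fun z => set_coord z i 0); split.
  apply: (measurableT_comp (measurable_set_coord i) (g := fun z : 'rV[R]_d => (z, 0 : R))).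
  by apply: measurable_fun_pair.
move=> f mf f0; rewrite (gaussian_resample i gl mf f0).
apply: eq_integral => z _.
have mz : measurable_fun setT (fun t : R => f (set_coord z i t)).
  apply: (measurableT_comp mf); apply: (measurableT_comp (measurable_set_coord i)
      (g := fun t : R => (z, t))).
  by apply: measurable_fun_pair.
have E t : set_coord z i 0 + t *: e = set_coord z i (t * e 0 i).
  apply/rowP => l; rewrite !mxE; have [->|li] := eqVneq l i; first by rewrite add0r.
  by rewrite (ej _ li) mulr0 addr0.
case: ei1 => ei1.
  by apply: eq_integral => t _; rewrite E ei1 mulr1.
rewrite -(ge0_integral_normalN s0 mz (fun t => f0 _)).
by apply: eq_integral => t _; rewrite E ei1 mulrN1.
Qed.

(* Splitting the noise along the direction [x - y], on which the
   one-dimensional reflection acts. *)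
Lemma gaussian_reflection s q a b beta (gamma : probability 'rV[R]_d R) (U V : 'rV[R]_d -> R) x y :
  0 < s -> 0 <= q -> gaussian_law s gamma -> bounded_measurable U -> bounded_measurable V ->
  (forall u v, U u - V v <= a * enorm (u - v) + b * gsign q (enorm (u - v)) + beta) ->
  \int[gamma]_z U (x + z) - \int[gamma]_z V (y + z) <=
    a * enorm (x - y) + b * gsign (q + 4 * s ^+ 2) (enorm (x - y)) + beta.
Proof.
move=> s0 q0 gl bU bV UV.
have trans (W : 'rV[R]_d -> R) w : bounded_measurable W ->
    bounded_measurable (fun z => W (w + z)).
  move=> [mW [M WM]]; split; last by exists M => z.
  apply: (measurableT_comp mW); apply: measurable_fun_rV => i.
  have -> : (fun z : 'rV[R]_d => (w + z) 0 i) = (fun z : 'rV[R]_d => w 0 i + z 0 i).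
    by apply/funext => z; rewrite mxE.
  by apply: measurable_funD => //; exact: measurable_coord.
(* Equal starting points have no direction of reflection; here both copies receive the same
   noise. *)
have [xy|xy] := eqVneq (enorm (x - y)) 0.
  rewrite xy mulr0 gsignr0 mulr0 !add0r.
  have -> : x = y by apply/eqP; rewrite -subr_eq0; apply/eqP; exact: enorm_eq0.
  rewrite -RintegralB//; [|exact: (bmf_integrable gamma (trans _ _ bU))|exact: (bmf_integrable gamma (trans _ _ bV))].
  apply: (prob_le_Rintegral_cst (P := gamma)).
    by apply: (bmf_integrable gamma); apply: bmfB; exact: trans.
  move=> z; apply: le_trans (UV _ _) _.
  by rewrite subrr enorm0 mulr0 gsignr0 mulr0 !add0r.
set r := enorm (x - y) in xy *.
have r0 : 0 < r by rewrite lt_neqAle eq_sym xy enorm_ge0.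
pose e := r^-1 *: (x - y).
have e1 : dotp e e = 1.
  by rewrite dotpZl dotpZr -sqr_enorm -/r expr2 mulKf// mulVf.
have xE : x = y + r *: e by rewrite /e scalerA divff// scale1r addrC subrK.
have ee t : enorm (t *: e) = `|t| by rewrite enormZ /enorm e1 sqrtr1 mulr1.
have [A [mA HA]] := gaussian_direction s0 gl e1.
have mAe : measurable_fun setT (fun p : 'rV[R]_d * R => A p.1 + p.2 *: e).
  apply: measurable_fun_rV => i.
  have -> : (fun p : 'rV[R]_d * R => (A p.1 + p.2 *: e) 0 i) = (fun p : 'rV[R]_d * R => A p.1 0 i + p.2 * e 0 i).
    by apply/funext => z; rewrite !mxE.
  apply: measurable_funD.
    exact: (measurableT_comp (measurable_coord i) (measurableT_comp mA measurable_fst)).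
  by apply: measurable_funM.
have HR (W : 'rV[R]_d -> R) : bounded_measurable W ->
    bounded_measurable (fun p : 'rV[R]_d * R => W (A p.1 + p.2 *: e)) /\
    \int[gamma]_z W z = \int[gamma]_z \int[N s]_t W (A z + t *: e).
  move=> bW; have [mW [M WM]] := bW.
  have bWA : bounded_measurable (fun p : 'rV[R]_d * R => W (A p.1 + p.2 *: e)).
    by split; [exact: (measurableT_comp mW mAe)|exists M => p].
  split=> //; apply: (addIr M); apply: EFin_inj.
  transitivity (\int[gamma]_z (W z + M)%:E)%E; first exact: (esym (integral_shift gamma M bW)).
  transitivity (\int[gamma]_z \int[N s]_t (W (A z + t *: e) + M)%:E)%E; last first.
    exact: (integral2_shift gamma (N s) M bWA).
  apply: (HA (fun z => (W z + M)%:E)).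
    by apply/measurable_EFinP; apply: measurable_funD.
  by move=> z; rewrite lee_fin; have := WM z; rewrite ler_norml => /andP[]; lra.
have [bUA UE] := HR _ (trans _ x bU); have [bVA VE] := HR _ (trans _ y bV).
rewrite UE VE.
have iU := bmf_integrable gamma (bmf_Rintegral (N s) bUA).
have iV := bmf_integrable gamma (bmf_Rintegral (N s) bVA).
rewrite -RintegralB//.
apply: (prob_le_Rintegral_cst (P := gamma)).
  by apply: (bmf_integrable gamma); apply: bmfB; [exact: (bmf_Rintegral (N s) bUA)|exact: (bmf_Rintegral (N s) bVA)].
move=> z /=.
pose U1 (t : R) := U (y + A z + t *: e); pose V1 (t : R) := V (y + A z + t *: e).
have mline : measurable_fun setT (fun t : R => y + A z + t *: e).
  apply: measurable_fun_rV => i.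
  have -> : (fun t : R => (y + A z + t *: e) 0 i) = (fun t : R => (y + A z) 0 i + t * e 0 i).
    by apply/funext => t; rewrite !mxE.
  by apply: measurable_funD => //; apply: measurable_funM.
have b1 (W : 'rV[R]_d -> R) : bounded_measurable W -> bounded_measurable (fun t : R => W (y + A z + t *: e)).
  by move=> [mW [M WM]]; split; [exact: (measurableT_comp mW mline)|exists M => t].
(* With the component [A z] frozen, the two points sit at [r] and [0] on a line in direction [e]. *)
have := @normal_reflection R s q a b beta U1 V1 r 0 s0 q0 (b1 _ bU) (b1 _ bV) _ r0.
rewrite subr0.
have -> : \int[normal_prob 0 s]_t U1 (r + t) = \int[normal_prob 0 s]_t U (x + (A z + t *: e)).
  apply: eq_Rintegral => t _.
  by rewrite /U1 xE scalerDl; congr U; rewrite -!addrA; congr (_ + _); rewrite addrCA.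
have -> : \int[normal_prob 0 s]_t V1 (0 + t) = \int[normal_prob 0 s]_t V (y + (A z + t *: e)).
  by apply: eq_Rintegral => t _; rewrite /V1 add0r addrA.
apply=> u v; rewrite /U1 /V1; apply: le_trans (UV _ _) _.
by rewrite opprD addrACA subrr add0r -scalerBl ee.
Qed.

End gaussian_directions.

(** * Mean-field drift *)
Section real_analysis.
Context {R : realType}.
Notation mu := (@lebesgue_measure R).
Implicit Types (f D a : R -> R).

Lemma continuous_clamp f : {within [set t : R | 0 <= t], continuous f} ->
  continuous (fun t : R => f (Num.max 0 t)).
Proof.
move=> /subspace_continuousP cf x.
have mx : [set t : R | 0 <= t] (Num.max 0 x) by rewrite /= le_max lexx.
apply: (cvg_comp _ _ _ (cf _ mx)) => A [e /= e0 He].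
exists e => //= y xy; apply: He => /=; last by rewrite le_max lexx.
apply: le_lt_trans xy; rewrite /Num.max; case: ltP => h1; case: ltP => h2 //.
- by rewrite subr0 gtr0_norm// ger0_norm; lra.
- by rewrite sub0r normrN gtr0_norm// ler0_norm; lra.
- by rewrite subrr normr0.
Qed.

Lemma continuous_itv_integrable f (x y : R) : continuous f ->
  mu.-integrable `[x, y] (EFin \o f).
Proof.
move=> cf; apply: continuous_compact_integrable; first exact: segment_compact.
exact: continuous_subspaceT.
Qed.

Lemma continuous_uniform f (x y e : R) : continuous f -> 0 < e ->
  exists h : R, 0 < h /\ forall s t, x <= s <= y -> `|s - t| < h -> `|f s - f t| <= e.
Proof.
move=> cf e0.
have /compact_near_coveringP/(_ R (0^'+) (fun h s => forall t, `|s - t| < h -> `|f s - f t| <= e)) := @segment_compact R x y.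
move=> /(_ _ _) [] // => [s sxy|].
  have /cvgrPdist_le /(_ (e / 2)) := cf s.
  rewrite divr_gt0// => /(_ isT) [/= r r0 Hr].
  exists ([set s' | `|s - s'| < r / 2], [set h | 0 < h < r / 2]).
    split; first by exists (r / 2); rewrite //= divr_gt0.
    by exists (r / 2); rewrite /= ?divr_gt0// => h /=; rewrite sub0r normrN => hr h0; rewrite h0 -(gtr0_norm h0).
  move=> [s' h] /= [ss' /andP[h0 hr]] t s't.
  have h1 : `|s - t| < r.
    by rewrite (splitr r) -(subrK s' s) -addrA; apply: le_lt_trans (ler_normD _ _) _; apply: ltrD => //; apply: lt_trans s't hr.
  have h2 : `|s - s'| < r by apply: lt_le_trans ss' _; lra.
  rewrite -(subrK (f s) (f s')) -addrA (splitr e); apply: le_trans (ler_normD _ _) _.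
  by apply: lerD; [rewrite distrC; exact: Hr|exact: Hr].
move=> r /= r0 Hr; exists (r / 2); split; first by rewrite divr_gt0.
move=> s t sxy st; apply: (Hr (r / 2)) => //=.
- by rewrite sub0r normrN gtr0_norm ?divr_gt0//; lra.
- by rewrite divr_gt0.
Qed.

Lemma Rintegral_split f (x y z : R) : mu.-integrable `[x, z] (EFin \o f) ->
  x <= y -> y <= z ->
  \int[mu]_(t in `[x, z]) f t = \int[mu]_(t in `[x, y]) f t + \int[mu]_(t in `[y, z]) f t.
Proof.
move=> fi xy yz; apply/eqP; rewrite addrC -subr_eq; apply/eqP.
rewrite (@Rintegral_itvB _ f (BLeft x) (BRight z) y) ?bnd_simp//.
rewrite Rintegral_itv_obnd_cbnd//.
by apply: integrableS fi => //; apply: subset_itvr; rewrite bnd_simp.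
Qed.

Lemma Rintegral_itv_cst (x y k : R) : x <= y -> \int[mu]_(t in `[x, y]) k = k * (y - x).
Proof.
move=> xy; rewrite Rintegral_cst//= lebesgue_measure_itv/= lte_fin.
case: ltP => [|yx]; first by rewrite -EFinB.
by rewrite /= (_ : y - x = 0)//; apply/eqP; rewrite subr_eq0 eq_le xy yx.
Qed.

Lemma integrable_itv_cst (x y k : R) : mu.-integrable `[x, y] (EFin \o (fun _ : R => k)).
Proof. by apply: continuous_itv_integrable => t; exact: cvg_cst. Qed.

Lemma Rintegral_itv_le (x y : R) f g : mu.-integrable `[x, y] (EFin \o f) ->
  mu.-integrable `[x, y] (EFin \o g) -> (forall t, x <= t <= y -> f t <= g t) ->
  \int[mu]_(t in `[x, y]) f t <= \int[mu]_(t in `[x, y]) g t.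
Proof.
by move=> fi gi fg; apply: le_Rintegral => // t; rewrite /= in_itv/=; exact: fg.
Qed.

Lemma Riemann_sum_ge f (x y e : R) : continuous f -> x < y -> 0 < e ->
  \forall n \near \oo, \int[mu]_(t in `[x, y]) f t <=
    \sum_(k < n.+1) f (x + (y - x) / n.+1%:R * k%:R) * ((y - x) / n.+1%:R) + e.
Proof.
move=> cf xy e0.
have yx0 : 0 < y - x by rewrite subr_gt0.
have [h [h0 Hh]] := continuous_uniform x y cf (divr_gt0 e0 yx0).
near=> n; set dx := (y - x) / n.+1%:R.
have dx0 : 0 < dx by rewrite divr_gt0.
have dxh : dx < h.
  rewrite /dx ltr_pdivrMr// mulrC -ltr_pdivrMr//.
  apply: (@lt_trans _ _ n%:R); last by rewrite ltr_nat.
  near: n; exact: nbhs_infty_gtr.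
have K m : (m <= n.+1)%N -> \int[mu]_(t in `[x, x + dx * m%:R]) f t <=
    \sum_(k < m) f (x + dx * k%:R) * dx + e / (y - x) * (dx * m%:R).
  elim: m => [_|m IH mn].
    rewrite !mulr0 !addr0 big_ord0 set_itv1 Rintegral_set1//.
  have i1 : x <= x + dx * m%:R by rewrite lerDl mulr_ge0// ltW.
  have i2 : x + dx * m%:R <= x + dx * m.+1%:R by rewrite lerD2l ler_wpM2l ?ler_nat// ltW.
  have i3 : x + dx * m.+1%:R <= y.
    have -> : y = x + dx * n.+1%:R by rewrite /dx divfK// addrC subrK.
    by rewrite lerD2l; apply: ler_wpM2l; [exact: ltW|rewrite ler_nat].
  rewrite (Rintegral_split (continuous_itv_integrable _ _ cf) i1 i2) big_ord_recr/=.
  have := IH (ltnW mn).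
  have : \int[mu]_(t in `[x + dx * m%:R, x + dx * m.+1%:R]) f t <= (f (x + dx * m%:R) + e / (y - x)) * dx.
    have E : x + dx * m.+1%:R - (x + dx * m%:R) = dx by rewrite -natr1; ring.
    rewrite -[X in _ <= _ * X]E -Rintegral_itv_cst//.
    apply: Rintegral_itv_le; [exact: continuous_itv_integrable|exact: integrable_itv_cst|].
    move=> t /andP[t1 t2]; rewrite -lerBlDl.
    apply: le_trans (ler_norm _) _; rewrite distrC; apply: Hh.
      by rewrite i1/= (le_trans i2 i3).
    by rewrite ler0_norm; [move: E t2; lra|lra].
  rewrite -natr1; clear; move: (Rintegral _ _ _) (Rintegral _ _ _) (\sum_(_ < _) _) => A B S.
  move: (f _) (e / _) => F c; lra.
have := K n.+1 (leqnn _).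
have -> : dx * n.+1%:R = y - x by rewrite /dx divfK.
by rewrite divfK ?gt_eqF// (addrC x (y - x)) subrK.
Unshelve. all: by end_near. Qed.

(** [J] is nonincreasing: its derivative is [expR (- c * s) * (D s - c * I s) - a s], where the
    bracket is at most [a s] and the exponential at most 1. *)
Lemma gronwall D a (c t : R) : continuous D -> continuous a -> (forall s, 0 <= a s) ->
  0 <= c -> (forall s, 0 <= s -> D s <= a s + c * \int[mu]_(r in `[0, s]) D r) -> 0 <= t ->
  \int[mu]_(r in `[0, t]) D r <= expR (c * t) * \int[mu]_(r in `[0, t]) a r.
Proof.
move=> cD ca a0 c0 H; rewrite le_eqVlt => /predU1P[<-|t0].
  by rewrite set_itv1 !Rintegral_set1 mulr0.
pose I (s : R) : R := \int[mu]_(r in `[0, s]) D r; pose A (s : R) : R := \int[mu]_(r in `[0, s]) a r.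
pose J (s : R) : R := expR (- c * s) * I s - A s.
have dE (f : R -> R) (s : R) : continuous f -> 0 < s ->
    is_derive s 1 (fun s : R => \int[mu]_(r in `[0, s]) f r) (f s).
  move=> cf s0; have s1 : s < s + 1 by rewrite ltrDl.
  have [h1 h2] := continuous_FTC1_closed s1 (continuous_itv_integrable 0 (s + 1) cf) s0 (cf s).
  by apply: DeriveDef; [exact: h1|rewrite -derive1E; exact: h2].
have dexp (s : R) : is_derive s 1 (fun s : R => expR (- c * s)) (- c * expR (- c * s)).
  have := @is_derive1_comp R expR (fun s : R => - c * s) s _ (- c) (is_derive_expR _) _.
  rewrite mulrC; apply.
  by apply: is_derive_eq; rewrite /GRing.scale/= mulr1.
have dJ (s : R) : 0 < s ->
    is_derive s 1 J (expR (- c * s) *: D s + I s *: (- c * expR (- c * s)) - a s).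
  move=> s0; have i1 := dexp s; have i2 := dE D s cD s0; have i3 := dE a s ca s0.
  have i4 : is_derive s 1 (fun s : R => expR (- c * s) * I s)
      (expR (- c * s) *: D s + I s *: (- c * expR (- c * s))).
    exact: (@is_deriveM R R (fun s : R => expR (- c * s)) I s 1 _ _ i1 i2).
  exact: (@is_deriveB R R R (fun s : R => expR (- c * s) * I s) A s 1 _ _ i4 i3).
have J0 : J 0 = 0 by rewrite /J /I /A set_itv1 !Rintegral_set1 mulr0 subr0.
have cint (f : R -> R) : continuous f ->
    {within `[0, t], continuous (fun s : R => \int[mu]_(r in `[0, s]) f r)}.
  move=> cf; apply: parameterized_integral_continuous; first exact: ltW.
  exact: continuous_itv_integrable.
have cJ : {within `[0, t], continuous J}.
  move=> s; apply: cvgB; last exact: cint.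
  apply: cvgM; last exact: cint.
  apply: continuous_subspaceT => r.
  by apply: differentiable_continuous; apply/derivable1_diffP; case: (dexp r).
have Jt : J t <= J 0.
  apply: (@ler0_derive1_nincr _ J 0 t _ _ cJ 0 t (lexx 0) _ (lexx t)); [| |exact: ltW].
    by move=> s; rewrite in_itv/= => /andP[s0 _]; case: (dJ _ s0).
  move=> s; rewrite in_itv/= => /andP[s0 _]; rewrite derive1E.
  have [_ ->] := dJ _ s0; rewrite /GRing.scale/=.
  have := H s (ltW s0); rewrite -/(I s) => Hs.
  have e0 : 0 < expR (- c * s) by exact: expR_gt0.
  have e1 : expR (- c * s) <= 1 by rewrite -expR0 ler_expR; have := mulr_ge0 c0 (ltW s0); lra.
  have h1 : expR (- c * s) * (D s - c * I s) <= expR (- c * s) * a s.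
    by rewrite ler_wpM2l ?(ltW e0)// lerBlDr.
  have h2 : expR (- c * s) * a s <= a s by rewrite ler_piMl.
  by move: h1 h2; clear; move: (expR _) (I s) (D s) (a s) => u v x y; lra.
move: Jt; rewrite J0 /J subr_le0 => Jt.
have -> : \int[mu]_(r in `[0, t]) D r = expR (c * t) * (expR (- c * t) * I t).
  by rewrite mulrA -expRD mulNr subrr expR0 mul1r.
by rewrite ler_wpM2l ?expR_ge0.
Qed.

End real_analysis.

(** * Expectations of time integrals *)

Section fatou_Riemann.
Context {R : realType} {disp : measure_display} {T : measurableType disp}
  (P : probability T R).
Notation mu := (@lebesgue_measure R).

Lemma limn_einf_le (u : nat -> \bar R) c : (forall n, (u n <= c)%E) -> (limn_einf u <= c)%E.
Proof.
move=> uc; rewrite limn_einf_lim; apply: lime_le; first exact: is_cvg_einfs.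
apply: nearW => n; apply: le_trans (uc n); apply: ereal_inf_lbound.
by exists n => /=.
Qed.

Lemma limn_einf_ge (u : nat -> \bar R) (c : R) :
  (forall e : R, 0 < e -> \forall n \near \oo, ((c - e)%:E <= u n)%E) -> (c%:E <= limn_einf u)%E.
Proof.
move=> H; apply/lee_addgt0Pr => e e0.
rewrite -leeBlDr// -EFinB limn_einf_lim; apply: lime_ge; first exact: is_cvg_einfs.
have [N _ HN] := H e e0; exists N => // n /= Nn.
apply: le_ereal_inf_tmp => _ [k /= nk <-]; apply: HN => /=; exact: leq_trans Nn nk.
Qed.

(** Takes the place of Tonelli: [Y] is measurable in [w] at each time and almost surely continuous
    in time, so joint measurability is not at hand. Riemann sums are measurable with controlled
    expectation, along almost every path they eventually exceed the time integral up to any [e], and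
    Fatou's lemma passes to the limit. *)
Lemma fatou_Riemann (Y : R -> T -> R) (U V : T -> R) (x y k C : R) :
  x < y -> 0 <= k ->
  (forall s, x <= s <= y -> measurable_fun setT (Y s)) ->
  (forall s w, 0 <= Y s w) ->
  measurable_fun setT U -> (forall w, 0 <= U w) ->
  measurable_fun setT V -> (forall w, 0 <= V w) ->
  {ae P, forall w, continuous (Y ^~ w)} ->
  {ae P, forall w, V w <= U w + k * \int[mu]_(s in `[x, y]) Y s w} ->
  (forall s, x <= s <= y -> (\int[P]_w (Y s w)%:E <= C%:E)%E) ->
  (\int[P]_w (V w)%:E <= \int[P]_w (U w)%:E + (k * (y - x) * C)%:E)%E.
Proof.
move=> xy k0 mY Y0 mU U0 mV V0 cY VU YC.
pose p (n j : nat) : R := x + (y - x) / n.+1%:R * j%:R.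
have pxy n j : (j < n.+1)%N -> x <= p n j <= y.
  move=> jn; rewrite /p lerDl mulr_ge0//=; last by rewrite divr_ge0// subr_ge0 ltW.
  rewrite -lerBrDl -mulrA ler_piMr ?subr_ge0 ?(ltW xy)//.
  by rewrite mulrC ler_pdivrMr// mul1r ler_nat ltnW.
pose c (n : nat) : R := k * ((y - x) / n.+1%:R).
have c0 n : 0 <= c n by rewrite /c mulr_ge0// divr_ge0// subr_ge0 ltW.
pose S n w : R := \sum_(j < n.+1) Y (p n j) w * c n.
have mS n : measurable_fun setT (S n).
  by apply: measurable_sum => j; apply: measurable_funM => //; apply: mY; exact: pxy.
have S0 n w : 0 <= S n w by apply: sumr_ge0 => j _; rewrite mulr_ge0.
pose f n w := (U w + S n w)%:E.
have mf n : measurable_fun setT (f n) by apply/measurable_EFinP; exact: measurable_funD.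
have f0 n w : setT w -> (0 <= f n w)%E by move=> _; rewrite lee_fin addr_ge0.
have IS n : (\int[P]_w (S n w)%:E <= (k * (y - x) * C)%:E)%E.
  have -> : (\int[P]_w (S n w)%:E = \sum_(j < n.+1) (c n)%:E * \int[P]_w (Y (p n j) w)%:E)%E.
    rewrite /S; under eq_integral do rewrite -sumEFin.
    rewrite (@ge0_integral_sum _ _ _ P setT measurableT 'I_n.+1 (fun j w => (Y (p n j) w * c n)%:E)).
    - apply: eq_bigr => j _; rewrite -ge0_integralZl//.
      + by apply: eq_integral => w _; rewrite mulrC EFinM.
      + by apply/measurable_EFinP; apply: mY; exact: pxy.
      + by move=> w _; rewrite lee_fin.
      + by rewrite lee_fin.
    - by move=> j; apply/measurable_EFinP; apply: measurable_funM => //; apply: mY; exact: pxy.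
    - by move=> j w _; rewrite lee_fin mulr_ge0.
  apply: (@le_trans _ _ (\sum_(j < n.+1) (c n * C)%:E)%E).
    apply: lee_sum => j _; rewrite [leRHS]EFinM; apply: lee_wpmul2l; first by rewrite lee_fin.
    by apply: YC; exact: pxy.
  rewrite sumEFin lee_fin sumr_const card_ord -mulr_natl /c le_eqVlt.
  have : n.+1%:R != 0 :> R by rewrite pnatr_eq0.
  by move: (n.+1%:R : R) => N N0; apply/orP; left; apply/eqP; field.
have If n : (\int[P]_w f n w <= \int[P]_w (U w)%:E + (k * (y - x) * C)%:E)%E.
  rewrite /f; under eq_integral do rewrite EFinD.
  rewrite ge0_integralD//.
  - by rewrite leeD2l.
  - by move=> w _; rewrite lee_fin.
  - exact/measurable_EFinP.
  - by move=> w _; rewrite lee_fin.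
  - exact/measurable_EFinP.
apply: (@le_trans _ _ (\int[P]_w limn_einf (f^~ w))%E); last first.
  by apply: le_trans (@fatou _ _ _ P setT measurableT f mf f0) _; exact: limn_einf_le.
apply: ae_ge0_le_integral => //.
- by move=> w _; rewrite lee_fin.
- exact/measurable_EFinP.
- move=> w _; rewrite limn_einf_lim; apply: lime_ge; first exact: is_cvg_einfs.
  apply: nearW => n; apply: le_ereal_inf_tmp => _ [j _ <-]; exact: f0.
- apply: (emeasurable_fun_cvg (fun n w => einfs (f^~ w) n)) => //.
  + exact: measurable_fun_einfs.
  + by move=> w _; rewrite limn_einf_lim; exact: is_cvg_einfs.
- have F := (@ae_filter_ringOfSetsType _ _ _ P).
  apply: filterS2 cY VU => w cYw VUw _.
  apply: limn_einf_ge => e e0.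
  have k1 : 0 < k + 1 by rewrite ltr_wpDl.
  have := Riemann_sum_ge cYw xy (divr_gt0 e0 k1).
  apply: filterS => n Hn; rewrite lee_fin /S.
  rewrite lerBlDr; apply: le_trans VUw _; rewrite -addrA lerD2l.
  apply: le_trans (ler_wpM2l k0 Hn) _; rewrite mulrDr; apply: lerD.
    rewrite mulr_sumr le_eqVlt; apply/orP; left; apply/eqP; apply: eq_bigr => j _.
    by rewrite /c /p; ring.
  rewrite mulrA ler_pdivrMr// mulrC ler_wpM2l ?(ltW e0)//; lra.
Qed.

End fatou_Riemann.
(** The drift as a vector field, with the law frozen at [mu]; [mckean_vlasov_drift] is its value
    along a path at the current law. *)
Definition mean_field_drift {R : realType} {d : nat} (eta : 'rV[R]_d -> 'rV[R]_d)
    (theta : 'rV[R]_d -> 'rV[R]_d -> 'rV[R]_d) (tau : R)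
    (mu : probability 'rV[R]_d R) (z : 'rV[R]_d) : 'rV[R]_d :=
  \row_i (eta z 0 i + tau * \int[mu]_y theta z y 0 i).

Section mean_field.
Context {R : realType} {d : nat} (eta : 'rV[R]_d -> 'rV[R]_d)
  (theta : 'rV[R]_d -> 'rV[R]_d -> 'rV[R]_d) (tau Le Lt : R).
Hypotheses (Le0 : 0 <= Le) (Lt0 : 0 <= Lt)
  (etaL : forall x y, enorm (eta x - eta y) <= Le * enorm (x - y))
  (theta1L : forall x x' y, enorm (theta x y - theta x' y) <= Lt * enorm (x - x'))
  (theta2L : forall x y y', enorm (theta x y - theta x y') <= Lt * enorm (y - y')).

Lemma theta_coord_elip x i : elip Lt (fun y => theta x y 0 i).
Proof.
move=> y y'; apply: le_trans (theta2L x y y').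
by have := coord_le_enorm (theta x y - theta x y') i; rewrite !mxE.
Qed.

Section law.
Context (mu : probability 'rV[R]_d R).
Hypothesis mui : forall z i, mu.-integrable setT (fun y => (theta z y 0 i)%:E).

Lemma mean_field_lip z z' i :
  `|\int[mu]_y theta z y 0 i - \int[mu]_y theta z' y 0 i| <= Lt * enorm (z - z').
Proof.
rewrite -(RintegralB measurableT (mui z i) (mui z' i)).
have ii : mu.-integrable setT (EFin \o (fun y => theta z y 0 i - theta z' y 0 i)).
  exact: (integrableB measurableT (mui z i) (mui z' i)).
apply: le_trans (le_normr_Rintegral measurableT ii) _.
apply: (prob_le_Rintegral_cst (P := mu)); first exact: (integrable_abse ii).
move=> y; apply: le_trans (theta1L z z' y).
by have := coord_le_enorm (theta z y - theta z' y) i; rewrite !mxE.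
Qed.

Lemma mean_field_drift_coord_lip z z' i :
  `|mean_field_drift eta theta tau mu z 0 i - mean_field_drift eta theta tau mu z' 0 i| <=
  (Le + `|tau| * Lt) * enorm (z - z').
Proof.
rewrite !mxE opprD addrACA -mulrBr mulrDl; apply: le_trans (ler_normD _ _) _.
apply: lerD.
  apply: le_trans (etaL z z').
  by have := coord_le_enorm (eta z - eta z') i; rewrite !mxE.
by rewrite normrM -mulrA ler_wpM2l// mean_field_lip.
Qed.

Lemma mean_field_drift_lip z z' :
  enorm (mean_field_drift eta theta tau mu z - mean_field_drift eta theta tau mu z') <=
  d%:R * ((Le + `|tau| * Lt) * enorm (z - z')).
Proof.
apply: enorm_le_bound => i.
by have := mean_field_drift_coord_lip z z' i; rewrite !mxE.
Qed.

(** By Cauchy-Schwarz the mean-field term raises [kappa] by at most its Lipschitz constant. The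
    factor [d] comes from bounding that term coordinate by coordinate. *)
Lemma mean_field_drift_monotone (kappa : R -> R) z z' :
  dotp (z - z') (eta z - eta z') <= kappa (enorm (z - z')) * enorm (z - z') ^+ 2 ->
  dotp (z - z') (mean_field_drift eta theta tau mu z - mean_field_drift eta theta tau mu z') <=
  (kappa (enorm (z - z')) + `|tau| * (d%:R * Lt)) * enorm (z - z') ^+ 2.
Proof.
move=> H; pose m : 'rV[R]_d := \row_i (tau * (\int[mu]_y theta z y 0 i - \int[mu]_y theta z' y 0 i)).
have -> : mean_field_drift eta theta tau mu z - mean_field_drift eta theta tau mu z' =
    (eta z - eta z') + m.
  by apply/rowP => i; rewrite !mxE; ring.
rewrite dotpDr mulrDl; apply: lerD => //.
apply: le_trans (dotp_le_enorm _ _) _; rewrite expr2 mulrA mulrC ler_wpM2r ?enorm_ge0//.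
have -> : `|tau| * (d%:R * Lt) * enorm (z - z') = d%:R * (`|tau| * (Lt * enorm (z - z'))) by ring.
apply: enorm_le_bound => i; rewrite mxE normrM ler_wpM2l// mean_field_lip//.
Qed.

End law.

Lemma mean_field_drift_law (mu nu : probability 'rV[R]_d R) (c : R) z :
  (forall i, `|\int[mu]_y theta z y 0 i - \int[nu]_y theta z y 0 i| <= c) ->
  enorm (mean_field_drift eta theta tau mu z - mean_field_drift eta theta tau nu z) <=
  d%:R * (`|tau| * c).
Proof.
move=> H; apply: enorm_le_bound => i; rewrite !mxE opprD addrACA subrr add0r -mulrBr.
by rewrite normrM ler_wpM2l.
Qed.

End mean_field.

(** * One-step approximation of the marginal laws *)
Section process.
Context {R : realType} {d : nat} (eta : 'rV[R]_d -> 'rV[R]_d)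
  (theta : 'rV[R]_d -> 'rV[R]_d -> 'rV[R]_d) (tau Le Lt : R) (x : 'rV[R]_d)
  {disp : measure_display} {Omega : measurableType disp} (P : probability Omega R)
  (F : R -> set (set Omega)) (B X : R -> {RV P >-> 'rV[R]_d}).
Hypotheses (Le0 : 0 <= Le) (Lt0 : 0 <= Lt)
  (etaL : forall x y, enorm (eta x - eta y) <= Le * enorm (x - y))
  (theta1L : forall x x' y, enorm (theta x y - theta x' y) <= Lt * enorm (x - x'))
  (theta2L : forall x y y', enorm (theta x y - theta x y') <= Lt * enorm (y - y'))
  (BM : brownian_motion F B) (sol : mckean_vlasov_solution eta theta tau x F B X).
Notation mu := (@lebesgue_measure R).
Notation N s := (normal_prob (0 : R) s).
Notation drift s w := (mckean_vlasov_drift eta theta tau X s w).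
Let L1 := Le + `|tau| * Lt.

Let L10 : 0 <= L1. Proof. by rewrite /L1 addr_ge0// mulr_ge0. Qed.

Let law_int s : 0 <= s -> forall z i,
  (distribution P (X s)).-integrable setT (fun y => (theta z y 0 i)%:E).
Proof. by move=> s0; case: sol => _ _ H _; exact: H. Qed.

(* Paths are extended to negative times by their value at time 0. *)
Let Xc (w : Omega) (i : 'I_d) (t : R) := X (Num.max 0 t) w 0 i.
Let Bc (w : Omega) (i : 'I_d) (t : R) := B (Num.max 0 t) w 0 i.

Let good (w : Omega) := [/\ forall i, continuous (Xc w i),
  forall i, continuous (Bc w i), B 0 w = 0 &
  forall t : R, 0 <= t -> forall i : 'I_d,
        mu.-integrable `[0, t] (fun s => (drift s w 0 i)%:E) /\
        X t w 0 i = x 0 i + \int[mu]_(s in `[0, t]) drift s w 0 i + B t w 0 i].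

Let ae_good : {ae P, forall w, good w}.
Proof.
case: BM => _ B0 cB _ _; case: sol => _ cX _ eqX.
have FF := @ae_filter_ringOfSetsType _ _ _ P.
have coord (f : R -> 'rV[R]_d) i : {within [set t : R | 0 <= t], continuous f} ->
    continuous (fun t : R => f (Num.max 0 t) 0 i).
  move=> cf; apply: (@continuous_clamp R (fun t => f t 0 i)).
  apply/subspace_continuousP => t t0; move/subspace_continuousP: cf => /(_ t t0) cf.
  by apply: (cvg_comp f (fun M : 'rV[R]_d => M 0 i) cf); exact: coord_continuous.
have H := filterI (filterI B0 cB) (filterI cX eqX).
move: (H FF FF FF) => {}H.
apply: filterS H => w [[h1 h2] [h3 h4]]; split => //.
- by move=> i; exact: (coord _ i h3).
- by move=> i; exact: (coord _ i h2).
Qed.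

Let good_path : exists w0, good w0.
Proof.
have PT : (0 < P setT)%E by rewrite probability_setT.
have PF := ae_properfilter_algebraOfSetsType PT.
by have /filter_ex := ae_good.
Qed.

(** Random paths are compared with each other, later with one fixed good path [w0]. At equal times
    both drifts contain the same law, so their difference is controlled by the Lipschitz constant
    [L1], although nothing is known yet about the size and the time regularity of the mean-field
    term. *)
Let dist (w w' : Omega) (t : R) := \sum_i `|Xc w i t - Xc w' i t|.

Let dist_ge0 w w' t : 0 <= dist w w' t. Proof. exact: sumr_ge0. Qed.

Let continuous_sum_norm (f : 'I_d -> R -> R) : (forall i, continuous (f i)) ->
  continuous (fun t : R => \sum_i `|f i t|).
Proof.
move=> cf; elim: (index_enum _) => [|i s IH] t.
  have -> : (fun t => \sum_(i <- [::]) `|f i t|) = (fun=> 0) by apply/funext => r; rewrite big_nil.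
  exact: cvg_cst.
have -> : (fun t => \sum_(j <- i :: s) `|f j t|) = (fun t => `|f i t| + \sum_(j <- s) `|f j t|).
  by apply/funext => r; rewrite big_cons.
by apply: cvgD; [apply: cvg_norm; exact: cf|exact: IH].
Qed.

Let dist_continuous w w' : good w -> good w' -> continuous (dist w w').
Proof.
move=> [c1 _ _ _] [c2 _ _ _].
by apply: continuous_sum_norm => i t; apply: cvgB; [exact: c1|exact: c2].
Qed.

Let drift_diff s w w' i : 0 <= s ->
  `|drift s w 0 i - drift s w' 0 i| <= L1 * dist w w' s.
Proof.
move=> s0; have := @mean_field_drift_coord_lip R d eta theta tau Le Lt etaL theta1L
  (distribution P (X s)) (law_int s0) (X s w) (X s w') i.
rewrite !mxE => H; apply: le_trans H _; rewrite ler_wpM2l//.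
apply: le_trans (enorm_le_sum _) _; apply: ler_sum => j _.
by rewrite /Xc !mxE max_r.
Qed.

Let incr w s t i : good w -> 0 <= s -> s <= t ->
  mu.-integrable `[s, t] (fun r => (drift r w 0 i)%:E) /\
  X t w 0 i - X s w 0 i = \int[mu]_(r in `[s, t]) drift r w 0 i + (B t w 0 i - B s w 0 i).
Proof.
move=> [_ _ _ H] s0 st; have t0 := le_trans s0 st.
have [i1 e1] := H t t0 i; have [i2 e2] := H s s0 i.
split.
  apply: integrableS i1 => //; apply: subset_itvr; by rewrite bnd_simp.
rewrite e1 e2 (Rintegral_split i1 s0 st).
by move: (Rintegral _ _ _) (Rintegral _ _ _) => u v; ring.
Qed.

Let incr_diff w w' s t i : good w -> good w' -> 0 <= s -> s <= t ->
  `|(X t w 0 i - X s w 0 i) - (X t w' 0 i - X s w' 0 i) -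
    ((B t w 0 i - B s w 0 i) - (B t w' 0 i - B s w' 0 i))| <=
  L1 * \int[mu]_(r in `[s, t]) dist w w' r.
Proof.
move=> gw gw' s0 st; have [i1 ->] := incr i gw s0 st; have [i2 ->] := incr i gw' s0 st.
have -> : forall a b c e : R, a + b - (c + e) - (b - e) = a - c by move=> *; ring.
rewrite -(RintegralB _ i1 i2)//.
have ii := integrableB _ i1 i2.
apply: le_trans (le_normr_Rintegral _ (ii _)) _ => //.
have di := continuous_itv_integrable s t (dist_continuous gw gw').
rewrite -RintegralZl//.
apply: Rintegral_itv_le.
- exact: (integrable_abse (ii _)).
- exact: (integrableZl _ L1 di).
- by move=> r /andP[sr _]; apply: drift_diff; exact: le_trans sr.
Qed.

Let mX s i : measurable_fun setT (fun w => X s w 0 i).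
Proof. exact: (measurableT_comp (measurable_coord i) (measurable_funPT (X s))). Qed.

Let mB s i : measurable_fun setT (fun w => B s w 0 i).
Proof. exact: (measurableT_comp (measurable_coord i) (measurable_funPT (B s))). Qed.

Let abs_moment := \int[N 1]_x `|x|.
Let abs_moment_ge0 : 0 <= abs_moment. Proof. exact: Rintegral_ge0. Qed.


Let normal_abs_moment s : 0 < s -> (\int[N s]_x `|x|%:E = (s * abs_moment)%:E)%E.
Proof.
move=> s0; rewrite (ge0_integral_normal_scale (f := fun x => `|x|%:E) s0); last 2 first.
- by apply/measurable_EFinP; exact: normr_measurable.
- by move=> y; rewrite lee_fin.
have ai : (N 1).-integrable setT (EFin \o (fun x : R => `|x|)).
  exact: (integrable_abse (integrable_normal_id ltr01)).
rewrite /abs_moment -[X in (X * _)%R](gtr0_norm s0) -RintegralZl//.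
rewrite /Rintegral fineK.
  by apply: eq_integral => y _; rewrite normrM.
by apply: integrable_fin_num => //; exact: (integrableZl measurableT `|s| ai).
Qed.

Let brownian_abs_moment i s t : 0 <= s -> s <= t ->
  (\int[P]_w (`|B t w 0 i - B s w 0 i|)%:E <= (Num.sqrt (t - s) * abs_moment)%:E)%E.
Proof.
move=> s0; rewrite le_eqVlt => /predU1P[<-|st].
  rewrite subrr sqrtr0 mul0r integral0_eq// => w _; by rewrite subrr normr0.
have ts0 : 0 < Num.sqrt (t - s) by rewrite sqrtr_gt0 subr_gt0.
have mD : measurable_fun setT (fun w => B t w 0 i - B s w 0 i) by exact: measurable_funB.
rewrite -normal_abs_moment//.
pose phi : Omega -> measurableTypeR R := (fun w => B t w 0 i - B s w 0 i).
pose m' : {measure set (measurableTypeR R) -> \bar R} := pushforward P phi.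
rewrite (@eq_measure_integral _ _ _ _ (m' mD)); last first.
  move=> A mA _; rewrite /m' /= /pushforward.
  case: BM => _ _ _ /(_ s t s0 st (fun j => if j == i then A else setT)) H _.
  have /H : forall j : 'I_d, measurable (if j == i then A else setT) by move=> j; case: ifP.
  rewrite (bigD1 i)//= eqxx big1 ?mule1; last first.
    by move=> j /negbTE ->; rewrite probability_setT.
  move=> <-; congr (P _); apply/seteqP; split => w /=.
    by move=> /(_ i); rewrite eqxx !mxE.
  by move=> Aw j; case: ifPn => // /eqP ->; rewrite !mxE.
rewrite ge0_integral_pushforward//.
by apply/measurable_EFinP; exact: normr_measurable.
Qed.

Let mdist w' t : measurable_fun setT (fun w => dist w w' t).
Proof.
apply: measurable_sum => i; apply: measurableT_comp => //.
by apply: measurable_funB => //; exact: mX.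
Qed.

Let integral_sum_le (f : 'I_d -> Omega -> R) (c : 'I_d -> R) :
  (forall i, measurable_fun setT (f i)) -> (forall i w, 0 <= f i w) ->
  (forall i, \int[P]_w (f i w)%:E <= (c i)%:E)%E ->
  (\int[P]_w (\sum_i f i w)%:E <= (\sum_i c i)%:E)%E.
Proof.
move=> mf f0 H; under eq_integral do rewrite -sumEFin.
rewrite (@ge0_integral_sum _ _ _ P setT measurableT 'I_d (fun i w => (f i w)%:E)).
- by rewrite -sumEFin; apply: lee_sum => i _; exact: H.
- by move=> i; exact/measurable_EFinP.
- by move=> i w _; rewrite lee_fin.
Qed.

Let bounded_cont (f : R -> R) T : continuous f -> exists M, forall t, 0 <= t <= T -> `|f t| <= M.
Proof.
move=> cf; have [T0|T0] := leP 0 T; last first.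
  by exists 0 => t /andP[t0 tT]; move: (le_lt_trans (le_trans t0 tT) T0); rewrite ltxx.
have cn : {within `[0, T], continuous (fun t => `|f t|)}.
  by apply: continuous_subspaceT => t; apply: cvg_norm; exact: cf.
have [c _ H] := EVT_max T0 cn.
by exists `|f c| => t tT; apply: H; rewrite in_itv.
Qed.

(** Pathwise Gronwall bounds the distance from [w0] by Brownian terms, whose expectations are
    bounded on [[0, T]]. Expectations are taken only afterwards, so no moment of [X] has to be known
    in advance. *)
Let dist_moment w0 (T : R) : 0 < T -> good w0 -> exists C, 0 <= C /\ forall t, 0 <= t <= T ->
  (\int[P]_w (dist w w0 t)%:E <= C%:E)%E.
Proof.
move=> T0 g0.
pose a w t : R := \sum_i `|Bc w i t - Bc w0 i t|.
have ca w : good w -> continuous (a w).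
  move=> [_ c1 _ _]; case: g0 => _ c2 _ _.
  by apply: continuous_sum_norm => i t; apply: cvgB; [exact: c1|exact: c2].
have a0 w t : 0 <= a w t by exact: sumr_ge0.
have ma t : measurable_fun setT (fun w => a w t).
  apply: measurable_sum => i; apply: measurableT_comp => //.
  by apply: measurable_funB => //; exact: mB.
pose c := d%:R * L1.
have c0 : 0 <= c by rewrite mulr_ge0.
have gron w t : good w -> 0 <= t -> dist w w0 t <= a w t + c * \int[mu]_(r in `[0, t]) dist w w0 r.
  move=> gw t0.
  apply: (@le_trans _ _ (\sum_i (`|Bc w i t - Bc w0 i t| + L1 * \int[mu]_(r in `[0, t]) dist w w0 r))).
    apply: ler_sum => i _; rewrite /Xc /Bc !max_r//.
    have H := incr_diff i gw g0 (lexx 0) t0.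
    have X0 w' : good w' -> X 0 w' 0 i = x 0 i.
      move=> [_ _ B0 /(_ 0 (lexx 0) i)[_ ->]].
      by rewrite set_itv1 Rintegral_set1 B0 mxE !addr0.
    have B0 w' : good w' -> B 0 w' 0 i = 0 by move=> [_ _ -> _]; rewrite mxE.
    rewrite (X0 _ gw) (X0 _ g0) (B0 _ gw) (B0 _ g0) !subr0 in H.
    move: H; move: (L1 * _) => K H.
    have -> : X t w 0 i - X t w0 0 i = (B t w 0 i - B t w0 0 i) +
      (X t w 0 i - x 0 i - (X t w0 0 i - x 0 i) - (B t w 0 i - B t w0 0 i)) by ring.
    by apply: le_trans (ler_normD _ _) _; rewrite lerD2l.
  by rewrite big_split/= sumr_const card_ord -mulr_natl mulrA.
have gron2 w t : good w -> 0 <= t <= T ->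
    dist w w0 t <= a w t + c * expR (c * T) * \int[mu]_(r in `[0, T]) a w r.
  move=> gw /andP[t0 tT]; apply: le_trans (gron w t gw t0) _.
  rewrite lerD2l -mulrA ler_wpM2l//.
  apply: le_trans (gronwall (dist_continuous gw g0) (ca w gw) (a0 w) c0 (fun s s0 => gron w s gw s0) t0) _.
  apply: ler_pM; rewrite ?expR_ge0 ?Rintegral_ge0//.
    by rewrite ler_expR ler_wpM2l.
  rewrite (Rintegral_split (continuous_itv_integrable 0 T (ca w gw)) t0 tT) lerDl.
  exact: Rintegral_ge0.
have /choice[M HM] i := bounded_cont T (let: And4 _ c2 _ _ := g0 in c2 i).
pose Ca := \sum_i (Num.sqrt T * abs_moment + `|M i|).
have Ca0 : 0 <= Ca by apply: sumr_ge0 => i _; rewrite addr_ge0// mulr_ge0// sqrtr_ge0.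
have Ea t : 0 <= t <= T -> (\int[P]_w (a w t)%:E <= Ca%:E)%E.
  move=> /andP[t0 tT]; apply: integral_sum_le => // i.
    by apply: measurableT_comp => //; apply: measurable_funB => //; exact: mB.
  rewrite EFinD.
  have mBt : measurable_fun setT (fun w => `|B t w 0 i - B 0 w 0 i|).
    by apply: measurableT_comp => //; apply: measurable_funB.
  apply: (@le_trans _ _ (\int[P]_w ((`|B t w 0 i - B 0 w 0 i|)%:E + `|M i|%:E))%E).
    apply: ae_ge0_le_integral => //.
    - apply/measurable_EFinP; apply: measurableT_comp => //; apply: measurable_funB => //; exact: mB.
    - by move=> w _; rewrite -EFinD lee_fin addr_ge0.
    - by apply/measurable_EFinP; apply: measurable_funD.
    - have FF := @ae_filter_ringOfSetsType _ _ _ P.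
      apply: filterS ae_good => w [_ _ B0 _] _; rewrite -EFinD lee_fin B0 mxE subr0.
      apply: le_trans (ler_normB _ _) _; rewrite /Bc max_r// lerD2l.
      apply: le_trans (ler_norm _); have := HM i t; rewrite t0 tT => /(_ isT).
      by rewrite /Bc max_r.
  rewrite ge0_integralD//; last exact/measurable_EFinP.
  apply: leeD.
    apply: le_trans (brownian_abs_moment i (lexx 0) t0) _.
    by rewrite lee_fin subr0 ler_wpM2r// ler_wsqrtr.
  by rewrite integral_cst//= probability_setT mule1.
pose C := Ca + c * expR (c * T) * (T - 0) * Ca.
exists C; split.
  by rewrite addr_ge0// !mulr_ge0 ?expR_ge0// subr0 ltW.
move=> t tT; rewrite EFinD.
apply: le_trans (@fatou_Riemann _ _ _ P (fun s w => a w s) (fun w => a w t)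
   (fun w => dist w w0 t) 0 T (c * expR (c * T)) Ca T0 _ _ _ _ _ _ _ _ _ _) _ => //.
- by rewrite mulr_ge0// expR_ge0.
- have FF := @ae_filter_ringOfSetsType _ _ _ P.
  by apply: filterS ae_good => w; exact: ca.
- have FF := @ae_filter_ringOfSetsType _ _ _ P.
  by apply: filterS ae_good => w gw; exact: gron2.
- by rewrite leeD2r// Ea.
Qed.

Let uniform_sum (f : 'I_d -> R -> R) T e : (forall i, continuous (f i)) -> 0 < e ->
  exists h : R, 0 < h /\ forall s t, 0 <= s <= T -> `|s - t| < h -> \sum_i `|f i s - f i t| <= e.
Proof.
move=> cf; elim: (index_enum _) e => [|i l IH] e e0.
  by exists 1; split => // s t _ _; rewrite big_nil ltW.
have e20 : 0 < e / 2 by rewrite divr_gt0.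
have [h1 [h10 H1]] := IH _ e20; have [h2 [h20 H2]] := continuous_uniform 0 T (cf i) e20.
exists (Num.min h1 h2); split; first by rewrite lt_min h10.
move=> s t sT; rewrite lt_min => /andP[st1 st2]; rewrite big_cons (splitr e).
by apply: lerD; [exact: H2|exact: H1].
Qed.

Let increment s t w := \sum_i `|X t w 0 i - X s w 0 i|.

Let measurable_increment s t : measurable_fun setT (increment s t).
Proof.
by apply: measurable_sum => i; apply: measurableT_comp => //; apply: measurable_funB.
Qed.

(** The increment of a random path exceeds that of [w0] by Brownian increments and a drift
    difference. The increments along [w0] are small by uniform continuity, the random Brownian ones
    by their variance, the drift difference by [dist_moment]. *)
Let modulus T e : 0 < T -> 0 < e -> exists h : R, 0 < h /\
  forall s t, 0 <= s -> s <= t -> t <= T -> t - s < h ->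
  (\int[P]_w (increment s t w)%:E <= e%:E)%E.
Proof.
move=> T0 e0; have [w0 g0] := good_path.
have [C [C0 HC]] := dist_moment T0 g0.
have [_ cX cB _] := g0.
pose c := d%:R * L1.
have c0 : 0 <= c by rewrite mulr_ge0.
have e40 : 0 < e / 4 by rewrite divr_gt0.
have g0' := g0; case: g0' => cX0 cB0 _ _.
have [h1 [h10 H1]] := uniform_sum T cX0 e40.
have [h2 [h20 H2]] := uniform_sum T cB0 e40.
have p1 : 0 < d%:R * abs_moment + 1 by rewrite ltr_wpDl// mulr_ge0.
have p2 : 0 < c * C + 1 by rewrite ltr_wpDl// mulr_ge0.
pose h3 := (e / 4 / (d%:R * abs_moment + 1)) ^+ 2.
have h30 : 0 < h3 by rewrite exprn_gt0// divr_gt0.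
pose h4 := e / 4 / (c * C + 1).
have h40 : 0 < h4 by rewrite divr_gt0.
(* One quarter of [e] each for the increments of [X] and of [B] along [w0], the mean random Brownian
   increment, and the drift difference. *)
exists (Num.min (Num.min h1 h2) (Num.min h3 h4)); split; first by rewrite !lt_min h10 h20 h30 h40.
move=> s t s0 st tT; rewrite !lt_min => /andP[/andP[t1 t2] /andP[t3 t4]].
have t0 := le_trans s0 st; have sT := le_trans st tT.
move: (st); rewrite le_eqVlt => /predU1P[ste|st'].
  rewrite ste integral0_eq ?lee_fin ?ltW// => w _.
  by rewrite /increment big1// => i _; rewrite subrr normr0.
pose osc := \sum_i (`|X t w0 0 i - X s w0 0 i| + `|B t w0 0 i - B s w0 0 i|).
have osc_le : osc <= e / 4 + e / 4.
  rewrite /osc big_split/=; apply: lerD.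
    have := H1 s t; rewrite s0 sT distrC ger0_norm ?subr_ge0// => /(_ isT t1); apply: le_trans.
    by apply: ler_sum => i _; rewrite distrC /Xc !max_r.
  have := H2 s t; rewrite s0 sT distrC ger0_norm ?subr_ge0// => /(_ isT t2); apply: le_trans.
  by apply: ler_sum => i _; rewrite distrC /Bc !max_r.
have osc0 : 0 <= osc by apply: sumr_ge0 => i _; rewrite addr_ge0.
pose U w := osc + \sum_i `|B t w 0 i - B s w 0 i|.
have mS : measurable_fun setT (fun w => \sum_i `|B t w 0 i - B s w 0 i|).
  by apply: measurable_sum => i; apply: measurableT_comp => //; apply: measurable_funB.
have mU : measurable_fun setT U by apply: measurable_funD.
have S0 w : 0 <= \sum_i `|B t w 0 i - B s w 0 i| by exact: sumr_ge0.
have U0 w : 0 <= U w by rewrite addr_ge0.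
have V0 w : 0 <= increment s t w by exact: sumr_ge0.
have VU w : good w -> increment s t w <= U w + c * \int[mu]_(r in `[s, t]) dist w w0 r.
  move=> gw; rewrite /increment /U /osc -big_split/=.
  have -> : c * \int[mu]_(r in `[s, t]) dist w w0 r =
      \sum_(i < d) L1 * \int[mu]_(r in `[s, t]) dist w w0 r.
    by rewrite sumr_const card_ord -mulr_natl mulrA.
  rewrite -big_split/=; apply: ler_sum => i _.
  have := incr_diff i gw g0 s0 st.
  move: (X t w 0 i - X s w 0 i) (X t w0 0 i - X s w0 0 i) (B t w 0 i - B s w 0 i)
    (B t w0 0 i - B s w0 0 i) (L1 * _) => a1 a2 b1 b2 K HK.
  have -> : a1 = (a2 - b2) + b1 + (a1 - a2 - (b1 - b2)) by ring.
  apply: le_trans (ler_normD _ _) _; apply: lerD HK.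
  by apply: le_trans (ler_normD _ _) _; apply: lerD => //; exact: ler_normB.
have FF := @ae_filter_ringOfSetsType _ _ _ P.
have key := @fatou_Riemann _ _ _ P (fun r w => dist w w0 r) U (increment s t) s t c C st' c0.
apply: le_trans (key _ _ _ _ _ _ _ _ _) _ => //.
- by apply: filterS ae_good => w gw; exact: dist_continuous.
- by apply: filterS ae_good => w gw; exact: VU.
- by move=> r /andP[sr rt]; apply: HC; rewrite (le_trans s0 sr) (le_trans rt tT).
rewrite /U; under eq_integral do rewrite EFinD.
rewrite ge0_integralD//; [|by move=> w _; rewrite lee_fin|exact/measurable_EFinP].
rewrite integral_cst//= probability_setT mule1.
have ES : (\int[P]_w (\sum_i `|B t w 0 i - B s w 0 i|)%:E <= (e / 4)%:E)%E.
  apply: (@le_trans _ _ (\sum_(i < d) Num.sqrt (t - s) * abs_moment)%:E).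
    apply: integral_sum_le => // i; last exact: brownian_abs_moment.
    by apply: measurableT_comp => //; apply: measurable_funB.
  rewrite lee_fin sumr_const card_ord -(mulr_natl (Num.sqrt (t - s) * _)) mulrCA.
  have sq : Num.sqrt (t - s) <= e / 4 / (d%:R * abs_moment + 1).
    rewrite -[leRHS](ger0_norm (x := _)); last by rewrite ltW// divr_gt0.
    by rewrite -sqrtr_sqr ler_wsqrtr// ltW.
  apply: (@le_trans _ _ (e / 4 / (d%:R * abs_moment + 1) * (d%:R * abs_moment + 1))).
    by apply: ler_pM; rewrite ?sqrtr_ge0 ?mulr_ge0// lerDl.
  by rewrite divfK// gt_eqF.
have E4 : c * (t - s) * C <= e / 4.
  rewrite mulrAC mulrC; apply: (@le_trans _ _ (h4 * (c * C + 1))).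
    by apply: ler_pM; rewrite ?subr_ge0 ?mulr_ge0 ?lerDl// ltW.
  by rewrite /h4 divfK// gt_eqF.
apply: (@le_trans _ _ ((e / 4 + e / 4)%:E + (e / 4)%:E + (e / 4)%:E)%E).
  by apply: leeD; [apply: leeD|]; rewrite ?lee_fin.
by rewrite -!EFinD lee_fin -!mulrDl ler_pdivrMr// mulr_natr 4!mulrS mulr0n addr0 !addrA.
Qed.

Let law_integral (g : 'rV[R]_d -> R) s :
  (distribution P (X s)).-integrable setT (EFin \o g) ->
  P.-integrable setT (EFin \o (fun w => g (X s w))) /\
  \int[distribution P (X s)]_y g y = \int[P]_w g (X s w).
Proof.
move=> /integrableP[mg ig]; have mX' := measurable_funPT (X s).
have ii : P.-integrable setT (EFin \o (fun w => g (X s w))).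
  apply/integrableP; split; first exact: (measurableT_comp mg mX').
  move: ig; rewrite ge0_integral_distribution//; exact: measurableT_comp.
split=> //; rewrite /Rintegral; congr fine.
exact: (integral_distribution mg ii).
Qed.

Let law_diff (g : 'rV[R]_d -> R) s t e : elip Lt g ->
  (distribution P (X s)).-integrable setT (EFin \o g) ->
  (distribution P (X t)).-integrable setT (EFin \o g) ->
  (\int[P]_w (increment s t w)%:E <= e%:E)%E ->
  `|\int[distribution P (X t)]_y g y - \int[distribution P (X s)]_y g y| <= Lt * e.
Proof.
move=> Lg gs gt He.
have [i1 ->] := law_integral gs; have [i2 ->] := law_integral gt.
rewrite -(RintegralB measurableT i2 i1).
have ii := integrableB measurableT i2 i1.
apply: le_trans (le_normr_Rintegral measurableT ii) _.
rewrite -lee_fin; apply: (@le_trans _ _ (\int[P]_w (Lt * increment s t w)%:E)%E).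
  rewrite /Rintegral fineK; last by apply: integrable_fin_num => //; exact: (integrable_abse ii).
  apply: ge0_le_integral => //.
  - by case/integrableP : (integrable_abse ii).
  - by apply/measurable_EFinP; exact: measurable_funM.
  - move=> w _; rewrite lee_fin; apply: le_trans (Lg _ _) _; rewrite ler_wpM2l//.
    apply: le_trans (enorm_le_sum _) _; apply: ler_sum => i _.
    by rewrite !mxE.
under eq_integral do rewrite EFinM.
rewrite ge0_integralZl//.
- by rewrite EFinM lee_wpmul2l// lee_fin.
- exact/measurable_EFinP.
- by move=> w _; rewrite lee_fin; exact: sumr_ge0.
Qed.

(** On [[s, s + h]] the drift departs from its value at time [s] through the state, by [L1] times
    the increment, and through the law, by [law_diff]; [modulus] makes both small in mean. *)
Let local_error T e : 0 < T -> 0 < e -> exists h0 : R, 0 < h0 /\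
  forall s h, 0 <= s -> 0 < h -> h < h0 -> s + h <= T -> forall i,
  (\int[P]_w (`|X (s + h) w 0 i - X s w 0 i - h * drift s w 0 i -
      (B (s + h) w 0 i - B s w 0 i)|)%:E <= (h * e)%:E)%E.
Proof.
move=> T0 e0.
pose k := L1 + `|tau| * Lt.
have k0 : 0 <= k by rewrite addr_ge0// mulr_ge0.
pose e1 := e / (k + 1).
have e10 : 0 < e1 by rewrite divr_gt0// ltr_wpDl.
have [h0 [h00 H]] := modulus T0 e10.
exists h0; split => // s h s0 hp hh0 shT i.
have sh : s < s + h by rewrite ltrDl.
have Hr r : s <= r <= s + h -> (\int[P]_w (increment s r w)%:E <= e1%:E)%E.
  move=> /andP[sr rsh]; apply: H => //; first exact: le_trans shT.
  by apply: le_lt_trans hh0; rewrite lerBlDl.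
have dd r w : s <= r <= s + h -> `|drift r w 0 i - drift s w 0 i| <=
    L1 * increment s r w + `|tau| * Lt * e1.
  move=> srh; case/andP : (srh) => sr _.
  have r0 := le_trans s0 sr.
  have := @mean_field_drift_coord_lip R d eta theta tau Le Lt etaL theta1L
    (distribution P (X r)) (law_int r0) (X r w) (X s w) i.
  rewrite !mxE -/L1 => A1.
  have A2 : `|tau * \int[distribution P (X r)]_y theta (X s w) y 0 i -
      tau * \int[distribution P (X s)]_y theta (X s w) y 0 i| <= `|tau| * Lt * e1.
    rewrite -mulrBr normrM -mulrA ler_wpM2l//.
    apply: law_diff (Hr _ srh); [exact: theta_coord_elip|exact: law_int|exact: law_int].
  have A3 : enorm (X r w - X s w) <= increment s r w.
    by apply: le_trans (enorm_le_sum _) _; apply: ler_sum => j _; rewrite !mxE.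
  have A4 := ler_wpM2l L10 A3.
  move: A1 A2 A4.
  move: (L1 * enorm _) (L1 * increment _ _ _) (`|tau| * _ * _) => u v z.
  move: (tau * _) (tau * _) (tau * _) (eta _ _ _) (eta _ _ _) => a1 a2 a3 b1 b2 A1 A2 A4.
  have -> : b2 + a3 - (b1 + a1) = (b2 + a3 - (b1 + a2)) + (a2 - a1) by ring.
  by apply: le_trans (ler_normD _ _) _; apply: lerD => //; exact: le_trans A4.
pose U (w : Omega) := h * (`|tau| * Lt * e1).
pose V w := `|X (s + h) w 0 i - X s w 0 i - h * drift s w 0 i - (B (s + h) w 0 i - B s w 0 i)|.
pose Y r w := increment s (Num.max 0 r) w.
have U0 w : 0 <= U w.
  by apply: mulr_ge0; [exact: ltW|apply: mulr_ge0; [exact: mulr_ge0|exact: ltW]].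
have mdr : measurable_fun setT (fun w => drift s w 0 i).
  have Ld : elip L1 (fun z => mean_field_drift eta theta tau (distribution P (X s)) z 0 i).
    move=> z z'; exact: (@mean_field_drift_coord_lip R d eta theta tau Le Lt etaL theta1L
    (distribution P (X s)) (law_int s0)).
  have := measurableT_comp (elip_measurable Ld) (measurable_funPT (X s)).
  by apply: eq_measurable_fun => w _; rewrite /= !mxE.
have mV : measurable_fun setT V.
  apply: measurableT_comp => //; apply: measurable_funB; last exact: measurable_funB.
  by apply: measurable_funB; [exact: measurable_funB|exact: measurable_funM].
have VU w : good w -> V w <= U w + L1 * \int[mu]_(r in `[s, s + h]) Y r w.
  move=> gw; rewrite /V; have [i1 ->] := incr i gw s0 (ltW sh).
  have -> : forall a b z : R, a + b - z - b = a - z by move=> *; ring.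
  have -> : h * drift s w 0 i = \int[mu]_(r in `[s, s + h]) drift s w 0 i.
    by rewrite Rintegral_itv_cst ?(ltW sh)// mulrC; congr (_ * _); rewrite addrAC subrr add0r.
  have i2 := integrable_itv_cst s (s + h) (drift s w 0 i).
  rewrite -(RintegralB _ i1 i2)//.
  have ii := integrableB _ i1 i2.
  apply: le_trans (le_normr_Rintegral _ (ii _)) _ => //.
  have cY : continuous (fun r => Y r w).
    case: gw => cX _ _ _; rewrite /Y /increment.
    apply: continuous_sum_norm => j t; apply: cvgB; first exact: (cX j).
    exact: cvg_cst.
  have iY := continuous_itv_integrable s (s + h) cY.
  have iLY : mu.-integrable `[s, s + h] (EFin \o (fun r => L1 * Y r w)).
    exact: (integrableZl _ L1 iY).
  have -> : U w + L1 * \int[mu]_(r in `[s, s + h]) Y r w =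
      \int[mu]_(r in `[s, s + h]) (L1 * Y r w + `|tau| * Lt * e1).
    rewrite RintegralD//; last exact: integrable_itv_cst.
    rewrite RintegralZl// Rintegral_itv_cst ?(ltW sh)// addrC; congr (_ + _).
    by rewrite /U mulrC; congr (_ * _); rewrite addrAC subrr add0r.
  apply: Rintegral_itv_le.
  - exact: (integrable_abse (ii _)).
  - have ij := integrableD _ iLY (integrable_itv_cst s (s + h) (`|tau| * Lt * e1)).
    exact: (ij _).
  - move=> r srh; apply: le_trans (dd r w srh) _.
    by rewrite /Y max_r// (le_trans s0)//; case/andP: srh.
have FF := @ae_filter_ringOfSetsType _ _ _ P.
have key := @fatou_Riemann _ _ _ P Y U V s (s + h) L1 e1 sh L10.
apply: le_trans (key _ _ _ _ _ _ _ _ _) _ => //.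
- by move=> r _; exact: measurable_increment.
- by move=> r w; exact: sumr_ge0.
- exact: measurable_cst.
- by move=> w; exact: normr_ge0.
- apply: filterS ae_good => w [cX _ _ _]; rewrite /Y /increment.
  apply: continuous_sum_norm => j t; apply: cvgB; first exact: (cX j).
  exact: cvg_cst.
- by apply: filterS ae_good => w gw; exact: VU.
- move=> r srh; rewrite /Y max_r; first exact: Hr.
  by rewrite (le_trans s0)//; case/andP: srh.
rewrite /U integral_cst//= probability_setT mule1 -EFinD lee_fin.
have -> : s + h - s = h by ring.
have -> : h * (`|tau| * Lt * e1) + L1 * h * e1 = h * (k * e1) by rewrite /k; ring.
rewrite ler_wpM2l ?(ltW hp)// /e1 mulrA ler_pdivrMr ?ltr_wpDl//.
by rewrite mulrC ler_wpM2l ?(ltW e0)// lerDl.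
Qed.

Let increment_law s t : 0 <= s -> s < t -> forall gamma : probability 'rV[R]_d R,
  gaussian_law (Num.sqrt (t - s)) gamma ->
  forall A, measurable A -> P [set w | A (B t w - B s w)] = gamma A.
Proof.
move=> s0 st gamma gl A mA.
have mD : measurable_fun setT (fun w => B t w - B s w).
  apply: measurable_fun_rV => i.
  have -> : (fun w => (B t w - B s w) 0 i) = (fun w => B t w 0 i - B s w 0 i).
    by apply/funext => w; rewrite !mxE.
  exact: measurable_funB.
pose m' : {measure set 'rV[R]_d -> \bar R} := pushforward P (fun w => B t w - B s w).
apply: (@eq_prob_rV _ _ (m' mD) gamma) => //.
  by rewrite /m' /= /pushforward preimage_setT; exact: le_lt_trans (probability_le1 P measurableT) (ltry _).
move=> C mC; rewrite gl//; case: BM => _ _ _ /(_ s t s0 st C mC) <- _.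
by [].
Qed.

(** [X s] is [F s]-measurable by adaptedness and the Brownian increment is independent of [F s], so
    the pair has a product law. *)
Let joint_law s h (gamma : probability 'rV[R]_d R) (H : 'rV[R]_d * 'rV[R]_d -> R) :
  0 <= s -> 0 < h -> gaussian_law (Num.sqrt h) gamma -> bounded_measurable H ->
  \int[P]_w H (X s w, B (s + h) w - B s w) =
  \int[distribution P (X s)]_z \int[gamma]_y H (z, y).
Proof.
move=> s0 h0 gl bH; have [mH [M HM]] := bH.
have sh : s < s + h by rewrite ltrDl.
have glh : gaussian_law (Num.sqrt (s + h - s)) gamma.
  by rewrite addrAC subrr add0r.
have mD : measurable_fun setT (fun w => B (s + h) w - B s w).
  apply: measurable_fun_rV => i.
  have -> : (fun w => (B (s + h) w - B s w) 0 i) = (fun w => B (s + h) w 0 i - B s w 0 i).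
    by apply/funext => w; rewrite !mxE.
  exact: measurable_funB.
have mXD : measurable_fun setT (fun w => (X s w, B (s + h) w - B s w)).
  by apply: measurable_fun_pair => //; exact: measurable_funPT.
pose m' : {measure set ('rV[R]_d * 'rV[R]_d) -> \bar R} :=
  pushforward P (fun w => (X s w, B (s + h) w - B s w)).
have E A : measurable A -> (distribution P (X s) \x gamma)%E A = m' mXD A.
  apply: product_measure_unique => U W mU mW.
  rewrite /m' /= /pushforward.
  case: BM => _ _ _ _ indep; case: sol => adX _ _ _.
  transitivity (P (X s @^-1` U) * P [set w | W (B (s + h)%R w - B s w)%R])%E.
    by rewrite -(indep s (s + h) s0 sh _ (adX s s0 U mU) W mW).
  by rewrite (increment_law s0 sh glh mW).
have bHX : bounded_measurable (fun w => H (X s w, B (s + h) w - B s w)).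
  by split; [exact: (measurableT_comp mH mXD)|exists M => w].
apply: (addIr M); apply: EFin_inj.
transitivity (\int[P]_w (H (X s w, B (s + h) w - B s w) + M)%:E)%E; first exact: (esym (integral_shift P M bHX)).
transitivity (\int[distribution P (X s)]_z \int[gamma]_y (H (z, y) + M)%:E)%E; last first.
  exact: (integral2_shift (distribution P (X s)) gamma M bH).
pose f z := (H z + M)%:E.
have mf : measurable_fun setT f by apply/measurable_EFinP; exact: measurable_funD.
have f0 z : (0 <= f z)%E by rewrite lee_fin; have := HM z; rewrite ler_norml => /andP[]; lra.
transitivity (\int[m' mXD]_z f z)%E.
  by rewrite ge0_integral_pushforward.
transitivity (\int[distribution P (X s) \x gamma]_z f z)%E.
  by apply: eq_measure_integral => A mA _; exact: (esym (E A mA)).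
exact: (fubini_tonelli1 (m1 := distribution P (X s)) (m2 := gamma) f mf f0).
Qed.

Let bmf_law (g : 'rV[R]_d -> R) s : bounded_measurable g ->
  bounded_measurable (fun w => g (X s w)) /\
  \int[distribution P (X s)]_y g y = \int[P]_w g (X s w).
Proof.
move=> bg; have [mg [M gM]] := bg.
have bX : bounded_measurable (fun w => g (X s w)).
  by split; [exact: (measurableT_comp mg (measurable_funPT (X s)))|exists M => w].
split=> //.
by have [_ ->] := law_integral (bmf_integrable (distribution P (X s)) bg).
Qed.

(** [joint_law] identifies the double integral with the mean of [g] at the random Euler point, whose
    distance to [X (s + h)] is at most the sum of the coordinate errors of [local_error]. *)
Lemma solution_one_step T e : 0 < T -> 0 < e -> exists h0 : R, 0 < h0 /\
  forall s h, 0 <= s -> 0 < h -> h < h0 -> s + h <= T ->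
  forall (g : 'rV[R]_d -> R) Lg, 0 <= Lg -> elip Lg g -> bounded_measurable g ->
  forall gamma : probability 'rV[R]_d R, gaussian_law (Num.sqrt h) gamma ->
  `|\int[distribution P (X (s + h))]_y g y -
    \int[distribution P (X s)]_z \int[gamma]_y
      g (z + h *: mean_field_drift eta theta tau (distribution P (X s)) z + y)| <= Lg * h * e.
Proof.
move=> T0 e0; have d10 : 0 < d%:R + 1 :> R by rewrite ltr_wpDl.
(* The error is shared among the coordinates; [d%:R + 1] stays positive for [d = 0]. *)
have [h0 [h00 H0]] := local_error T0 (divr_gt0 e0 d10).
exists h0; split => // s h s0 hp hh0 shT g Lg Lg0 gL bg gamma gl.
pose b z := mean_field_drift eta theta tau (distribution P (X s)) z.
have mb i : measurable_fun setT (fun z => b z 0 i).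
  have Ld : elip L1 (fun z => b z 0 i).
    move=> z z'; exact: (@mean_field_drift_coord_lip R d eta theta tau Le Lt etaL theta1L
      (distribution P (X s)) (law_int s0)).
  exact: elip_measurable Ld.
have [mg [M gM]] := bg.
have bH : bounded_measurable (fun p : 'rV[R]_d * 'rV[R]_d => g (p.1 + h *: b p.1 + p.2)).
  split; last by exists M => p.
  apply: (measurableT_comp mg); apply: measurable_fun_rV => i.
  have -> : (fun p : 'rV[R]_d * 'rV[R]_d => (p.1 + h *: b p.1 + p.2) 0 i) =
      (fun p : 'rV[R]_d * 'rV[R]_d => p.1 0 i + h * b p.1 0 i + p.2 0 i).
    by apply/funext => p; rewrite !mxE.
  have m1 : measurable_fun setT (fun p : 'rV[R]_d * 'rV[R]_d => p.1 0 i).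
    exact: (measurableT_comp (measurable_coord i) measurable_fst).
  have m2 : measurable_fun setT (fun p : 'rV[R]_d * 'rV[R]_d => p.2 0 i).
    exact: (measurableT_comp (measurable_coord i) measurable_snd).
  apply: measurable_funD => //; apply: measurable_funD => //; apply: measurable_funM => //.
  exact: (measurableT_comp (mb i) measurable_fst).
rewrite -(joint_law s0 hp gl bH) /=.
have [bX ->] := bmf_law (s + h) bg.
have bE : bounded_measurable (fun w => g (X s w + h *: b (X s w) + (B (s + h) w - B s w))).
  split; last by exists M => w.
  apply: (measurableT_comp (proj1 bH) (g := fun w => (X s w, B (s + h) w - B s w))).
  apply: measurable_fun_pair; first exact: measurable_funPT.
  apply: measurable_fun_rV => i.
  have -> : (fun w => (B (s + h) w - B s w) 0 i) = (fun w => B (s + h) w 0 i - B s w 0 i).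
    by apply/funext => w; rewrite !mxE.
  exact: measurable_funB.
rewrite -RintegralB//; [|exact: (bmf_integrable P bX)|exact: (bmf_integrable P bE)].
have ii := bmf_integrable P (bmfB bX bE).
apply: le_trans (le_normr_Rintegral measurableT ii) _.
pose err i w := `|X (s + h) w 0 i - X s w 0 i - h * drift s w 0 i -
      (B (s + h) w 0 i - B s w 0 i)|.
have merr i : measurable_fun setT (err i).
  apply: measurableT_comp => //; apply: measurable_funB; last exact: measurable_funB.
  apply: measurable_funB; first exact: measurable_funB.
  apply: measurable_funM => //.
  have := measurableT_comp (mb i) (measurable_funPT (X s)).
  by apply: eq_measurable_fun => w _; rewrite /= !mxE.
have He := integral_sum_le merr (fun i w => normr_ge0 _) (H0 s h s0 hp hh0 shT).
rewrite -lee_fin; apply: (@le_trans _ _ (\int[P]_w (Lg * \sum_i err i w)%:E)%E).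
  rewrite /Rintegral fineK; last by apply: integrable_fin_num => //; exact: (integrable_abse ii).
  apply: ge0_le_integral => //.
  - by case/integrableP : (integrable_abse ii).
  - by apply/measurable_EFinP; apply: measurable_funM => //; exact: measurable_sum.
  - move=> w _; rewrite lee_fin; apply: le_trans (gL _ _) _; rewrite ler_wpM2l//.
    apply: le_trans (enorm_le_sum _) _; apply: ler_sum => i _.
    rewrite le_eqVlt; apply/orP; left; apply/eqP; congr `|_|; rewrite !mxE; ring.
under eq_integral do rewrite EFinM.
rewrite ge0_integralZl//.
- apply: (@le_trans _ _ (Lg%:E * (\sum_(i < d) h * (e / (d%:R + 1)))%:E)%E).
    by rewrite lee_wpmul2l// lee_fin.
  rewrite -EFinM lee_fin -mulrA ler_wpM2l// sumr_const card_ord -mulrnAr ler_wpM2l ?(ltW hp)//.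
  rewrite -mulr_natl mulrA ler_pdivrMr// mulrC ler_wpM2l ?(ltW e0)// lerDl//.
- by apply/measurable_EFinP; exact: measurable_sum.
- by move=> w _; rewrite lee_fin; apply: sumr_ge0 => i _; exact: normr_ge0.
Qed.

Lemma solution_start (g : 'rV[R]_d -> R) : bounded_measurable g ->
  \int[distribution P (X 0)]_y g y = g x.
Proof.
move=> bg; have [bX ->] := bmf_law 0 bg.
rewrite -(prob_Rintegral_cst P (g x)).
rewrite /Rintegral; congr fine; apply: ae_eq_integral => //.
- by apply/measurable_EFinP; case: bX.
- have FF := @ae_filter_ringOfSetsType _ _ _ P.
  apply: filterS ae_good => w [_ _ B0 H] _; congr (g _)%:E; apply/rowP => i.
  have [_ ->] := H 0 (lexx 0) i.
  by rewrite set_itv1 Rintegral_set1 B0 mxE !addr0.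
Qed.

(** A crude bound, uniform on [[0, T]] and over all [Lt]-Lipschitz functions; it supplies the finite
    constant from which the iteration in [mean_field_gap] starts. *)
Lemma solution_moment T : 0 < T -> exists C, forall t, 0 <= t <= T ->
  forall g, elip Lt g -> (distribution P (X t)).-integrable setT (EFin \o g) ->
  `|\int[distribution P (X t)]_y g y - g x| <= C.
Proof.
move=> T0; have [w0 g0] := good_path.
have [C [C0 HC]] := dist_moment T0 g0.
have /choice[M HM] i := bounded_cont T (let: And4 c1 _ _ _ := g0 in c1 i).
pose K := \sum_i (`|M i| + `|x 0 i|).
have K0 : 0 <= K by apply: sumr_ge0 => i _; rewrite addr_ge0.
exists (Lt * (C + K)) => t tT g gL gi; case/andP : (tT) => t0 _.
have [i1 ->] := law_integral gi.
rewrite -[X in _ - X](prob_Rintegral_cst P (g x)).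
have i2 := bmf_integrable P (bmf_cst (g x)).
rewrite -(RintegralB measurableT i1 i2).
have ii := integrableB measurableT i1 i2.
apply: le_trans (le_normr_Rintegral measurableT ii) _.
rewrite -lee_fin; apply: (@le_trans _ _ (\int[P]_w (Lt * (dist w w0 t + K))%:E)%E).
  rewrite /Rintegral fineK; last by apply: integrable_fin_num => //; exact: (integrable_abse ii).
  apply: ge0_le_integral => //.
  - by case/integrableP : (integrable_abse ii).
  - by apply/measurable_EFinP; apply: measurable_funM => //; apply: measurable_funD.
  - move=> w _; rewrite lee_fin; apply: le_trans (gL _ _) _; rewrite ler_wpM2l//.
    apply: le_trans (enorm_le_sum _) _; rewrite /dist /K -big_split/=; apply: ler_sum => i _.
    rewrite /Xc !mxE max_r//.
    have -> : X t w 0 i - x 0 i = (X t w 0 i - X t w0 0 i) + (X t w0 0 i - x 0 i) by ring.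
    apply: le_trans (ler_normD _ _) _; rewrite lerD2l; apply: le_trans (ler_normB _ _) _.
    by rewrite lerD2r; apply: le_trans (ler_norm _); have := HM i t tT; rewrite /Xc max_r.
under eq_integral do rewrite EFinM.
rewrite ge0_integralZl//.
- rewrite EFinM lee_wpmul2l ?lee_fin//; under eq_integral do rewrite EFinD.
  rewrite ge0_integralD//; [|by move=> w _; rewrite lee_fin|exact/measurable_EFinP].
  rewrite integral_cst//= probability_setT mule1 [leRHS]EFinD; apply: leeD => //; exact: HC.
- by apply/measurable_EFinP; exact: measurable_funD.
- by move=> w _; rewrite lee_fin addr_ge0.
Qed.

(** Existence of the Gaussian measure is read off from the given Brownian motion: it is the law of
    [B h - B 0]. *)
Lemma solution_noise h : 0 < h -> exists gamma : probability 'rV[R]_d R,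
  gaussian_law (Num.sqrt h) gamma.
Proof.
move=> h0.
have mD : measurable_fun setT (fun w => B h w - B 0 w).
  apply: measurable_fun_rV => i.
  have -> : (fun w => (B h w - B 0 w) 0 i) = (fun w => B h w 0 i - B 0 w 0 i).
    by apply/funext => w; rewrite !mxE.
  exact: measurable_funB.
pose D : {RV P >-> 'rV[R]_d} := HB.pack (fun w => B h w - B 0 w)
  (isMeasurableFun.Build _ _ _ _ _ mD).
exists (distribution P D) => A mA.
case: BM => _ _ _ /(_ 0 h (lexx 0) h0 A mA) H _.
by rewrite subr0 in H; rewrite -H.
Qed.

End process.

(* What the comparison argument uses of the marginals of a solution: each small
   time step is, up to an error [o(h)], an Euler step with Gaussian noise. *)
Definition euler_flow {R : realType} {d : nat} (eta : 'rV[R]_d -> 'rV[R]_d)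
    (theta : 'rV[R]_d -> 'rV[R]_d -> 'rV[R]_d) (tau Lt : R) (x : 'rV[R]_d)
    (mu : R -> probability 'rV[R]_d R) : Prop :=
  [/\ forall s : R, 0 <= s -> forall z i,
        (mu s).-integrable setT (fun y => (theta z y 0 i)%:E),
      forall T e : R, 0 < T -> 0 < e -> exists h0 : R, 0 < h0 /\
        forall s h, 0 <= s -> 0 < h -> h < h0 -> s + h <= T ->
        forall (g : 'rV[R]_d -> R) L, 0 <= L -> elip L g -> bounded_measurable g ->
        forall gamma : probability 'rV[R]_d R, gaussian_law (Num.sqrt h) gamma ->
        `|\int[mu (s + h)]_y g y -
          \int[mu s]_z \int[gamma]_y
            g (z + h *: mean_field_drift eta theta tau (mu s) z + y)| <= L * h * e,
      forall g : 'rV[R]_d -> R, bounded_measurable g -> \int[mu 0]_y g y = g x,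
      forall T : R, 0 < T -> exists C : R, forall t, 0 <= t <= T ->
        forall g, elip Lt g -> (mu t).-integrable setT (EFin \o g) ->
        `|\int[mu t]_y g y - g x| <= C
    & forall h : R, 0 < h -> exists gamma : probability 'rV[R]_d R,
        gaussian_law (Num.sqrt h) gamma].

Lemma mckean_vlasov_euler_flow {R : realType} {d : nat} (eta : 'rV[R]_d -> 'rV[R]_d)
    (theta : 'rV[R]_d -> 'rV[R]_d -> 'rV[R]_d) (tau Le Lt : R) (x : 'rV[R]_d)
    (mu : R -> probability 'rV[R]_d R) :
  0 <= Le -> 0 <= Lt ->
  (forall x y, enorm (eta x - eta y) <= Le * enorm (x - y)) ->
  (forall x x' y, enorm (theta x y - theta x' y) <= Lt * enorm (x - x')) ->
  (forall x y y', enorm (theta x y - theta x y') <= Lt * enorm (y - y')) ->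
  mckean_vlasov_law eta theta tau x mu -> euler_flow eta theta tau Lt x mu.
Proof.
move=> Le0 Lt0 etaL t1L t2L [disp [W [P [F [B [X [_ BM sol muE]]]]]]].
have E s (g : 'rV[R]_d -> \bar R) : 0 <= s ->
    (\int[mu s]_y g y = \int[distribution P (X s)]_y g y)%E.
  by move=> s0; apply: eq_measure_integral => A mA _; exact: muE.
have ER s (g : 'rV[R]_d -> R) : 0 <= s -> \int[mu s]_y g y = \int[distribution P (X s)]_y g y.
  by move=> s0; rewrite /Rintegral E.
have EI s (g : 'rV[R]_d -> \bar R) : 0 <= s ->
    (mu s).-integrable setT g <-> (distribution P (X s)).-integrable setT g.
  by move=> s0; split => /integrableP[mg ig]; apply/integrableP; split => //; move: ig; rewrite E.
have ED s z : 0 <= s -> mean_field_drift eta theta tau (mu s) z =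
    mean_field_drift eta theta tau (distribution P (X s)) z.
  by move=> s0; apply/rowP => i; rewrite !mxE ER.
split.
- by move=> s s0 z i; apply/EI => //; case: sol => _ _ H _; exact: H.
- move=> T e T0 e0.
  have [h0 [h00 H]] := solution_one_step Le0 Lt0 etaL t1L t2L BM sol T0 e0.
  exists h0; split; first exact: h00.
  move=> s h s0 hp hh shT g L L0 Lg bg gamma gl.
  have sh0 : 0 <= s + h by rewrite addr_ge0// ltW.
  rewrite (ER _ _ sh0) (ER _ _ s0).
  have -> : mean_field_drift eta theta tau (mu s) = mean_field_drift eta theta tau (distribution P (X s)).
    by apply/funext => z; exact: ED.
  exact: (H s h s0 hp hh shT g L L0 Lg bg gamma gl).
- by move=> g bg; rewrite ER//; exact: (solution_start BM sol bg).
- move=> T T0; have [C H] := solution_moment Le0 Lt0 etaL t1L BM sol T0.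
  exists C => t tT g Lg gi; case/andP: (tT) => t0 _; rewrite ER//; apply: H => //.
  exact/EI.
- by move=> h h0; exact: (solution_noise BM h0).
Qed.

(** * Backward Euler recursions *)

Section backward.
Context {R : realType} {d : nat}.
Implicit Types (gamma : probability 'rV[R]_d R) (g u v : 'rV[R]_d -> R) (h : R).

Definition euler_step gamma h (b : 'rV[R]_d -> 'rV[R]_d) u : 'rV[R]_d -> R :=
  fun z => \int[gamma]_y u (z + h *: b z + y).

(* [j] backward Euler steps from the final time [n * h]. *)
Fixpoint backward gamma h (b : R -> 'rV[R]_d -> 'rV[R]_d) g (n j : nat) : 'rV[R]_d -> R :=
  if j is k.+1 then euler_step gamma h (b ((n - k.+1)%:R * h)) (backward gamma h b g n k)
  else g.

Lemma elip_bmf L M g : elip L g -> (forall z, `|g z| <= M) -> bounded_measurable g.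
Proof. by move=> Lg gM; split; [exact: elip_measurable Lg|exists M]. Qed.

Lemma bmf_translate u (w : 'rV[R]_d) : bounded_measurable u ->
  bounded_measurable (fun z : 'rV[R]_d => u (w + z)).
Proof.
move=> [mu [M uM]]; split; last by exists M => z.
apply: (measurableT_comp mu); apply: measurable_fun_rV => i.
have -> : (fun z : 'rV[R]_d => (w + z) 0 i) = (fun z : 'rV[R]_d => w 0 i + z 0 i).
  by apply/funext => z; rewrite mxE.
by apply: measurable_funD => //; exact: measurable_coord.
Qed.

Lemma euler_step_elip gamma h b u L M Lb : 0 <= L -> 0 <= h ->
  (forall z z', enorm (b z - b z') <= Lb * enorm (z - z')) ->
  elip L u -> (forall z, `|u z| <= M) ->
  elip (L * (1 + h * Lb)) (euler_step gamma h b u) /\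
  (forall z, `|euler_step gamma h b u z| <= M).
Proof.
move=> L0 h0 bL Lu uM; have bu := elip_bmf Lu uM.
have bt w := bmf_translate w bu.
split; last by move=> z; apply: prob_Rintegral_bound => //; case: (bt (z + h *: b z)).
move=> z z'; rewrite /euler_step -RintegralB//; [|exact: (bmf_integrable gamma (bt _))|exact: (bmf_integrable gamma (bt _))].
have ii := bmf_integrable gamma (bmfB (bt (z + h *: b z)) (bt (z' + h *: b z'))).
apply: le_trans (le_normr_Rintegral measurableT ii) _.
apply: (prob_le_Rintegral_cst (P := gamma)); first exact: (integrable_abse ii).
move=> y; apply: le_trans (Lu _ _) _; rewrite -mulrA ler_wpM2l//.
have -> : z + h *: b z + y - (z' + h *: b z' + y) = (z - z') + h *: (b z - b z').
  by apply/rowP => i; rewrite !mxE; ring.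
apply: le_trans (enormD _ _) _; rewrite mulrDl mul1r lerD2l enormZ ger0_norm// -mulrA.
by rewrite ler_wpM2l.
Qed.

(** The Lipschitz constant grows by a factor [1 + h * Lb] per step at most. Over a time [T] the
    total factor stays below [expR (Lb * T)], uniformly in [h], which keeps the one-step errors
    summable. *)
Lemma backward_elip gamma h b g L M Lb n j : 0 <= L -> 0 <= h -> 0 <= Lb ->
  (forall s, 0 <= s -> forall z z', enorm (b s z - b s z') <= Lb * enorm (z - z')) ->
  elip L g -> (forall z, `|g z| <= M) ->
  elip (L * (1 + h * Lb) ^+ j) (backward gamma h b g n j) /\
  (forall z, `|backward gamma h b g n j z| <= M).
Proof.
move=> L0 h0 Lb0 bL Lg gM; elim: j => [|j [IH1 IH2]] /=; first by rewrite expr0 mulr1.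
rewrite exprSr mulrA; apply: euler_step_elip => //; last by apply: bL; rewrite mulr_ge0.
by rewrite mulr_ge0// exprn_ge0// addr_ge0// mulr_ge0.
Qed.

Lemma expr1D_le (a : R) (n : nat) : 0 <= a -> (1 + a) ^+ n <= expR (a * n%:R).
Proof.
move=> a0; rewrite mulrC expRM_natl lerXn2r ?nnegrE ?expR_ge0 ?addr_ge0//.
exact: expR_ge1Dx.
Qed.

(** Telescoping over [j] of the integral of the [j]-th iterate against the law at time
    [(n - j) * h]: for [j = 0] this is the integral of [g], for [j = n] the value of the last
    iterate at [x], and each step costs [o(h)]. *)
Lemma backward_error eta theta tau Lt x (mu : R -> probability 'rV[R]_d R) T g L M Lb e :
  euler_flow eta theta tau Lt x mu ->
  let b s := mean_field_drift eta theta tau (mu s) in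
  0 < T -> 0 <= L -> 0 <= Lb -> 0 < e ->
  (forall s, 0 <= s -> forall z z', enorm (b s z - b s z') <= Lb * enorm (z - z')) ->
  elip L g -> (forall z, `|g z| <= M) ->
  exists h0 : R, 0 < h0 /\ forall (h : R) (n : nat), 0 < h -> h < h0 -> n%:R * h <= T ->
  forall gamma, gaussian_law (Num.sqrt h) gamma ->
  `|\int[mu (n%:R * h)]_y g y - backward gamma h b g n n x| <= e.
Proof.
move=> [_ step start _ _] b T0 L0 Lb0 e0 bL Lg gM.
(* The [n] step errors, each [h * (e / K)] times a Lipschitz constant, add up to at most [e]; the 1
   makes [K] positive when [L = 0]. *)
pose K := T * (L * expR (Lb * T)) + 1.
have K0 : 0 < K by rewrite ltr_wpDl// !mulr_ge0 ?expR_ge0// ltW.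
have [h0 [h00 H]] := step T (e / K) T0 (divr_gt0 e0 K0).
exists h0; split; first exact: h00.
move=> h n hp hh nhT gamma gl.
have bk j := backward_elip gamma n j L0 (ltW hp) Lb0 bL Lg gM.
have bbk j : bounded_measurable (backward gamma h b g n j).
  by have [h1 h2] := bk j; exact: elip_bmf h1 h2.
have Lj j : (j <= n)%N -> L * (1 + h * Lb) ^+ j <= L * expR (Lb * T).
  move=> jn; rewrite ler_wpM2l//; apply: le_trans (expr1D_le _ _) _; first by rewrite mulr_ge0// ltW.
  rewrite ler_expR (mulrC h) -mulrA ler_wpM2l//; apply: le_trans nhT.
  by rewrite mulrC ler_wpM2r ?(ltW hp)// ler_nat.
have main j : (j <= n)%N -> `|\int[mu (n%:R * h)]_y g y - \int[mu ((n - j)%:R * h)]_y backward gamma h b g n j y| <=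
    j%:R * (L * expR (Lb * T) * h * (e / K)).
  elim: j => [_|j IH jn]; first by rewrite subn0 subrr normr0 mul0r.
  have E : (n - j)%:R * h = (n - j.+1)%:R * h + h.
    by rewrite -[in LHS](subnSK jn) -natr1 mulrDl mul1r.
  have := IH (ltnW jn); rewrite E => IHj.
  have s0 : 0 <= (n - j.+1)%:R * h by rewrite mulr_ge0// ltW.
  have sT : (n - j.+1)%:R * h + h <= T.
    rewrite -E; apply: le_trans nhT; by rewrite ler_wpM2r ?(ltW hp)// ler_nat leq_subr.
  have [Lk _] := bk j.
  have LL0 : 0 <= L * (1 + h * Lb) ^+ j by rewrite mulr_ge0// exprn_ge0// addr_ge0// mulr_ge0// ltW.
  have := H _ h s0 hp hh sT _ _ LL0 Lk (bbk j) gamma gl => Hj.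
  have Hj' := le_trans Hj (ler_wpM2r (ltW (divr_gt0 e0 K0)) (ler_wpM2r (ltW hp) (Lj j (ltnW jn)))).
  rewrite -[j.+1%:R]natr1 mulrDl mul1r.
  exact: le_trans (ler_distD _ _ _) (lerD IHj Hj').
have := main n (leqnn n); rewrite subnn mul0r start//.
move=> Hn; apply: le_trans Hn _.
have -> : n%:R * (L * expR (Lb * T) * h * (e / K)) = (n%:R * h) * (L * expR (Lb * T)) / K * e.
  by field; rewrite gt_eqF.
apply: (@le_trans _ _ (1 * e)); last by rewrite mul1r.
rewrite ler_wpM2r ?(ltW e0)// ler_pdivrMr// mul1r /K.
apply: (@le_trans _ _ (T * (L * expR (Lb * T)))); last by rewrite lerDl.
by rewrite ler_wpM2r// mulr_ge0// expR_ge0.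
Qed.

(** In the application [p] and [p'] are the first drift at the two points and [q] is the second
    drift at [y]: the displacement splits into movement under one drift and the gap between the
    drifts. For the former, the squared distance is at most [r ^+ 2 * (1 + 2 A)], and
    [sqrt (1 + 2 A) <= 1 + A]. *)
Lemma drift_step_dist (x y p p' q : 'rV[R]_d) (h k Lb delta : R) : 0 <= h -> 0 <= Lb ->
  dotp (x - y) (p - p') <= k * enorm (x - y) ^+ 2 ->
  enorm (p - p') <= Lb * enorm (x - y) -> enorm (p' - q) <= delta ->
  enorm (x + h *: p - (y + h *: q)) <=
    enorm (x - y) * (1 + (h * k + h ^+ 2 * Lb ^+ 2 / 2)) + h * delta.
Proof.
move=> h0 Lb0 Hk HL Hd; set r := enorm (x - y) in Hk HL *.
have r0 : 0 <= r by exact: enorm_ge0.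
have -> : x + h *: p - (y + h *: q) = (x - y + h *: (p - p')) + h *: (p' - q).
  by apply/rowP => i; rewrite !mxE; ring.
apply: le_trans (enormD _ _) _; apply: lerD; last by rewrite enormZ ger0_norm// ler_wpM2l.
set A := h * k + _; set w := x - y + _.
have w2 : enorm w ^+ 2 <= r ^+ 2 * (1 + A + A).
  have -> : enorm w ^+ 2 = r ^+ 2 + 2 * (h * dotp (x - y) (p - p')) + h ^+ 2 * enorm (p - p') ^+ 2.
    rewrite /w /r; move: (x - y) (p - p') => a c.
    by rewrite !sqr_enorm !(dotpDl, dotpDr, dotpZl, dotpZr) (dotpC c a); ring.
  have h1 := ler_wpM2l h0 Hk.
  have h2 : enorm (p - p') ^+ 2 <= (Lb * r) ^+ 2.
    by rewrite ler_pXn2r ?nnegrE ?enorm_ge0// mulr_ge0.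
  have h3 := ler_wpM2l (mulr_ge0 h0 h0) h2.
  have -> : r ^+ 2 * (1 + A + A) = r ^+ 2 + (h * (k * r ^+ 2) + h * (k * r ^+ 2)) + h * h * (Lb * r) ^+ 2.
    by rewrite /A; field.
  move: h1 h3; rewrite -!mulrA.
  move: (dotp _ _) (enorm (p - p') ^+ 2) => dd en; lra.
(* [k] may be very negative, so the sign of [1 + A] needs an argument: [r ^+ 2 * (1 + A + A)]
   dominates a square. *)
have rA : 0 <= r * (1 + A).
  have [->|rn] := eqVneq r 0; first by rewrite mul0r.
  have rp : 0 < r by rewrite lt_neqAle eq_sym rn.
  have : 0 <= r ^+ 2 * (1 + A + A) by apply: le_trans w2; exact: sqr_ge0.
  by rewrite pmulr_rge0 ?exprn_gt0// => hA; rewrite mulr_ge0//; lra.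
rewrite -(ler_pXn2r (n := 2)) ?nnegrE ?enorm_ge0//; apply: le_trans w2 _.
rewrite exprMn ler_wpM2l ?sqr_ge0//.
have -> : (1 + A) ^+ 2 = 1 + A + A + A ^+ 2 by ring.
by rewrite lerDl sqr_ge0.
Qed.

Lemma comparison_step gamma h u v a c q beta (b b' : 'rV[R]_d -> 'rV[R]_d) x y :
  0 < h -> 0 <= q -> gaussian_law (Num.sqrt h) gamma ->
  bounded_measurable u -> bounded_measurable v ->
  (forall z w, u z - v w <= a * enorm (z - w) + c * gsign q (enorm (z - w)) + beta) ->
  euler_step gamma h b u x - euler_step gamma h b' v y <=
    a * enorm (x + h *: b x - (y + h *: b' y)) +
    c * gsign (q + 4 * h) (enorm (x + h *: b x - (y + h *: b' y))) + beta.
Proof.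
move=> h0 q0 gl bu bv uv; have sh : 0 < Num.sqrt h by rewrite sqrtr_gt0.
have := gaussian_reflection (x + h *: b x) (y + h *: b' y) sh q0 gl bu bv uv.
by rewrite sqr_sqrtr// ltW.
Qed.

End backward.

(** * Contraction and smoothing *)
Section contraction.
Context {R : realType}.
Implicit Types (q r h k s : R).

Lemma gsign_tangent_scale q q' r r' : 0 < q -> 0 < q' -> 0 <= r -> 0 <= r' ->
  gsign q' r' <= gsign q r + 2 * phi1 (r / Num.sqrt q) * (r' / Num.sqrt q' - r / Num.sqrt q).
Proof.
move=> q0 q'0 r0 r'0; rewrite (gsign_scale r q0) (gsign_scale r' q'0).
by apply: gsign_tangent; rewrite divr_ge0// sqrtr_ge0.
Qed.

Lemma gsign_slope q r : 0 < q -> 0 <= r -> gsign q r <= 2 * phi1 (0 : R) / Num.sqrt q * r.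
Proof.
move=> q0 r0; have := gsign_tangent_scale q0 q0 (lexx 0) r0.
rewrite gsignr0 mul0r subr0 add0r => H; apply: le_trans H _.
by rewrite [_ * r]mulrAC mulrA.
Qed.

(** The slope of [gsign q] at 0 is proportional to [1 / Num.sqrt q], and this ratio is the factor by
    which one step flattens it. With [s = h / q] one has [(1 - s)^2 (1 + 4 s) = 1 + s (2 - 7 s + 4
    s^2)], and the last bracket is positive for [s <= 1 / 4]. *)
Lemma sqrt_ratio_le q h : 0 < q -> 0 <= h -> h <= q / 4 ->
  Num.sqrt q / Num.sqrt (q + 4 * h) <= 1 - h / q.
Proof.
move=> q0 h0 hq; set s := h / q.
have s0 : 0 <= s by rewrite divr_ge0// ltW.
have s4 : s <= 1 / 4 by rewrite /s ler_pdivrMr// mul1r mulrC.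
have hE : h = s * q by rewrite /s divfK// gt_eqF.
have Q0 : 0 < q + 4 * h by rewrite ltr_pwDl// mulr_ge0.
rewrite ler_pdivrMr ?sqrtr_gt0//.
rewrite -(ler_pXn2r (n := 2)) ?nnegrE ?sqrtr_ge0//; last first.
  by rewrite mulr_ge0 ?sqrtr_ge0//; move: s4; clear; lra.
rewrite exprMn !sqr_sqrtr ?(ltW q0) ?(ltW Q0)// hE.
have -> : (1 - s) ^+ 2 * (q + 4 * (s * q)) = q + q * s * (2 - 7 * s + 4 * s ^+ 2) by ring.
rewrite lerDl; apply: mulr_ge0; first by rewrite mulr_ge0// ltW.
have := sqr_ge0 s; move: s4; clear; move: (s ^+ 2) => t; lra.
Qed.

(** Up to the contribution of [delta] there are two regimes. For [r <= R0] the concave part loses at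
    least twice what the linear part can gain; beyond [R0] the linear part shrinks by itself,
    because [k <= - k0], and the concave part does not grow. *)
Lemma gsign_contraction (K k0 R0 Lb : R) : 1 <= K -> 0 < k0 -> 0 <= R0 ->
  exists eps q c M h1 : R, [/\ 0 < eps, 0 < q, 0 < c, 0 < M & 0 < h1] /\
    forall h k r r' delta : R, 0 < h -> h <= h1 -> 0 <= r -> 0 <= r' -> 0 <= delta ->
    k <= K -> (R0 < r -> k <= - k0) ->
    r' <= r * (1 + (h * k + h ^+ 2 * Lb ^+ 2 / 2)) + h * delta ->
    eps * r' + gsign (q + 4 * h) r' <= (1 - c * h) * (eps * r + gsign q r) + h * delta * M.
Proof.
move=> K1 k00 R00.
pose K' := K + 1; have K'0 : 0 < K' by rewrite /K'; lra.
(* With this [q] the slope at 0 of [gsign] is multiplied by at most [1 - 2 K' h]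
   per step, which beats the growth [1 + K' h] of the distance. *)
pose q := (2 * K')^-1; have q0 : 0 < q by rewrite invr_gt0 mulr_gt0.
have sq0 : 0 < Num.sqrt q by rewrite sqrtr_gt0.
pose rho r := 2 * phi1 (r / Num.sqrt q) / Num.sqrt q.
have rho0 r : 0 < rho r by rewrite /rho !mulr_gt0 ?invr_gt0// phi1_gt0.
have rho_le r r' : 0 <= r -> r <= r' -> rho r' <= rho r.
  move=> r0 rr'; rewrite /rho ler_wpM2r ?invr_ge0 ?(ltW sq0)// ler_wpM2l//.
  have r'0 := le_trans r0 rr'.
  by apply: phi1_le; rewrite !ger0_norm ?divr_ge0 ?(ltW sq0)// ler_wpM2r ?invr_ge0 ?(ltW sq0).
(* Half the least slope of [gsign q] on [[0, R0]]: the loss there is at least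
   [2 * K' * eps * h * r], against a growth of the linear part of at most [K' * eps * h * r]. *)
pose eps := rho R0 / 2; have eps0 : 0 < eps by rewrite divr_gt0.
(* The slope at 0 of the concave function [eps * r + gsign q r]. It gives both the price of a
   displacement [h * delta] and, through the bound [M * r], the rate [m / M]. *)
pose M := eps + rho 0; have M0 : 0 < M by rewrite addr_gt0.
(* The net decrease per unit of [h * r]: first entry up to [R0], second entry beyond. *)
pose m := Num.min (K' * eps) (eps * k0 / 2).
have m0 : 0 < m by rewrite lt_min mulr_gt0// divr_gt0// mulr_gt0.
(* [q / 4] is for [sqrt_ratio_le]; the other bound makes the second-order term [h * Lb ^+ 2 / 2] at
   most 1/2 and at most [k0 / 2], to be absorbed by [K' = K + 1] and by half of [k0]. *)
pose h1 := Num.min (q / 4) (Num.min 1 k0 / (Lb ^+ 2 + 1)).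
have L0 : 0 < Lb ^+ 2 + 1 by rewrite ltr_wpDl// sqr_ge0.
have mk0 : 0 < Num.min 1 k0 by rewrite lt_min ltr01.
have h10 : 0 < h1 by rewrite lt_min !divr_gt0.
exists eps, q, (m / M), M, h1; split; first by split => //; rewrite divr_gt0.
move=> h k r r' delta h0 hh1 r0 r'0 d0 kK kR Hr.
have [hq hL] : h <= q / 4 /\ h * (Lb ^+ 2 + 1) <= Num.min 1 k0.
  by move: hh1; rewrite le_min => /andP[? ?]; split=> //; rewrite -ler_pdivlMr.
have hL1 : h * Lb ^+ 2 <= 1.
  by move: hL; rewrite le_min mulrDr mulr1 => /andP[? _]; lra.
have hLk : h * Lb ^+ 2 <= k0.
  by move: hL; rewrite le_min mulrDr mulr1 => /andP[_ ?]; lra.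
have aE : h * k + h ^+ 2 * Lb ^+ 2 / 2 = h * (k + h * Lb ^+ 2 / 2) by field.
rewrite aE in Hr; set b := k + _ in Hr.
have bK : b <= K' by rewrite /b /K'; move: hL1 kK; clear; lra.
have bR : R0 < r -> b <= - (k0 / 2) by move=> /kR; rewrite /b; move: hLk; clear; lra.
have Q0 : 0 < q + 4 * h by rewrite addr_gt0// mulr_gt0.
set lam := Num.sqrt q / Num.sqrt (q + 4 * h).
have lam_le : lam <= 1 - h * (2 * K').
  by have := sqrt_ratio_le q0 (ltW h0) hq; rewrite [h / q](_ : _ = h * (2 * K'))// /q invrK.
have lam0 : 0 <= lam by rewrite divr_ge0// sqrtr_ge0.
have hK0 : 0 < h * K' by rewrite mulr_gt0.
have lam1 : lam <= 1 by move: lam_le hK0; clear; lra.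
have hd0 : 0 <= h * delta by rewrite mulr_ge0// ltW.
have lr : lam * r' - r <= - (h * K' * r) + h * delta.
  have h2 := ler_wpM2l lam0 Hr.
  have h3 : r * (1 + h * b) <= r * (1 + h * K').
    by rewrite ler_wpM2l// lerD2l ler_wpM2l// ltW.
  have h4 := ler_wpM2l lam0 h3.
  have h5 : lam * (r * (1 + h * K')) <= (1 - h * (2 * K')) * (r * (1 + h * K')).
    by rewrite ler_wpM2r// mulr_ge0// addr_ge0// ltW.
  have h6 : lam * (h * delta) <= h * delta by rewrite ler_piMl.
  have h7 : 0 <= r * (h * K') ^+ 2 by rewrite mulr_ge0// sqr_ge0.
  move: h2 h4 h5 h6 h7; rewrite mulrDr.
  have -> : (1 - h * (2 * K')) * (r * (1 + h * K')) = r - h * K' * r - 2 * (r * (h * K') ^+ 2) by ring.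
  move: (r * (h * K') ^+ 2) (h * K' * r) (lam * (r * (1 + h * b))) (lam * r') (lam * (h * delta)) (h * delta) (lam * (r * (1 + h * K'))).
  clear; move=> *; lra.
(* Concavity in standardised units: the point moves from [r / Num.sqrt q] to
   [r' / Num.sqrt (q + 4 * h)], which amounts to comparing [lam * r'] with [r]. *)
have G : gsign (q + 4 * h) r' <= gsign q r + rho r * (lam * r' - r).
  apply: le_trans (gsign_tangent_scale q0 Q0 r0 r'0) _; rewrite lerD2l /rho /lam.
  rewrite le_eqVlt; apply/orP; left; apply/eqP; field.
  by rewrite !gt_eqF// sqrtr_gt0.
have G' : rho r * (lam * r' - r) <= - (rho r * (h * K' * r)) + rho 0 * (h * delta).
  apply: le_trans (ler_wpM2l (ltW (rho0 r)) lr) _.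
  by rewrite mulrDr mulrN lerD2l ler_wpM2r// rho_le.
have E := ler_wpM2l (ltW eps0) Hr.
have fle : eps * r + gsign q r <= M * r.
  by rewrite /M mulrDl lerD2l; apply: le_trans (gsign_slope q0 r0) _; rewrite /rho mul0r.
have cf : m / M * h * (eps * r + gsign q r) <= h * (m * r).
  apply: le_trans (ler_wpM2l _ fle) _; first by rewrite mulr_ge0 ?divr_ge0 ?(ltW h0) ?(ltW m0) ?(ltW M0).
  by rewrite [X in X <= _](_ : _ = h * (m * r))//; field; rewrite gt_eqF.
suff key : eps * (r * (1 + h * b)) - rho r * (h * K' * r) <= eps * r - h * (m * r).
  move: G G' E cf key; rewrite mulrBl mul1r /M mulrDr [eps * (_ + _)]mulrDr [h * delta * _]mulrDr.
  rewrite (mulrC (h * delta) eps) (mulrC (h * delta) (rho 0)).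
  move: (gsign _ r') (gsign q r) (rho r * (lam * r' - r)) (rho r * (h * K' * r)) (rho 0 * (h * delta)) (eps * (h * delta)) (eps * r') (eps * (r * (1 + h * b))) (h * (m * r)) (m / M * h * (eps * r + gsign q r)).
  move: (eps * r) (m / (eps + rho 0) * h * (eps * r + gsign q r)).
  clear; move=> *; lra.
have hr0 : 0 <= h * r by rewrite mulr_ge0// ltW.
case: (leP r R0) => [rR|Rr].
- have e1 : rho R0 <= rho r by exact: rho_le.
  have e2 : h * r * (m) <= h * r * (K' * eps) by rewrite ler_wpM2l// ge_min lexx.
  have e3 : h * r * (eps * b) <= h * r * (eps * K') by rewrite ler_wpM2l// ler_wpM2l// ltW.
  have e4 : h * r * (K' * (2 * eps)) <= h * r * (K' * rho r).
    rewrite ler_wpM2l// ler_wpM2l ?(ltW K'0)//; apply: le_trans e1.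
    by rewrite /eps mulrC divfK.
  rewrite -subr_ge0.
  have -> : eps * r - h * (m * r) - (eps * (r * (1 + h * b)) - rho r * (h * K' * r)) =
    h * r * (K' * rho r) - h * r * (eps * b) - h * r * m by ring.
  move: e2 e3 e4; rewrite [K' * (2 * eps)](_ : _ = K' * eps + K' * eps); last by ring.
  rewrite [h * r * (K' * eps + _)]mulrDr (mulrC eps K').
  move: (h * r * (K' * rho r)) (h * r * (eps * b)) (h * r * m) (h * r * (K' * eps)).
  clear; move=> *; lra.
- have e1 : h * r * (eps * b) <= h * r * (eps * - (k0 / 2)).
    by rewrite ler_wpM2l// ler_wpM2l ?(ltW eps0)//; exact: bR.
  have e2 : h * r * m <= h * r * (eps * k0 / 2) by rewrite ler_wpM2l// ge_min lexx orbT.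
  have e3 : 0 <= rho r * (h * K' * r) by rewrite mulr_ge0 ?(ltW (rho0 r))// mulr_ge0// ltW.
  rewrite -subr_ge0.
  have -> : eps * r - h * (m * r) - (eps * (r * (1 + h * b)) - rho r * (h * K' * r)) =
    rho r * (h * K' * r) - h * r * (eps * b) - h * r * m by ring.
  move: e1 e2 e3; rewrite [eps * - _](_ : _ = - (eps * k0 / 2)); last by ring.
  rewrite mulrN.
  move: (rho r * (h * K' * r)) (h * r * (eps * b)) (h * r * m) (h * r * (eps * k0 / 2)).
  clear; move=> *; lra.
Qed.

(* The noise decreases the slope by more than the drift increases it as long as
   [q] is small. *)
Lemma gsign_smoothing (K q h r r' delta : R) : 0 < K -> 0 < q -> 0 < h ->
  h * K <= 1 -> q * (2 * K) <= 1 -> 0 <= r -> 0 <= r' -> 0 <= delta ->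
  r' <= r * (1 + h * K) + h * delta ->
  gsign (q + 2 * h) r' <= gsign q r + 2 * phi1 (0 : R) * delta * (h / Num.sqrt q).
Proof.
move=> K0 q0 h0 hK qK r0 r'0 d0 Hr.
have Q0 : 0 < q + 2 * h by rewrite addr_gt0// mulr_gt0.
have sq0 : 0 < Num.sqrt q by rewrite sqrtr_gt0.
have sQ0 : 0 < Num.sqrt (q + 2 * h) by rewrite sqrtr_gt0.
apply: le_trans (gsign_tangent_scale q0 Q0 r0 r'0) _; rewrite lerD2l -mulrA -[leRHS]mulrA.
rewrite -[leRHS]mulrA ler_wpM2l//.
have p0 := phi1_gt0 (r / Num.sqrt q); have hK0 : 0 <= h * K by rewrite mulr_ge0 ?ltW.
have sle : (1 + h * K) * Num.sqrt q <= Num.sqrt (q + 2 * h).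
  rewrite -(ler_pXn2r (n := 2)) ?nnegrE ?sqrtr_ge0//; last by rewrite mulr_ge0 ?sqrtr_ge0// addr_ge0.
  rewrite exprMn !sqr_sqrtr ?(ltW q0) ?(ltW Q0)//.
  have -> : (1 + h * K) ^+ 2 * q = q + h * (q * (2 * K)) + h * (h * K) * (q * K) by ring.
  have e1 : h * (q * (2 * K)) <= h by rewrite ler_piMr// ltW.
  have qK1 : q * K <= 1 / 2 by move: qK; rewrite mulrCA; clear; lra.
  have e2 : h * (h * K) * (q * K) <= h * (1 / 2).
    apply: ler_pM => //; first by rewrite mulr_ge0// ltW.
      by rewrite mulr_ge0 ?ltW.
    by rewrite ler_piMr// ltW.
  by move: e1 e2 h0; clear; lra.
have e1 : r' / Num.sqrt (q + 2 * h) <= r / Num.sqrt q + h * delta / Num.sqrt q.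
  rewrite ler_pdivrMr//; apply: le_trans Hr _.
  rewrite -mulrDl -mulrA (mulrC (_^-1)).
  apply: (@le_trans _ _ ((r + h * delta) * (1 + h * K))).
    by rewrite mulrDl lerD2l ler_peMr ?mulr_ge0 ?(ltW h0)// lerDl.
  by rewrite ler_wpM2l ?addr_ge0 ?mulr_ge0 ?(ltW h0)// ler_pdivlMr.
apply: (@le_trans _ _ (phi1 (r / Num.sqrt q) * (h * delta / Num.sqrt q))).
  by rewrite ler_wpM2l ?(ltW p0)//; move: e1; clear; lra.
have -> : delta * (h / Num.sqrt q) = h * delta / Num.sqrt q by ring.
rewrite ler_wpM2r ?divr_ge0 ?mulr_ge0 ?(ltW h0) ?(ltW sq0)//.
by apply: phi1_le; rewrite normr0.
Qed.

(** Sums the price of smoothing: the terms, singular at small times, are dominated by increments of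
    a square root and telescope to a quantity bounded over a fixed time. *)
Lemma sqrt_increment (h : R) (j : nat) : 0 < h ->
  h / Num.sqrt (2 * h * j.+1%:R) <= Num.sqrt (2 * h * j.+1%:R) - Num.sqrt (2 * h * j%:R).
Proof.
move=> h0; set a := Num.sqrt (2 * h * j.+1%:R); set b := Num.sqrt _.
have h20 : 0 < 2 * h by rewrite mulr_gt0.
have a0 : 0 < a by rewrite sqrtr_gt0 mulr_gt0.
have a2 : a ^+ 2 = 2 * h * j%:R + 2 * h.
  by rewrite sqr_sqrtr ?mulr_ge0 ?(ltW h0)// -[j.+1%:R]natr1 mulrDr mulr1.
have b2 : b ^+ 2 = 2 * h * j%:R by rewrite sqr_sqrtr// mulr_ge0// ltW.
rewrite ler_pdivrMr//; have := sqr_ge0 (a - b).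
have -> : (a - b) ^+ 2 = 2 * ((a - b) * a) - (a ^+ 2 - b ^+ 2) by ring.
by rewrite a2 b2; move: ((a - b) * a) (2 * h * j%:R); clear; move=> *; lra.
Qed.

End contraction.

(** * Comparing two recursions over many steps *)

Section backward_phases.
Context {R : realType} {d : nat} (gamma : probability 'rV[R]_d R) (h : R)
  (b b' : R -> 'rV[R]_d -> 'rV[R]_d) (kap : R -> R) (Lb : R) (g : 'rV[R]_d -> R) (n : nat).
Hypotheses (h0 : 0 < h) (gl : gaussian_law (Num.sqrt h) gamma) (Lb0 : 0 <= Lb)
  (bL : forall s, 0 <= s -> forall z z', enorm (b s z - b s z') <= Lb * enorm (z - z'))
  (b'L : forall s, 0 <= s -> forall z z', enorm (b' s z - b' s z') <= Lb * enorm (z - z'))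
  (bk : forall s, 0 <= s -> forall z z',
     dotp (z - z') (b s z - b s z') <= kap (enorm (z - z')) * enorm (z - z') ^+ 2)
  (Lg : R) (Lg0 : 0 <= Lg) (gL : elip Lg g) (Mg : R) (gM : forall z, `|g z| <= Mg).

Let U := backward gamma h b g n.
Let V := backward gamma h b' g n.

(** [r'] is the distance of the two points after the drift, kept abstract so that a scalar
    inequality can be applied to it. *)
Lemma backward_step_le j a c q beta delta z w : 0 <= a -> 0 <= c -> 0 <= q ->
  (forall z w, U j z - V j w <= a * enorm (z - w) + c * gsign q (enorm (z - w)) + beta) ->
  (forall z, enorm (b ((n - j.+1)%:R * h) z - b' ((n - j.+1)%:R * h) z) <= delta) ->
  exists2 r' : R, 0 <= r' /\
    r' <= enorm (z - w) * (1 + (h * kap (enorm (z - w)) + h ^+ 2 * Lb ^+ 2 / 2)) + h * delta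
    & U j.+1 z - V j.+1 w <= a * r' + c * gsign (q + 4 * h) r' + beta.
Proof.
move=> a0 c0 q0 uv hd; set s := (n - j.+1)%:R * h in hd *.
have s0 : 0 <= s by rewrite mulr_ge0// ltW.
have [u1 u2] := backward_elip gamma n j Lg0 (ltW h0) Lb0 bL gL gM.
have [v1 v2] := backward_elip gamma n j Lg0 (ltW h0) Lb0 b'L gL gM.
exists (enorm (z + h *: b s z - (w + h *: b' s w))); last first.
  exact: (comparison_step (b s) (b' s) z w h0 q0 gl (elip_bmf u1 u2) (elip_bmf v1 v2) uv).
split; first exact: enorm_ge0.
exact: (drift_step_dist (ltW h0) Lb0 (bk s0 z w) (bL s0 z w) (hd w)).
Qed.

(** A Duhamel estimate after [J0] initial steps. Step [j] looks at time [(n - J0 - j - 1) * h], so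
    the source grows like [x ^- j] while the factor in front decays like [x ^+ (2 * j)]; the product
    is geometric with ratio [x] and sums to a multiple of [1 - x ^+ j]. With equal rates the sum
    would grow linearly in [j]. *)
Lemma backward_contraction (eps q c M D : R) (J0 : nat) (alpha beta : R) :
  0 <= eps -> 0 <= q -> 0 < c -> 0 <= M -> 0 <= D -> 0 <= alpha ->
  (forall r r' delta : R, 0 <= r -> 0 <= r' -> 0 <= delta ->
    r' <= r * (1 + (h * kap r + h ^+ 2 * Lb ^+ 2 / 2)) + h * delta ->
    eps * r' + gsign (q + 4 * h) r' <=
      (1 - c * 2 * h) * (eps * r + gsign q r) + h * delta * M) ->
  (forall s, 0 <= s -> s <= n%:R * h -> forall z,
     enorm (b s z - b' s z) <= D * expR (- (c * s))) ->
  (forall z w, U J0 z - V J0 w <=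
     alpha * (eps * enorm (z - w) + gsign q (enorm (z - w))) + beta) ->
  let x := expR (- (c * h)) in
  let S := D * M * (expR (c * h) ^+ 2 / c) * expR (- (c * ((n - J0)%:R * h))) in
  forall j, (J0 + j <= n)%N -> forall z w, U (J0 + j) z - V (J0 + j) w <=
    alpha * x ^+ (2 * j) * (eps * enorm (z - w) + gsign q (enorm (z - w))) +
    (beta + alpha * S * (1 - x ^+ j)).
Proof.
move=> e0 q0 c0 M0 D0 al0 contr bb' start x S; elim=> [|j IH] jn z w.
  by rewrite addn0 muln0 expr0 mulr1 subrr mulr0 addr0; exact: start.
rewrite addnS in jn *.
have x0 : 0 < x by exact: expR_gt0.
have ax0 : 0 <= alpha * x ^+ (2 * j) by rewrite mulr_ge0// exprn_ge0// ltW.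
set s := (n - (J0 + j).+1)%:R * h.
have s0 : 0 <= s by rewrite mulr_ge0// ltW.
have sn : s <= n%:R * h by rewrite ler_wpM2r ?(ltW h0)// ler_nat leq_subr.
have IH' z0 w0 : U (J0 + j) z0 - V (J0 + j) w0 <=
    alpha * x ^+ (2 * j) * eps * enorm (z0 - w0) + alpha * x ^+ (2 * j) * gsign q (enorm (z0 - w0)) +
    (beta + alpha * S * (1 - x ^+ j)).
  by apply: le_trans (IH (ltnW jn) z0 w0) _; rewrite [_ * (_ + gsign _ _)]mulrDr mulrA.
have [r' [r'0 Hr] Hs] := backward_step_le z w (mulr_ge0 ax0 e0) ax0 q0 IH' (bb' s s0 sn).
apply: le_trans Hs _; move: Hr; set r := enorm (z - w) => Hr.
have r0 : 0 <= r by exact: enorm_ge0.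
set dl := D * expR _ in Hr.
have dl0 : 0 <= dl by rewrite mulr_ge0// expR_ge0.
have C := contr r r' dl r0 r'0 dl0 Hr.
have F0 : 0 <= eps * r + gsign q r by rewrite addr_ge0 ?mulr_ge0 ?gsign_ge0.
have x2 : 1 - c * 2 * h <= x ^+ 2.
  rewrite /x -expRM_natl; apply: le_trans (expR_ge1Dx _).
  by rewrite [X in _ <= 1 + X](_ : _ = - (c * 2 * h)); last by ring.
have ex : expR (c * h) * x = 1 by rewrite /x -expRD subrr expR0.
(* One factor [expR (c * h)] of [S] comes from this inequality, which trades [c * h] for [1 - x];
   the other appears in [dx], because the drift is taken at the left end of the time step. *)
have x1 : c * h * x <= 1 - x.
  have := ler_wpM2l (ltW x0) (expR_ge1Dx (c * h)); rewrite (mulrC x (expR _)) ex mulrDr mulr1 (mulrC x (c * h)).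
  by rewrite lerBrDr addrC.
have dx : dl * x ^+ j = D * expR (- (c * ((n - J0)%:R * h))) * expR (c * h).
  rewrite /dl /s /x -expRM_natl -!mulrA -!expRD; congr (_ * expR _).
  have -> : (n - (J0 + j).+1)%:R = (n - J0)%:R - j%:R - 1 :> R.
    rewrite (natrB _ jn) (natrB _ (leq_trans (leq_addr j J0) (ltnW jn))).
    by rewrite -[(J0 + j).+1%:R]natr1 natrD; ring.
  by ring.
have xj0 : 0 <= x ^+ j by rewrite exprn_ge0// ltW.
have SE : S = D * M * (expR (c * h) ^+ 2 / c) * expR (- (c * ((n - J0)%:R * h))) by [].
have key : x ^+ (2 * j) * (h * dl * M) <= S * (x ^+ j - x ^+ j.+1).
  have -> : x ^+ (2 * j) * (h * dl * M) = h * M * x ^+ j * (dl * x ^+ j).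
    by rewrite mulnC muln2 -addnn exprD; ring.
  have ic : c^-1 * c = 1 by rewrite mulVf// gt_eqF.
  have e1 : 0 <= expR (c * h) by exact: expR_ge0.
  have e2 : 0 <= expR (- (c * ((n - J0)%:R * h))) by exact: expR_ge0.
  rewrite dx SE (exprSr x j).
  move: ex x1 ic (x ^+ j) xj0 e1 e2.
  move: (expR (c * h)) (expR (- (c * ((n - J0)%:R * h)))) (x) => E1 E2 x' ex x1 ic X xj0 e1 e2.
  have -> : h * M * X * (D * E2 * E1) = M * X * (D * E2) * (E1 ^+ 2 / c) * (c * h * x').
    have -> : M * X * (D * E2) * (E1 ^+ 2 / c) * (c * h * x') =
      h * M * X * (D * E2 * E1) * (E1 * x') * (c^-1 * c) by ring.
    by rewrite ex ic !mulr1.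
  have -> : D * M * (E1 ^+ 2 / c) * E2 * (X - X * x') = M * X * (D * E2) * (E1 ^+ 2 / c) * (1 - x').
    by ring.
  apply: ler_wpM2l x1.
  by rewrite !mulr_ge0 ?invr_ge0 ?exprn_ge0// ltW.
have k1 := ler_wpM2l ax0 C.
have k2 := ler_wpM2r F0 x2.
have k3 := ler_wpM2l al0 key.
have k4 : alpha * x ^+ (2 * j) * ((1 - c * 2 * h) * (eps * r + gsign q r)) <=
    alpha * x ^+ (2 * j.+1) * (eps * r + gsign q r).
  have -> : alpha * x ^+ (2 * j.+1) * (eps * r + gsign q r) =
      alpha * x ^+ (2 * j) * (x ^+ 2 * (eps * r + gsign q r)).
    by rewrite mulnS addnC exprD; ring.
  exact: ler_wpM2l ax0 _ _ k2.
apply: (@le_trans _ _ (alpha * x ^+ (2 * j) * (eps * r' + gsign (q + 4 * h) r') + (beta + alpha * S * (1 - x ^+ j)))).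
  by rewrite [_ * (_ + gsign _ _)]mulrDr mulrA.
rewrite [alpha * S * (1 - x ^+ j.+1)](_ : _ = alpha * S * (1 - x ^+ j) + alpha * (S * (x ^+ j - x ^+ j.+1))); last by ring.
rewrite [_ * (_ + h * dl * M)]mulrDr in k1.
rewrite (mulrA alpha (x ^+ (2 * j))) in k3.
move: k1 k3 k4.
move: (alpha * x ^+ (2 * j) * (eps * r' + gsign (q + 4 * h) r')).
move: (alpha * x ^+ (2 * j) * ((1 - c * 2 * h) * (eps * r + gsign q r))) (alpha * x ^+ (2 * j) * (h * dl * M)).
move: (alpha * (S * (x ^+ j - x ^+ j.+1))) (alpha * x ^+ (2 * j.+1) * (eps * r + gsign q r)) (alpha * S * (1 - x ^+ j)).
clear -h0 gl Lb0 bL b'L bk Lg0 gL gM U V; move=> *; lra.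
Qed.

(** Of the variance [4 * h] gained per step, [2 * h] is kept and [2 * h] offsets the expansion by
    the drift. The start [gsign 0 = sg] bounds a difference of values in [0, 1] at distinct points,
    so the Lipschitz constant of [g] does not enter the bound. The slack 1 in [K - 1] covers the
    term [h * Lb ^+ 2 / 2]. *)
Lemma backward_smoothing (K delta : R) (m : nat) : 0 < K -> 0 <= delta ->
  (forall r, 0 <= r -> kap r <= K - 1) -> h * Lb ^+ 2 <= 1 -> h * K <= 1 ->
  2 * h * m%:R * (2 * K) <= 1 -> (m <= n)%N ->
  (forall z, 0 <= g z <= 1) ->
  (forall s, (n - m)%:R * h <= s -> s <= n%:R * h -> forall z, enorm (b s z - b' s z) <= delta) ->
  forall j, (j <= m)%N -> forall z w, U j z - V j w <=
    gsign (2 * h * j%:R) (enorm (z - w)) + 2 * phi1 (0 : R) * delta * Num.sqrt (2 * h * j%:R).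
Proof.
move=> K0 d0 kK hL hK mK mn g01 bb'; elim=> [|j IH] jm z w.
  rewrite mulr0 sqrtr0 mulr0 addr0 gsign0 /U /V /=.
  have [->|zw] := eqVneq z w; first by rewrite !subrr enorm0 sgr0.
  rewrite gtr0_sg; last first.
    rewrite lt_neqAle enorm_ge0 andbT eq_sym; apply: contra zw => /eqP/enorm_eq0/eqP.
    by rewrite subr_eq0.
  by have := g01 z; have := g01 w; move: (g z) (g w); clear -h0 gl Lb0 bL b'L bk Lg0 gL gM U V; move=> *; lra.
set s := (n - j.+1)%:R * h.
have s1 : (n - m)%:R * h <= s by rewrite ler_wpM2r ?(ltW h0)// ler_nat leq_sub2l.
have sn : s <= n%:R * h by rewrite ler_wpM2r ?(ltW h0)// ler_nat leq_subr.
have q0 : 0 <= 2 * h * j%:R by rewrite mulr_ge0// mulr_ge0// ltW.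
have IH' z0 w0 : U j z0 - V j w0 <= 0 * enorm (z0 - w0) + 1 * gsign (2 * h * j%:R) (enorm (z0 - w0)) +
    2 * phi1 (0 : R) * delta * Num.sqrt (2 * h * j%:R).
  by rewrite mul0r add0r mul1r; exact: IH (ltnW jm) z0 w0.
have [r' [r'0 Hr] Hs] := backward_step_le z w (lexx 0) ler01 q0 IH' (bb' s s1 sn).
apply: le_trans Hs _; rewrite mul0r add0r mul1r; move: Hr; set r := enorm (z - w) => Hr.
have r0 : 0 <= r by exact: enorm_ge0.
have Hr' : r' <= r * (1 + h * K) + h * delta.
  apply: le_trans Hr _; rewrite lerD2r ler_wpM2l// lerD2l.
  have -> : h * kap r + h ^+ 2 * Lb ^+ 2 / 2 = h * (kap r + h * Lb ^+ 2 / 2) by ring.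
  rewrite ler_wpM2l ?(ltW h0)//; have := kK r r0; move: hL; clear -h0 gl Lb0 bL b'L bk Lg0 gL gM U V; move: (kap r) (h * Lb ^+ 2) => *; lra.
(* The parameter after the step, positive even for [j = 0], where the old one vanishes; reflection
   has produced [Q + 2 * h]. *)
pose Q := 2 * h * j.+1%:R.
have Q0 : 0 < Q by rewrite !mulr_gt0.
have QK : Q * (2 * K) <= 1.
  apply: le_trans mK; rewrite ler_wpM2r ?mulr_ge0 ?(ltW K0)//.
  by rewrite ler_wpM2l ?mulr_ge0 ?(ltW h0)// ler_nat.
have := gsign_smoothing K0 Q0 h0 hK QK r0 r'0 d0 Hr'.
have -> : Q + 2 * h = 2 * h * j%:R + 4 * h by rewrite /Q -[j.+1%:R]natr1; ring.
have := ler_wpM2l (mulr_ge0 (mulr_ge0 (ler0n R 2) (ltW (phi1_gt0 (0 : R)))) d0) (sqrt_increment j h0).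
rewrite -/Q mulrBr.
move: (gsign _ r') (gsign Q r) (2 * phi1 0 * delta * (h / Num.sqrt Q)).
move: (2 * phi1 0 * delta * Num.sqrt Q) (2 * phi1 0 * delta * Num.sqrt (2 * h * j%:R)).
clear -h0 gl Lb0 bL b'L bk Lg0 gL gM U V; move=> *; lra.
Qed.

End backward_phases.

(** * From recursions to the two flows *)

Lemma clip_lipschitz {R : realType} (N a b : R) :
  `|Num.max (- N) (Num.min N a) - Num.max (- N) (Num.min N b)| <= `|a - b|.
Proof.
rewrite ler_norml /Num.max /Num.min; have := ler_norm (a - b); have := ler_norm (b - a).
rewrite distrC; move: `|a - b| => c h1 h2.
by do 4 case: ifPn; rewrite -?leNgt => *; apply/andP; split; lra.
Qed.

(** Euler flows are tested on bounded functions, whereas the coordinates of [theta] are only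
    Lipschitz and integrable. Clipping at [N] keeps the Lipschitz constant, and dominated
    convergence removes the clipping. *)
Lemma elip_law_le {R : realType} {d : nat} (mu nu : probability 'rV[R]_d R)
    (L beta : R) (g : 'rV[R]_d -> R) :
  elip L g -> mu.-integrable setT (EFin \o g) -> nu.-integrable setT (EFin \o g) ->
  (forall g' (M : R), elip L g' -> (forall z, `|g' z| <= M) ->
     \int[mu]_y g' y - \int[nu]_y g' y <= beta) ->
  \int[mu]_y g y - \int[nu]_y g y <= beta.
Proof.
move=> gL imu inu H; pose G (N : nat) z := Num.max (- (N%:R : R)) (Num.min N%:R (g z)).
have GL N : elip L (G N) by move=> z w; apply: le_trans (clip_lipschitz _ _ _) (gL z w).
have GM N z : `|G N z| <= N%:R.
  have N0 : 0 <= N%:R :> R by [].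
  by rewrite ler_norml /G le_max lexx ge_max ge_min lexx (ge0_cp N0).
have Gg N z : `|G N z| <= `|g z|.
  have N0 : 0 <= N%:R :> R by [].
  rewrite /G ler_norml /Num.max /Num.min; have := ler_norm (g z); have := ler_norm (- g z).
  rewrite normrN; move: `|g z| N0; move: (N%:R : R) => n c n0 h1 h2.
  by do 2 case: ifPn; rewrite -?leNgt => *; apply/andP; split; lra.
have cv (P : probability 'rV[R]_d R) : P.-integrable setT (EFin \o g) ->
    (\int[P]_y G n y) @[n --> \oo] --> \int[P]_y g y.
  move=> ig; apply: fine_cvg; rewrite fineK; last exact: integrable_fin_num ig.
  apply: (@dominated_cvg _ _ _ P setT measurableT (fun n => EFin \o G n) (EFin \o g)
    (fun z => `|g z|%:E)).
  - by move=> n; apply/measurable_EFinP; exact: elip_measurable (GL n).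
  - move=> z _; apply: cvg_EFin; first exact: nearW.
    apply: cvg_near_cst.
    exists (Num.truncn `|g z|).+1 => // n /= nN; apply/eqP.
    have gn : `|g z| <= n%:R.
      apply: ltW; apply: lt_le_trans (truncnS_gt _) _; by rewrite ler_nat.
    by move: gn; rewrite ler_norml /G => /andP[g1 g2]; rewrite min_r// max_r.
  - by [].
  - exact: integrable_abse ig.
  - by move=> n z _; rewrite lee_fin Gg.
have cB : (\int[mu]_y G n y - \int[nu]_y G n y) @[n --> \oo] --> \int[mu]_y g y - \int[nu]_y g y.
  by apply: cvgB; exact: cv.
refine (ler_cvg_to cB (cvg_cst beta) _); apply: nearW => n.
exact: H _ _ (GL n) (GM n).
Qed.

Lemma small_step {R : realType} (t h : R) (N : nat) : 0 < t -> 0 < h ->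
  exists2 n : nat, (N < n)%N & t / n%:R < h.
Proof.
move=> t0 h0; exists (maxn N (Num.truncn (t / h))).+1; first by rewrite ltnS leq_maxl.
rewrite ltr_pdivrMr// mulrC -ltr_pdivrMr//; apply: lt_le_trans (truncnS_gt _) _.
by rewrite ler_nat ltnS leq_maxr.
Qed.

Lemma expR_sqr_le2 {R : realType} (x : R) : 4 * x <= 1 -> expR x ^+ 2 <= 2.
Proof.
move=> x4; have e0 := expR_gt0 (x + x); rewrite expr2 -expRD.
have : expR (x + x) * (1 - (x + x)) <= expR (x + x) * expR (- (x + x)).
  by rewrite ler_wpM2l ?(ltW e0)//; exact: expR_ge1Dx.
rewrite -expRD subrr expR0.
have : expR (x + x) * (1 / 2) <= expR (x + x) * (1 - (x + x)).
  by rewrite ler_wpM2l ?(ltW e0)//; lra.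
by move: (expR (x + x)) (expR (x + x) * (1 - (x + x))) => a b; lra.
Qed.

Section two_flows.
Context {R : realType} {d : nat} (eta : 'rV[R]_d -> 'rV[R]_d)
  (theta : 'rV[R]_d -> 'rV[R]_d -> 'rV[R]_d) (tau Lt Lb : R) (kap : R -> R)
  (eps q c M h1 : R) (x y : 'rV[R]_d) (mu nu : R -> probability 'rV[R]_d R).
Let b s := mean_field_drift eta theta tau (mu s).
Let b' s := mean_field_drift eta theta tau (nu s).
Hypotheses (Lt0 : 0 <= Lt) (Lb0 : 0 <= Lb)
  (thetaL : forall z i, elip Lt (fun w => theta z w 0 i))
  (bL : forall s, 0 <= s -> forall z z', enorm (b s z - b s z') <= Lb * enorm (z - z'))
  (b'L : forall s, 0 <= s -> forall z z', enorm (b' s z - b' s z') <= Lb * enorm (z - z'))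
  (bk : forall s, 0 <= s -> forall z z',
     dotp (z - z') (b s z - b s z') <= kap (enorm (z - z')) * enorm (z - z') ^+ 2)
  (Fmu : euler_flow eta theta tau Lt x mu) (Fnu : euler_flow eta theta tau Lt y nu)
  (eps0 : 0 < eps) (q0 : 0 < q) (c0 : 0 < c) (M0 : 0 < M) (h10 : 0 < h1)
  (contr : forall h r r' delta : R, 0 < h -> h <= h1 -> 0 <= r -> 0 <= r' -> 0 <= delta ->
    r' <= r * (1 + (h * kap r + h ^+ 2 * Lb ^+ 2 / 2)) + h * delta ->
    eps * r' + gsign (q + 4 * h) r' <=
      (1 - c * 2 * h) * (eps * r + gsign q r) + h * delta * M).

Let f (r : R) := eps * r + gsign q r.

Let f_ge r : 0 <= r -> eps * r <= f r.
Proof. by move=> r0; rewrite lerDl gsign_ge0. Qed.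

Let f_ge0 r : 0 <= r -> 0 <= f r.
Proof. by move=> r0; apply: le_trans (f_ge r0); rewrite mulr_ge0// ltW. Qed.

Lemma flow_approx (g : 'rV[R]_d -> R) (L Mg e t : R) : 0 <= L -> 0 < e -> 0 < t ->
  elip L g -> (forall z, `|g z| <= Mg) ->
  exists h0 : R, 0 < h0 /\ forall n : nat, (0 < n)%N -> t / n%:R < h0 ->
  exists2 gamma : probability 'rV[R]_d R, gaussian_law (Num.sqrt (t / n%:R)) gamma &
  \int[mu t]_z g z - \int[nu t]_z g z <=
    backward gamma (t / n%:R) b g n n x - backward gamma (t / n%:R) b' g n n y + e.
Proof.
move=> L0 e0 t0 gL gM; have e20 : 0 < e / 2 by rewrite divr_gt0.
have [ha [ha0 Ha]] := backward_error Fmu t0 L0 Lb0 e20 bL gL gM.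
have [hb [hb0 Hb]] := backward_error Fnu t0 L0 Lb0 e20 b'L gL gM.
exists (Num.min ha hb); split; first by rewrite lt_min ha0.
move=> n n0; rewrite lt_min => /andP[nha nhb].
have n0' : 0 < n%:R :> R by rewrite ltr0n.
have h0 : 0 < t / n%:R by rewrite divr_gt0.
have nt : n%:R * (t / n%:R) = t by rewrite mulrC divfK// gt_eqF.
have nt' : n%:R * (t / n%:R) <= t by rewrite nt.
have [_ _ _ _ /(_ _ h0)[gamma gl]] := Fmu; exists gamma => //.
have := Ha _ n h0 nha nt' gamma gl; have := Hb _ n h0 nhb nt' gamma gl; rewrite nt.
move: (\int[mu t]_z g z) (\int[nu t]_z g z) (backward _ _ b _ _ _ _) (backward _ _ _ _ _ _ _).
move=> A B U V; rewrite !ler_norml => /andP[? ?] /andP[? ?]; lra.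
Qed.

(** Contraction from a Lipschitz start, [L * r <= L / eps * f r], without smoothing. The horizon [T]
    is explicit because, until the feedback loop is closed, a drift gap of this form is known on
    bounded time intervals only. *)
Lemma flow_gap (D T t L Mg : R) (g : 'rV[R]_d -> R) : 0 <= D -> 0 <= t -> t <= T ->
  (forall s, 0 <= s -> s <= T -> forall z, enorm (b s z - b' s z) <= D * expR (- (c * s))) ->
  0 <= L -> elip L g -> (forall z, `|g z| <= Mg) ->
  \int[mu t]_z g z - \int[nu t]_z g z <=
    L / eps * (f (enorm (x - y)) + 2 * M * D / c) * expR (- (c * t)).
Proof.
move=> D0 t0 tT bb' L0 gL gM; have bg := elip_bmf gL gM.
have r0 := enorm_ge0 (x - y); have Le0 : 0 <= L / eps by rewrite divr_ge0// ltW.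
have start z w : g z - g w <= L / eps * f (enorm (z - w)).
  apply: le_trans (ler_norm _) (le_trans (gL z w) _).
  have := ler_wpM2l Le0 (f_ge (enorm_ge0 (z - w))); apply: le_trans.
  by rewrite mulrA divfK ?gt_eqF.
have MD0 : 0 <= 2 * M * D / c by rewrite !mulr_ge0 ?invr_ge0// ltW.
move: t0; rewrite le_eqVlt => /orP[/eqP t0|t0].
  have [_ _ smu _ _] := Fmu; have [_ _ snu _ _] := Fnu.
  rewrite -t0 smu// snu// mulr0 oppr0 expR0 mulr1; apply: le_trans (start x y) _.
  by rewrite ler_wpM2l// lerDl.
apply/ler_addgt0Pr => e e0.
have [ha [ha0 Ha]] := flow_approx L0 e0 t0 gL gM.
(* [(4 * c)^-1] makes [expR (c * h) ^+ 2] at most 2, whence the 2 in the bound. *)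
have hm0 : 0 < Num.min ha (Num.min h1 (4 * c)^-1).
  by rewrite !lt_min ha0 h10 invr_gt0 mulr_gt0.
have [n n0 hn] := small_step 0 t0 hm0.
have n0' : 0 < n%:R :> R by rewrite ltr0n.
move: hn; rewrite !lt_min => /and3P[nha nh1 nh4].
have [gamma gl H] := Ha n n0 nha; apply: le_trans H _; rewrite lerD2r.
set h := t / n%:R in gl nh1 nh4 *.
have h0 : 0 < h by rewrite divr_gt0.
have nt : n%:R * h = t by rewrite mulrC divfK// gt_eqF.
have bb'n s : 0 <= s -> s <= n%:R * h -> forall z, enorm (b s z - b' s z) <= D * expR (- (c * s)).
  by move=> s0; rewrite nt => st; apply: bb' => //; exact: le_trans st tT.
have start0 z w : backward gamma h b g n 0 z - backward gamma h b' g n 0 w <=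
    L / eps * (eps * enorm (z - w) + gsign q (enorm (z - w))) + 0.
  by rewrite addr0; exact: start.
have cn r r' delta : 0 <= r -> 0 <= r' -> 0 <= delta ->
    r' <= r * (1 + (h * kap r + h ^+ 2 * Lb ^+ 2 / 2)) + h * delta ->
    eps * r' + gsign (q + 4 * h) r' <=
      (1 - c * 2 * h) * (eps * r + gsign q r) + h * delta * M.
  by apply: contr => //; exact: ltW.
have := backward_contraction h0 gl Lb0 bL b'L bk L0 gL gM (ltW eps0) (ltW q0) c0 (ltW M0) D0 Le0 cn bb'n start0.
move=> /(_ n); rewrite add0n leqnn => /(_ isT x y).
rewrite subn0 nt add0r => Hn; apply: le_trans Hn _; rewrite -/(f _).
have xn : expR (- (c * h)) ^+ n = expR (- (c * t)).
  by rewrite -expRM_natl mulrN mulrCA nt.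
have E0 := expR_gt0 (- (c * t)).
have E1 : expR (- (c * t)) <= 1 by rewrite -expR0 ler_expR oppr_le0 mulr_ge0 ?(ltW c0) ?(ltW t0).
have e2 : expR (c * h) ^+ 2 <= 2.
  apply: expR_sqr_le2; rewrite mulrA mulrC -ler_pdivlMr ?mulr_gt0// div1r; exact: ltW.
rewrite mulnC exprM xn.
have f0 := f_ge0 r0.
have g1 : expR (- (c * t)) ^+ 2 * f (enorm (x - y)) <= expR (- (c * t)) * f (enorm (x - y)).
  by rewrite ler_wpM2r// expr2 ler_piMr// ltW.
have g2 : D * M * (expR (c * h) ^+ 2 / c) * expR (- (c * t)) * (1 - expR (- (c * t))) <=
    2 * M * D / c * expR (- (c * t)).
  have P0 : 0 <= D * M * (expR (c * h) ^+ 2 / c) * expR (- (c * t)).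
    by rewrite !mulr_ge0 ?invr_ge0 ?exprn_ge0 ?expR_ge0// ltW.
  apply: (@le_trans _ _ (D * M * (expR (c * h) ^+ 2 / c) * expR (- (c * t)))).
    by rewrite ler_piMr// lerBlDr lerDl ltW.
  rewrite ler_wpM2r ?(ltW E0)//.
  have -> : 2 * M * D / c = D * M * (2 / c) by ring.
  by rewrite ler_wpM2l ?mulr_ge0 ?(ltW M0)// ler_wpM2r ?invr_ge0 ?(ltW c0).
have H := ler_wpM2l Le0 (lerD g1 g2).
apply: le_trans (le_trans _ H) _; last first.
  rewrite le_eqVlt; apply/orP; left; apply/eqP.
  move: (expR (- (c * t))) (f _) (2 * M * D / c) (L / eps) => E F G A; ring.
rewrite le_eqVlt; apply/orP; left; apply/eqP.
move: (expR (- (c * t))) (f _) (expR (c * h) ^+ 2 / c) (L / eps) => E F G A; ring.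
Qed.

Let theta_gap s z i := `|\int[mu s]_w theta z w 0 i - \int[nu s]_w theta z w 0 i|.

Let mui s (s0 : 0 <= s) z i : (mu s).-integrable setT (EFin \o (fun w => theta z w 0 i)).
Proof. by case: Fmu => H _ _ _ _; exact: H. Qed.

Let nui s (s0 : 0 <= s) z i : (nu s).-integrable setT (EFin \o (fun w => theta z w 0 i)).
Proof. by case: Fnu => H _ _ _ _; exact: H. Qed.

(** The constant that [flow_gap] gives for [Lt]-Lipschitz functions when the two drifts coincide. *)
Let A0 := Lt / eps * f (enorm (x - y)).

Hypothesis (tau_small : Lt / eps * (2 * M * (d%:R * `|tau|) / c) <= 1 / 2).

Let A00 : 0 <= A0.
Proof. by rewrite mulr_ge0 ?divr_ge0 ?f_ge0 ?enorm_ge0// ltW. Qed.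

(** The feedback loop: a gap [K] between the mean fields is a drift gap [D = d * |tau| * K], which
    [flow_gap] returns as [A0] plus a multiple of [K] that [tau_small] makes at most [K / 2]. *)
Lemma mean_field_gap_step K T : 0 <= K ->
  (forall s, 0 <= s -> s <= T -> forall z i, theta_gap s z i <= K * expR (- (c * s))) ->
  forall s, 0 <= s -> s <= T -> forall z i,
    theta_gap s z i <= (A0 + K / 2) * expR (- (c * s)).
Proof.
move=> K0 HK s s0 sT z i.
have bb' u : 0 <= u -> u <= T -> forall w, enorm (b u w - b' u w) <= d%:R * `|tau| * K * expR (- (c * u)).
  move=> u0 uT w; have := mean_field_drift_law eta tau (fun j => HK u u0 uT w j).
  by rewrite !mulrA.
have D0 : 0 <= d%:R * `|tau| * K by rewrite !mulr_ge0.
have bound (g : 'rV[R]_d -> R) Mg : elip Lt g -> (forall w, `|g w| <= Mg) ->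
    \int[mu s]_w g w - \int[nu s]_w g w <= (A0 + K / 2) * expR (- (c * s)).
  move=> gL gM; apply: le_trans (flow_gap D0 s0 sT bb' Lt0 gL gM) _.
  rewrite ler_wpM2r ?expR_ge0// mulrDr lerD2l.
  have := ler_wpM2r K0 tau_small.
  have -> : Lt / eps * (2 * M * (d%:R * `|tau| * K) / c) = Lt / eps * (2 * M * (d%:R * `|tau|) / c) * K.
    by rewrite !mulrA; ring.
  by rewrite div1r (mulrC 2^-1 K).
have h1' := elip_law_le (thetaL z i) (mui s0 z i) (nui s0 z i) bound.
(* The bound is one-sided; applied to the negated coordinate as well it yields the absolute
   value. *)
have NL : elip Lt (fun w => - theta z w 0 i).
  by move=> u v; rewrite -opprD normrN; exact: thetaL.
have NI (P : probability 'rV[R]_d R) : P.-integrable setT (EFin \o (fun w => theta z w 0 i)) ->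
    P.-integrable setT (EFin \o (fun w => - theta z w 0 i)) /\
    \int[P]_w (- theta z w 0 i) = - \int[P]_w theta z w 0 i.
  move=> ii; split; first exact: (integrableN ii).
  rewrite -[RHS]mulN1r -(RintegralZl (-1) measurableT ii).
  by apply: eq_Rintegral => w _; rewrite mulN1r.
have [i1 e1] := NI _ (mui s0 z i); have [i2 e2] := NI _ (nui s0 z i).
have h2' := elip_law_le NL i1 i2 bound; rewrite e1 e2 opprK addrC in h2'.
by rewrite /theta_gap ler_norml h1' andbT lerNl opprB.
Qed.

(** [2 * A0] is the fixed point of the map [K] to [A0 + K / 2], and iterating this map gives
    [2 * A0 + K0 / 2 ^+ n]. The initial [K0] depends on the horizon, the limit does not. *)
Lemma mean_field_gap s z i : 0 <= s -> theta_gap s z i <= 2 * A0 * expR (- (c * s)).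
Proof.
move=> s0; pose T := s + 1; have T0 : 0 < T by rewrite ltr_wpDl.
have [_ _ _ /(_ T T0)[C1 H1] _] := Fmu; have [_ _ _ /(_ T T0)[C2 H2] _] := Fnu.
(* The moment bounds of both flows plus the gap between the starting points; [expR (c * T)]
   compensates the decay demanded on [[0, T]]. *)
pose K0 := (`|C1| + `|C2| + Lt * enorm (x - y)) * expR (c * T).
have K00 : 0 <= K0 by rewrite mulr_ge0 ?expR_ge0// addr_ge0 ?addr_ge0 ?mulr_ge0 ?enorm_ge0.
have init u : 0 <= u -> u <= T -> forall w j, theta_gap u w j <= (2 * A0 + K0) * expR (- (c * u)).
  move=> u0 uT w j; apply: (@le_trans _ _ (K0 * expR (- (c * u)))); last first.
    by rewrite ler_wpM2r ?expR_ge0// lerDr mulr_ge0.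
  rewrite /K0 -mulrA -expRD.
  have e1 : 1 <= expR (c * T + - (c * u)).
    by rewrite -expR0 ler_expR subr_ge0 ler_wpM2l// ltW.
  apply: (@le_trans _ _ (`|C1| + `|C2| + Lt * enorm (x - y))); last first.
    by rewrite ler_peMr// addr_ge0 ?addr_ge0 ?mulr_ge0 ?enorm_ge0.
  have uu : 0 <= u <= T by rewrite u0.
  have := H1 u uu _ (thetaL w j) (mui u0 w j); have := H2 u uu _ (thetaL w j) (nui u0 w j).
  have := thetaL w j x y; rewrite /theta_gap.
  move: (\int[mu u]_v _) (\int[nu u]_v _) => a a'.
  have := ler_norm C1; have := ler_norm C2.
  move: (`|C1|) (`|C2|) (theta w x 0 j) (theta w y 0 j) (Lt * _) => n1 n2 t1 t2 l k1 k2.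
  by rewrite !ler_norml => /andP[? ?] /andP[? ?] /andP[? ?]; apply/andP; split; lra.
have iter n u : 0 <= u -> u <= T -> forall w j,
    theta_gap u w j <= (2 * A0 + K0 / 2 ^+ n) * expR (- (c * u)).
  elim: n u => [|n IH] u u0 uT w j; first by rewrite expr0 divr1; exact: init.
  have Kn : 0 <= 2 * A0 + K0 / 2 ^+ n.
    exact: addr_ge0 (mulr_ge0 (ler0n R 2) A00) (divr_ge0 K00 (exprn_ge0 n (ler0n R 2))).
  apply: le_trans (mean_field_gap_step Kn IH u0 uT w j) _.
  rewrite ler_wpM2r ?expR_ge0// le_eqVlt; apply/orP; left; apply/eqP.
  by rewrite exprS invfM; field.
have sT : s <= T by rewrite lerDl.
apply/ler_addgt0Pr => e e0; have E0 := expR_gt0 (- (c * s)).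
pose n := (Num.truncn (K0 * expR (- (c * s)) / e)).+1.
apply: le_trans (iter n s s0 sT z i) _; rewrite mulrDl lerD2l mulrAC ler_pdivrMr ?exprn_gt0//.
have : K0 * expR (- (c * s)) / e <= 2 ^+ n.
  apply: le_trans (ltW (truncnS_gt _)) _; rewrite -natrX ler_nat; apply: ltnW; exact: ltn_expl.
by rewrite ler_pdivrMr// [_ * e]mulrC.
Qed.

(** [D] is the drift gap obtained from [mean_field_gap], [2 * phi1 0 / Num.sqrt T0 / eps] the factor
    with which contraction starts after smoothing, the last summand the price of smoothing, and
    [expR (c * T0)] the decay lost during it. *)
Definition gap_constant (T0 : R) : R :=
  let D := d%:R * `|tau| * (2 * A0) in
  expR (c * T0) * (2 * phi1 0 / Num.sqrt T0 / eps * (f (enorm (x - y)) + 2 * M * D / c) +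
    2 * phi1 0 * D * Num.sqrt (2 * T0)).

(** Smoothing acts over the last [T0] and contraction before it; [T0] is the longest time for which
    the smoothing condition [2 * h * m * (2 * K) <= 1] can hold. The bound is free of [L], as total
    variation requires. *)
Lemma lipschitz_gap (K T0 : R) : 1 <= K -> (forall r, 0 <= r -> kap r <= K - 1) ->
  T0 = (4 * K)^-1 ->
  forall t, T0 <= t -> forall (g : 'rV[R]_d -> R) L, elip L g ->
    (forall z, 0 <= g z <= 1) ->
    \int[mu t]_z g z - \int[nu t]_z g z <= gap_constant T0 * expR (- (c * t)).
Proof.
move=> K1 kK T0E; have K0 : 0 < K by apply: lt_le_trans K1.
have T00 : 0 < T0 by rewrite T0E invr_gt0 mulr_gt0.
pose D := d%:R * `|tau| * (2 * A0).
have D0 : 0 <= D := mulr_ge0 (mulr_ge0 (ler0n R d) (normr_ge0 tau)) (mulr_ge0 (ler0n R 2) A00).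
have bb' s : 0 <= s -> forall z, enorm (b s z - b' s z) <= D * expR (- (c * s)).
  move=> s0 z; have := mean_field_drift_law eta tau (fun i => mean_field_gap z i s0).
  by rewrite /D !mulrA.
have p0 := phi1_gt0 (0 : R); have sT0 : 0 < Num.sqrt T0 by rewrite sqrtr_gt0.
have r0 := enorm_ge0 (x - y); have f0 := f_ge0 r0.
pose al := 2 * phi1 0 / Num.sqrt T0 / eps.
have al0 : 0 < al := divr_gt0 (divr_gt0 (mulr_gt0 (ltr0n R 2) p0) sT0) eps0.
pose B := expR (c * T0) * (al * (f (enorm (x - y)) + 2 * M * D / c) +
  2 * phi1 0 * D * Num.sqrt (2 * T0)).
rewrite -[gap_constant T0]/B.
have alE : al = 2 * phi1 0 / Num.sqrt T0 / eps by [].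
clearbody al D.
move=> t T0t g L gL g01; have t0 : 0 < t by apply: lt_le_trans T0t.
have gM z : `|g z| <= 1 by have /andP[? ?] := g01 z; rewrite ger0_norm.
have gL' : elip `|L| g.
  by move=> z w; apply: le_trans (gL z w) _; rewrite ler_wpM2r ?enorm_ge0// ler_norm.
have L0 : 0 <= `|L| by [].
apply/ler_addgt0Pr => e e0.
have [ha [ha0 Ha]] := flow_approx L0 e0 t0 gL' gM.
(* In this order: room for [T0 <= 2 * h * m], then the conditions [h * K <= 1] and
   [h * Lb ^+ 2 <= 1]. *)
pose h2 := Num.min (Num.min (T0 / 2) K^-1) (Lb ^+ 2 + 1)^-1.
have Lb20 : 0 < Lb ^+ 2 + 1 by rewrite ltr_wpDl// sqr_ge0.
have h20 : 0 < h2 by rewrite !lt_min !invr_gt0 divr_gt0// K0 Lb20.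
have hm0 : 0 < Num.min (Num.min ha h2) (Num.min h1 (4 * c)^-1).
  rewrite lt_min; apply/andP; split; first by rewrite lt_min ha0; exact: h20.
  by rewrite lt_min h10 invr_gt0 mulr_gt0.
have [n n0 hn] := small_step 0 t0 hm0.
have n0' : 0 < n%:R :> R by rewrite ltr0n.
move: hn; rewrite !lt_min => /andP[/andP[nha /andP[/andP[nhT nhK] nhL]] /andP[nh1 nh4]].
have [gamma gl H] := Ha n n0 nha; apply: le_trans H _; rewrite lerD2r.
set h := t / n%:R in gl nhT nhK nhL nh1 nh4 *.
have h0 : 0 < h by rewrite divr_gt0.
have nt : n%:R * h = t by rewrite mulrC divfK// gt_eqF.
clearbody h.
(* Rounding down keeps [h * m <= T0], within the range of smoothing, and loses at most half: the
   parameter reached, [2 * h * m], is at least [T0], so the slope is at most that of [gsign T0] at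
   0. *)
pose m := Num.truncn (T0 / h).
have Th0 : 0 <= T0 / h by rewrite divr_ge0// ltW.
have hm1 : h * m%:R <= T0.
  by rewrite mulrC -ler_pdivlMr// /m; have /andP[] := truncn_itv Th0.
have hm2 : T0 <= 2 * h * m%:R.
  have /andP[_] := truncn_itv Th0; rewrite -/m ltr_pdivrMr// -[m.+1%:R]natr1 mulrDl mul1r.
  by move: nhT; rewrite -[2 * h * _]mulrA (mulrC _ h); move: (h * m%:R) => a; lra.
have mn : (m <= n)%N.
  rewrite -(ler_nat R) -(ler_pM2r h0) nt; apply: le_trans T0t; by rewrite mulrC.
have m0 : 0 < m%:R :> R.
  by rewrite lt_neqAle ler0n andbT; apply/eqP => m0; move: hm2; rewrite -m0 mulr0 leNgt T00.
have nm : (n - m)%:R * h = t - h * m%:R by rewrite natrB// mulrBl nt (mulrC h).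
(* Bounds the drift gap throughout the last [T0] by its bound at the beginning of that period. *)
pose dl := D * expR (- (c * (t - T0))).
have dl0 : 0 <= dl by rewrite mulr_ge0 ?expR_ge0.
have hL : h * Lb ^+ 2 <= 1.
  have : h * (Lb ^+ 2 + 1) <= 1 by rewrite -ler_pdivlMr// div1r ltW.
  by apply: le_trans; rewrite mulrDr mulr1 lerDl ltW.
have hK : h * K <= 1 by rewrite -ler_pdivlMr// div1r ltW.
have mK : 2 * h * m%:R * (2 * K) <= 1.
  have -> : 2 * h * m%:R * (2 * K) = h * m%:R * (4 * K) by ring.
  by rewrite -ler_pdivlMr ?mulr_gt0// div1r -T0E.
have bbm s : (n - m)%:R * h <= s -> s <= n%:R * h -> forall z, enorm (b s z - b' s z) <= dl.
  rewrite nm => s1 _ z; have s2 : t - T0 <= s by apply: le_trans s1; rewrite lerD2l lerN2.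
  have s0 : 0 <= s by apply: le_trans s2; rewrite subr_ge0.
  apply: le_trans (bb' s s0 z) _; rewrite ler_wpM2l// ler_expR lerN2 ler_wpM2l ?(ltW c0)//.
have S := backward_smoothing h0 gl Lb0 bL b'L bk L0 gL' gM K0 dl0 kK hL hK mK mn g01 bbm (leqnn m).
pose beta := 2 * phi1 (0 : R) * dl * Num.sqrt (2 * h * m%:R).
have q2 : 0 < 2 * h * m%:R by apply: lt_le_trans hm2.
have start z w : backward gamma h b g n m z - backward gamma h b' g n m w <=
    al * (eps * enorm (z - w) + gsign q (enorm (z - w))) + beta.
  apply: le_trans (S z w) _; rewrite lerD2r; have rr := enorm_ge0 (z - w).
  apply: le_trans (gsign_slope q2 rr) _.
  apply: (@le_trans _ _ (al * (eps * enorm (z - w)))); last first.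
    exact: (ler_wpM2l (ltW al0) (f_ge rr)).
  rewrite alE mulrA divfK ?gt_eqF// ler_wpM2r// ler_wpM2l ?mulr_ge0 ?(ltW p0)//.
  by rewrite lef_pV2 ?posrE ?sqrtr_gt0//; exact: ler_wsqrtr.
have bbn s : 0 <= s -> s <= n%:R * h -> forall z, enorm (b s z - b' s z) <= D * expR (- (c * s)).
  by move=> s0 _; exact: bb'.
have cn r r' delta : 0 <= r -> 0 <= r' -> 0 <= delta ->
    r' <= r * (1 + (h * kap r + h ^+ 2 * Lb ^+ 2 / 2)) + h * delta ->
    eps * r' + gsign (q + 4 * h) r' <=
      (1 - c * 2 * h) * (eps * r + gsign q r) + h * delta * M.
  by apply: contr => //; exact: ltW.
have := backward_contraction h0 gl Lb0 bL b'L bk L0 gL' gM (ltW eps0) (ltW q0) c0 (ltW M0) D0 (ltW al0) cn bbn start.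
move=> /(_ (n - m)%N); rewrite subnKC// leqnn => /(_ isT x y).
move=> Hn; apply: le_trans Hn _; rewrite -/(f _).
set E := expR (- (c * t)).
have E0 : 0 < E by exact: expR_gt0.
have xn : expR (- (c * h)) ^+ (n - m) = expR (- (c * ((n - m)%:R * h))).
  by rewrite -expRM_natl mulrN mulrCA.
have xE : expR (- (c * ((n - m)%:R * h))) <= expR (c * T0) * E.
  by rewrite /E -expRD ler_expR nm mulrBr opprB lerD2r ler_wpM2l// ltW.
have x0 := expR_gt0 (- (c * ((n - m)%:R * h))).
have x1 : expR (- (c * ((n - m)%:R * h))) <= 1.
  by rewrite -expR0 ler_expR oppr_le0 !mulr_ge0 ?(ltW c0) ?(ltW h0).
have e2 : expR (c * h) ^+ 2 / c <= 2 / c.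
  rewrite ler_wpM2r ?invr_ge0 ?(ltW c0)//; apply: expR_sqr_le2.
  by rewrite mulrA mulrC -ler_pdivlMr ?mulr_gt0// div1r; exact: ltW.
have be : beta <= expR (c * T0) * E * (2 * phi1 0 * D * Num.sqrt (2 * T0)).
  have -> : beta = expR (c * T0) * E * (2 * phi1 0 * D * Num.sqrt (2 * h * m%:R)).
    have -> : expR (c * T0) * E = expR (- (c * (t - T0))).
      by rewrite /E -expRD; congr expR; ring.
    by rewrite /beta /dl; ring.
  rewrite ler_wpM2l ?mulr_ge0 ?expR_ge0// ler_wpM2l ?mulr_ge0 ?(ltW p0)//.
  by rewrite ler_wsqrtr// -mulrA ler_wpM2l.
have e20 : 0 <= expR (c * h) ^+ 2 / c by rewrite divr_ge0 ?exprn_ge0 ?expR_ge0// ltW.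
rewrite mulnC exprM xn.
move: (expR (- (c * ((n - m)%:R * h)))) xE x0 x1 => X xE x0 x1.
have g1 : al * X ^+ 2 * f (enorm (x - y)) <= expR (c * T0) * E * (al * f (enorm (x - y))).
  have -> : al * X ^+ 2 * f (enorm (x - y)) = X * X * (al * f (enorm (x - y))) by ring.
  rewrite ler_wpM2r ?mulr_ge0 ?(ltW al0)//; apply: le_trans xE; by rewrite ler_piMr// ltW.
have g2 : al * (D * M * (expR (c * h) ^+ 2 / c) * X) * (1 - X) <=
    expR (c * T0) * E * (al * (2 * M * D / c)).
  apply: (@le_trans _ _ (al * (D * M * (expR (c * h) ^+ 2 / c) * X))).
    rewrite ler_piMr//; last by rewrite lerBlDr lerDl ltW.
    by rewrite mulr_ge0 ?(ltW al0)// mulr_ge0 ?(ltW x0)// mulr_ge0// mulr_ge0// ltW.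
  have -> : al * (D * M * (expR (c * h) ^+ 2 / c) * X) = X * (al * (D * M * (expR (c * h) ^+ 2 / c))) by ring.
  apply: ler_pM => //; [exact: ltW| |].
    by rewrite mulr_ge0 ?(ltW al0)// mulr_ge0// mulr_ge0// ltW.
  rewrite ler_wpM2l ?(ltW al0)//.
  have -> : 2 * M * D / c = D * M * (2 / c) by ring.
  by rewrite ler_wpM2l// mulr_ge0// ltW.
have G := lerD g1 (lerD be g2); apply: le_trans G _.
rewrite le_eqVlt; apply/orP; left; apply/eqP; rewrite /B.
move: (expR (c * T0)) (f _) (2 * M * D / c) (2 * phi1 0 * D * Num.sqrt (2 * T0)) => a1 a2 a3 a4.
by ring.
Qed.

End two_flows.

(** * Assembly: constants and total variation *)

Lemma tv_dist_le {R : realType} {d : nat} (mu nu : probability 'rV[R]_d R) (b : R) :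
  (forall A, measurable A -> fine (mu A) - fine (nu A) <= b) -> (tv_dist mu nu <= b%:E)%E.
Proof.
move=> H; apply: ge_ereal_sup => _ [A mA <-].
have mE (P : probability 'rV[R]_d R) B : measurable B -> P B = (fine (P B))%:E.
  by move=> mB; rewrite fineK// fin_num_measure.
(* The complement of [A] reverses the sign of the difference, which gives the absolute value. *)
have HC := H _ (measurableC mA); rewrite !probability_setC// in HC.
rewrite (mE mu A mA) (mE nu A mA) in HC *; rewrite -EFinB abse_EFin lee_fin.
rewrite ler_norml H// andbT; move: HC => /=.
move: (fine (mu A)) (fine (nu A)) => u v; lra.
Qed.

Lemma kappa_bound {R : realType} (kappa : R -> R) :
  [lipschitz kappa r | r in [set r | 0 <= r]] ->
  (exists a b k : R, k < 0 /\ forall r, 0 <= r -> ~ (a <= r <= b) -> kappa r = k) ->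
  exists K R0 k0 : R, [/\ 0 <= K, 0 <= R0, 0 < k0,
    forall r, 0 <= r -> kappa r <= K & forall r, R0 < r -> kappa r = - k0].
Proof.
move=> [M [_ HM]] [a [b [k [k0 Hk]]]].
have kL r : 0 <= r -> `|kappa r - kappa 0| <= (M + 1) * r.
  (* The Lipschitz property is stated for all constants above [M]; [M + 1] is one of them. *)
  move=> r0; have M1 : M < M + 1 by rewrite ltrDl.
  have := HM (M + 1) M1 (r, 0); rewrite /= subr0 (ger0_norm r0); apply.
  by split; rewrite /= ?lexx.
exists (`|kappa 0| + `|M + 1| * `|b|), `|b|, (- k); split; [by rewrite addr_ge0// mulr_ge0|by []| | |]; last 2 first.
- move=> r r0; case: (pselect (a <= r <= b)) => [/andP[_ rb]|ab]; last first.
    by rewrite (Hk r r0 ab) (le_trans (ltW k0))// addr_ge0// mulr_ge0.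
  have := ler_norm (kappa 0); have := le_trans (ler_norm _) (kL r r0).
  have h1 : (M + 1) * r <= `|M + 1| * r by rewrite ler_wpM2r// ler_norm.
  have h2 : `|M + 1| * r <= `|M + 1| * `|b|.
    by rewrite ler_wpM2l//; exact: le_trans rb (ler_norm b).
  by move: h1 h2; move: (_ * r) (`|M + 1| * r) (`|M + 1| * `|b|) => ? ? ?; lra.
- move=> r br; rewrite opprK; apply: Hk; first exact: le_trans (ltW br).
  by move=> /andP[_ rb]; have := lt_le_trans br rb; rewrite ltNge ler_norm.
- by rewrite oppr_gt0.
Qed.

Lemma elip_row_mx {R : realType} {d : nat} (theta : 'rV[R]_d -> 'rV[R]_d -> 'rV[R]_d) L :
  (forall z z' : 'rV[R]_(d + d), enorm (theta (lsubmx z) (rsubmx z) - theta (lsubmx z') (rsubmx z')) <=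
     L * enorm (z - z')) ->
  (forall x x' y, enorm (theta x y - theta x' y) <= `|L| * enorm (x - x')) /\
  (forall x y y', enorm (theta x y - theta x y') <= `|L| * enorm (y - y')).
Proof.
move=> H.
have E (u v : 'rV[R]_d) : enorm (row_mx u v) ^+ 2 = enorm u ^+ 2 + enorm v ^+ 2.
  rewrite !sqr_enorm /dotp big_split_ord/=; congr (_ + _); apply: eq_bigr => i _.
    by rewrite !row_mxEl.
  by rewrite !row_mxEr.
have El (u : 'rV[R]_d) : enorm (row_mx u (0 : 'rV[R]_d)) = enorm u.
  have := E u 0; rewrite enorm0 expr0n/= addr0 => /eqP.
  by rewrite eqrXn2 ?enorm_ge0// => /eqP.
have Er (u : 'rV[R]_d) : enorm (row_mx (0 : 'rV[R]_d) u) = enorm u.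
  have := E 0 u; rewrite enorm0 expr0n/= add0r => /eqP.
  by rewrite eqrXn2 ?enorm_ge0// => /eqP.
have norm_le (r : R) : 0 <= r -> L * r <= `|L| * r by move=> r0; rewrite ler_wpM2r// ler_norm.
split=> [x x' y|x y y'].
- have := H (row_mx x y) (row_mx x' y); rewrite !row_mxKl !row_mxKr opp_row_mx add_row_mx subrr El.
  by move=> h; apply: le_trans h (norm_le _ (enorm_ge0 _)).
- have := H (row_mx x y) (row_mx x y'); rewrite !row_mxKl !row_mxKr opp_row_mx add_row_mx subrr Er.
  by move=> h; apply: le_trans h (norm_le _ (enorm_ge0 _)).
Qed.

Theorem theorem3 (R : realType) (d : nat)
    (eta : 'rV[R]_d -> 'rV[R]_d)
    (theta : 'rV[R]_d -> 'rV[R]_d -> 'rV[R]_d)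
    (eta_lip : elipschitz eta)
    (theta_lip : elipschitz
       (fun z : 'rV[R]_(d + d) => theta (lsubmx z) (rsubmx z)))
    (kappa : R -> R)
    (kappa_lip : [lipschitz kappa r | r in [set r | 0 <= r]])
    (kappa_neg : exists a b k : R, k < 0 /\
       forall r : R, 0 <= r -> ~ (a <= r <= b) -> kappa r = k)
    (eta_kappa : forall x y : 'rV[R]_d,
       dotp (x - y) (eta x - eta y) <=
         kappa (enorm (x - y)) * enorm (x - y) ^+ 2) :
  exists tau0 : R, 0 < tau0 /\
    forall tau : R, `|tau| <= tau0 ->
    forall x y : 'rV[R]_d,
    exists B c : R, 0 < B /\ 0 < c /\
      forall mu nu : R -> probability 'rV[R]_d R,
        mckean_vlasov_law eta theta tau x mu ->
        mckean_vlasov_law eta theta tau y nu ->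
        forall t : R, 0 <= t ->
          (tv_dist (mu t) (nu t) <= (B * expR (- (c * t)))%:E)%E.
Proof.
have [Lt1 HLt] := theta_lip; have [theta1L theta2L] := elip_row_mx HLt.
set Lt := `|Lt1| in theta1L theta2L; have Lt0 : 0 <= Lt by exact: normr_ge0.
have [Le1 HLe] := eta_lip; pose Le := `|Le1|; have Le0 : 0 <= Le by exact: normr_ge0.
have etaL x y : enorm (eta x - eta y) <= Le * enorm (x - y).
  by apply: le_trans (HLe x y) _; rewrite ler_wpM2r ?enorm_ge0// ler_norm.
clearbody Lt Le.
have [K [R0 [k0 [K0 R00 k00 kK kR]]]] := kappa_bound kappa_lip kappa_neg.
have d0 : 0 <= d%:R :> R by exact: ler0n.
have dL1 : 0 < d%:R * Lt + 1 by rewrite ltr_wpDl// mulr_ge0.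
(* For [|tau| <= tau1] the mean-field term raises [kappa] by at most 1, and by at most half of [k0],
   so that it stays negative far away. *)
pose tau1 := Num.min 1 (k0 / 2) / (d%:R * Lt + 1).
have m0 : 0 < Num.min 1 (k0 / 2) by rewrite lt_min ltr01 divr_gt0.
have tau10 : 0 < tau1 by rewrite divr_gt0.
have tdL : tau1 * (d%:R * Lt) <= Num.min 1 (k0 / 2).
  have : tau1 * (d%:R * Lt + 1) = Num.min 1 (k0 / 2) by rewrite divfK// gt_eqF.
  by rewrite mulrDr mulr1 => <-; rewrite lerDl ltW.
(* Built with [tau1] instead of [tau], as is [Lb] below: the contraction constants must be fixed
   before [tau], since the final bound on [tau] is expressed through them. *)
pose kap r := kappa r + tau1 * (d%:R * Lt).
have kapK r : 0 <= r -> kap r <= K + 1.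
  move=> r0; apply: lerD (kK r r0) (le_trans tdL _); by rewrite ge_min lexx.
have kapR r : R0 < r -> kap r <= - (k0 / 2).
  move=> rR; rewrite /kap (kR r rR).
  have : tau1 * (d%:R * Lt) <= k0 / 2 by apply: le_trans tdL _; rewrite ge_min lexx orbT.
  by move: (tau1 * _) => u; lra.
pose Lb := d%:R * (Le + tau1 * Lt).
have Lb0 : 0 <= Lb by rewrite mulr_ge0// addr_ge0// mulr_ge0// ltW.
have K1 : 1 <= K + 1 by rewrite lerDr.
have k20 : 0 < k0 / 2 by rewrite divr_gt0.
have [eps [q [c2 [M [h1 [[eps0 q0 c20 M0 h10] contr]]]]]] := gsign_contraction Lb K1 k20 R00.
(* Contraction runs at rate [c2 = 2 * c]; the surplus lets the mean-field gap decay at rate [c]. *)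
pose c := c2 / 2; have c0 : 0 < c by rewrite divr_gt0.
have cE : c * 2 = c2 by rewrite divfK.
pose Y := Lt / eps * (2 * M * d%:R / c).
have Y0 : 0 <= Y.
  apply: mulr_ge0; first by rewrite divr_ge0// ltW.
  by rewrite divr_ge0 ?(ltW c0)// mulr_ge0// mulr_ge0// ltW.
have Y1 : 0 < 2 * (Y + 1) by rewrite mulr_gt0// ltr_wpDl.
(* The second bound gives [|tau| * Y <= 1 / 2], which is [tau_small]; the 1 covers [Y = 0]. *)
exists (Num.min tau1 (2 * (Y + 1))^-1); split; first by rewrite lt_min tau10 invr_gt0.
move=> tau; rewrite le_min => /andP[tau_le tauY] x y.
have tau_small : Lt / eps * (2 * M * (d%:R * `|tau|) / c) <= 1 / 2.
  have -> : Lt / eps * (2 * M * (d%:R * `|tau|) / c) = `|tau| * Y by rewrite /Y; ring.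
  have h := ler_wpM2r (ltW Y1) tauY; rewrite mulVf ?gt_eqF// in h.
  have t0 := normr_ge0 tau; move: h; rewrite mulrCA mulrDr mulr1.
  by move: (`|tau|) (`|tau| * Y) t0 => u v; lra.
(* [lipschitz_gap] is applied with [K + 1 + 1], since [kap] is at most [K + 1] and smoothing asks
   for one more. *)
pose T0 := (4 * (K + 1 + 1))^-1.
have K2 : 1 <= K + 1 + 1 by rewrite lerDr addr_ge0.
(* The second summand serves times below [T0], where the difference of probabilities is at most
   [1 <= expR (c * (T0 - t))]; it also makes the constant positive. *)
exists (`|gap_constant tau Lt eps q c M x y T0| + expR (c * T0)), c; split.
  by rewrite ltr_wpDl// expR_gt0.
split; first exact: c0.
move=> mu nu lmu lnu t t0.
have Fmu := mckean_vlasov_euler_flow Le0 Lt0 etaL theta1L theta2L lmu.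
have Fnu := mckean_vlasov_euler_flow Le0 Lt0 etaL theta1L theta2L lnu.
have E0 := expR_gt0 (- (c * t)).
have thetaL z i : elip Lt (fun w => theta z w 0 i) by exact: theta_coord_elip theta2L z i.
have driftL (P : probability 'rV[R]_d R) :
    (forall z i, P.-integrable setT (fun w => (theta z w 0 i)%:E)) -> forall z z',
    enorm (mean_field_drift eta theta tau P z - mean_field_drift eta theta tau P z') <=
    Lb * enorm (z - z').
  move=> Pi z z'; apply: le_trans (mean_field_drift_lip tau etaL theta1L Pi z z') _.
  rewrite mulrA ler_wpM2r ?enorm_ge0// ler_wpM2l// lerD2l ler_wpM2r//.
have bL s (s0 : 0 <= s) := driftL _ (let: And5 H _ _ _ _ := Fmu in H s s0).
have b'L s (s0 : 0 <= s) := driftL _ (let: And5 H _ _ _ _ := Fnu in H s s0).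
have bk s : 0 <= s -> forall z z', dotp (z - z')
    (mean_field_drift eta theta tau (mu s) z - mean_field_drift eta theta tau (mu s) z') <=
    kap (enorm (z - z')) * enorm (z - z') ^+ 2.
  move=> s0 z z'; have Pi := let: And5 H _ _ _ _ := Fmu in H s s0.
  apply: le_trans (mean_field_drift_monotone tau theta1L Pi (eta_kappa z z')) _.
  by rewrite ler_wpM2r ?sqr_ge0// lerD2l ler_wpM2r// mulr_ge0.
have ct h r r' delta : 0 < h -> h <= h1 -> 0 <= r -> 0 <= r' -> 0 <= delta ->
    r' <= r * (1 + (h * kap r + h ^+ 2 * Lb ^+ 2 / 2)) + h * delta ->
    eps * r' + gsign (q + 4 * h) r' <=
      (1 - c * 2 * h) * (eps * r + gsign q r) + h * delta * M.
  by move=> h0 hh r0 r'0 dl0; rewrite cE; apply: contr => //; [exact: kapK|exact: kapR].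
have kapK' r : 0 <= r -> kap r <= K + 1 + 1 - 1 by rewrite addrK; exact: kapK.
apply: tv_dist_le => A mA; rewrite mulrDl.
case: (leP T0 t) => [Tt|tT]; last first.
- have h1' : fine (mu t A) <= 1.
    by rewrite -lee_fin fineK ?fin_num_measure//; exact: probability_le1.
  have h2' : 0 <= fine (nu t A) by rewrite fine_ge0.
  have h3 : 1 <= expR (c * T0) * expR (- (c * t)).
    rewrite -expRD -expR0 ler_expR subr_ge0 ler_wpM2l ?(ltW c0)//; exact: ltW.
  have h4 : 0 <= `|gap_constant tau Lt eps q c M x y T0| * expR (- (c * t)).
    by rewrite mulr_ge0// ltW.
  apply: (@le_trans _ _ (1 - 0)); first exact: lerB.
  by rewrite subr0 -[leLHS]add0r lerD.
- apply: (tv_le_elip _ mA) => L g gL g01.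
  apply: le_trans (lipschitz_gap Lt0 Lb0 thetaL bL b'L bk Fmu Fnu eps0 q0 c0 M0 h10 ct
    tau_small K2 kapK' erefl Tt gL g01) _.
  apply: (@le_trans _ _ (`|gap_constant tau Lt eps q c M x y T0| * expR (- (c * t)))).
    by rewrite ler_wpM2r ?(ltW E0)// ler_norm.
  by rewrite lerDl mulr_ge0// expR_ge0.
Qed.
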